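(* Let $A$ be a separable unital $C^*$-algebra of finite nuclear dimension and let $\alpha\in\mathrm{Aut}(A)$ be an automorphism with finite Rokhlin dimension $\dim_{\mathrm{Rok}}(\alpha)$. Then $A\rtimes_\alpha\mathbb Z$ has finite nuclear dimension, with $$\dim_{\mathrm{nuc}}(A\rtimes_\alpha\mathbb Z)\le 4\,(\dim_{\mathrm{Rok}}(\alpha)+1)(\dim_{\mathrm{nuc}}(A)+1)-1 .$$
   Context: Rokhlin dimension: for a unital $C^*$-algebra $A$ and $\alpha\in\mathrm{Aut}(A)$ (identified with the $\mathbb Z$-action it generates), $\dim_{\mathrm{Rok}}(\alpha)$ is the least natural number $d\ge 0$ (or $\infty$ if there is none) such that for any finite $F\subset A$, any $p\in\mathbb N$ and any $\varepsilon>0$ there are positive elements $f^{(l)}_{0,0},\ldots,f^{(l)}_{0,p-1},f^{(l)}_{1,0},\ldots,f^{(l)}_{1,p}\in A$, $l\in\{0,\ldots,d\}$, with (1) for any $l$, $\|f^{(l)}_{q,i}f^{(l)}_{r,j}\|<\varepsilon$ whenever $(q,i)\ne(r,j)$; (2) $\|\sum_{l=0}^d\sum_{r=0}^1\sum_{j=0}^{p-1+r}f^{(l)}_{r,j}-1\|<\varepsilon$; (3) $\|\alpha(f^{(l)}_{r,j})-f^{(l)}_{r,j+1}\|<\varepsilon$ for all $r\in\{0,1\}$, $j\in\{0,\ldots,p-2+r\}$ and all $l$; (4) $\|\alpha(f^{(l)}_{0,p-1}+f^{(l)}_{1,p})-(f^{(l)}_{0,0}+f^{(l)}_{1,0})\|<\varepsilon$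 for all $l$; (5) $\|[f^{(l)}_{r,j},a]\|<\varepsilon$ for all $r,j,l$ and $a\in F$. Nuclear dimension: c.p. = completely positive, c.p.c. = completely positive contractive. A c.p. map $\varphi$ has order zero if $\varphi(x)\varphi(y)=0$ for all positive $x,y$ with $xy=0$. $\dim_{\mathrm{nuc}}(A)$ is the least integer $n$ (or $\infty$) such that for every finite $F\subset A$ and $\varepsilon>0$ there are a finite-dimensional $C^*$-algebra $\mathcal F=\mathcal F^{(0)}\oplus\cdots\oplus\mathcal F^{(n)}$, a c.p.c. map $\psi:A\to\mathcal F$ and a c.p. map $\varphi:\mathcal F\to A$ with $\|\varphi\psi(b)-b\|<\varepsilon$ for all $b\in F$ and such that each restriction $\varphi|_{\mathcal F^{(i)}}$ is a c.p.c. order zero map. *)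

(* Defs.v *)
From HB Require Import structures.
From mathcomp Require Import all_boot all_order all_algebra.
From mathcomp Require Import complex.
From mathcomp Require Import all_classical all_reals all_analysis.

Set Implicit Arguments.
Unset Strict Implicit.
Unset Printing Implicit Defensive.

Import Order.TTheory GRing.Theory Num.Theory.
Import numFieldNormedType.Exports.

Local Open Scope classical_set_scope.
Local Open Scope ring_scope.

(** Unital C*-algebras over the complex numbers [R[i]], the zero algebra included.
    The norm of a [normedModType R[i]] takes its values in [R[i]] (they are
    nonnegative, hence real), and [0 < eps] for [eps : R[i]] says that [eps] is a
    positive real.  This is a record and not an HB structure because the hierarchy
    has no join of [pzRingType] and [normedModType] (their only common heirs are
    number domains); the ring structure is put on [cstar_sort] instead. *)
Record cstarType (R : realType) := CStarType {
  cstar_base : completeNormedModType R[i] ;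
  cmul : cstar_base -> cstar_base -> cstar_base ;
  cone : cstar_base ;
  cstar : cstar_base -> cstar_base ;
  cmulA : associative cmul ;
  cmul1 : left_id cone cmul ;
  cmulr1 : right_id cone cmul ;
  cmulDl : left_distributive cmul +%R ;
  cmulDr : right_distributive cmul +%R ;
  cscaleAl : forall (c : R[i]) x y, c *: cmul x y = cmul (c *: x) y ;
  cscaleAr : forall (c : R[i]) x y, c *: cmul x y = cmul x (c *: y) ;
  cnormM : forall x y, `|cmul x y| <= `|x| * `|y| ;
  cstarK : involutive cstar ;
  cstarD : forall x y, cstar (x + y) = cstar x + cstar y ;
  cstarZ : forall (c : R[i]) x, cstar (c *: x) = Num.conj c *: cstar x ;
  cstarM : forall x y, cstar (cmul x y) = cmul (cstar y) (cstar x) ;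
  cnorm_starM : forall x, `|cmul (cstar x) x| = `|x| ^+ 2
}.

Definition cstar_sort (R : realType) (A : cstarType R) : Type := cstar_base A.
Coercion cstar_sort : cstarType >-> Sortclass.

HB.instance Definition _ (R : realType) (A : cstarType R) :=
  CompleteNormedModule.copy (cstar_sort A) (cstar_base A).

HB.instance Definition _ (R : realType) (A : cstarType R) :=
  GRing.Zmodule_isPzRing.Build (cstar_sort A)
    (@cmulA R A) (@cmul1 R A) (@cmulr1 R A) (@cmulDl R A) (@cmulDr R A).

Definition star (R : realType) (A : cstarType R) (x : A) : A := cstar x.

Section NonnegMax.
Context {K : numDomainType} {I : finType} (g : I -> {nonneg K}).
Local Notation nnmax := (\big[Num.max/0%:nng]_i g i)%:num.

Lemma nnmax_ge0 : 0 <= nnmax.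
Proof. by []. Qed.

Lemma nnmax_ub i : (g i)%:num <= nnmax.
Proof. by rewrite num_le le_bigmax. Qed.

Lemma nnmax_le (c : K) : 0 <= c -> (forall i, (g i)%:num <= c) -> nnmax <= c.
Proof.
move=> c0 h; rewrite -[c]/((NngNum c0)%:num) num_le.
by apply: bigmax_le => [|i _]; rewrite -num_le /=.
Qed.

Lemma nnmax_lt (c : K) : 0 < c -> (forall i, (g i)%:num < c) -> nnmax < c.
Proof.
move=> c0 h; rewrite -[c]/((NngNum (ltW c0))%:num) num_lt.
by apply: bigmax_lt => [|i _]; rewrite -num_lt /=.
Qed.

End NonnegMax.

Section DirectSum.
Context {R : realType} {I : finType} (F : I -> cstarType R).

Definition dsum_sort : Type := forall i, F i.

Implicit Types x y z : dsum_sort.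

HB.instance Definition _ := gen_eqMixin dsum_sort.
HB.instance Definition _ := gen_choiceMixin dsum_sort.

Let ext x y : (forall i, x i = y i) -> x = y.
Proof. exact: functional_extensionality_dep. Qed.

Definition dsum_zero : dsum_sort := fun i => 0.
Definition dsum_opp x : dsum_sort := fun i => - x i.
Definition dsum_add x y : dsum_sort := fun i => x i + y i.
Definition dsum_one : dsum_sort := fun i => 1.
Definition dsum_mul x y : dsum_sort := fun i => x i * y i.
Definition dsum_scale (c : R[i]) x : dsum_sort := fun i => c *: x i.
Definition dsum_star x : dsum_sort := fun i => star (x i).

Let addA : associative dsum_add.
Proof. by move=> x y z; apply: ext => i; exact: addrA. Qed.
Let addC : commutative dsum_add.
Proof. by move=> x y; apply: ext => i; exact: addrC. Qed.
Let add0 : left_id dsum_zero dsum_add.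
Proof. by move=> x; apply: ext => i; exact: add0r. Qed.
Let addN : left_inverse dsum_zero dsum_opp dsum_add.
Proof. by move=> x; apply: ext => i; exact: addNr. Qed.

HB.instance Definition _ := GRing.isZmodule.Build dsum_sort addA addC add0 addN.

Let mulA : associative dsum_mul.
Proof. by move=> x y z; apply: ext => i; exact: mulrA. Qed.
Let mul1 : left_id dsum_one dsum_mul.
Proof. by move=> x; apply: ext => i; exact: mul1r. Qed.
Let mulr1' : right_id dsum_one dsum_mul.
Proof. by move=> x; apply: ext => i; exact: mulr1. Qed.
Let mulDl : left_distributive dsum_mul +%R.
Proof. by move=> x y z; apply: ext => i; exact: mulrDl. Qed.
Let mulDr : right_distributive dsum_mul +%R.
Proof. by move=> x y z; apply: ext => i; exact: mulrDr. Qed.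

Let scaleA (a b : R[i]) x : dsum_scale a (dsum_scale b x) = dsum_scale (a * b) x.
Proof. by apply: ext => i; exact: scalerA. Qed.
Let scale1 : left_id 1 dsum_scale.
Proof. by move=> x; apply: ext => i; exact: scale1r. Qed.
Let scaleDr : right_distributive dsum_scale +%R.
Proof. by move=> c x y; apply: ext => i; exact: scalerDr. Qed.
Let scaleDl x : {morph dsum_scale^~ x : a b / a + b}.
Proof. by move=> a b; apply: ext => i; exact: scalerDl. Qed.

HB.instance Definition _ :=
  GRing.Zmodule_isLmodule.Build R[i] dsum_sort scaleA scale1 scaleDr scaleDl.

(* [Num.max] is only well behaved on a total order, hence the detour through
   the nonnegative elements of [R[i]], as in the library's [mx_norm] *)
Definition dsum_norm x : R[i] :=
  (\big[Num.max/0%:nng]_i (`|x i|%:nng : {nonneg R[i]}))%:num.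

Let norm_ub x i : `|x i| <= dsum_norm x.
Proof. exact: (nnmax_ub (fun j => `|x j|%:nng)). Qed.

Let norm_ge0 x : 0 <= dsum_norm x.
Proof. exact: nnmax_ge0. Qed.

Let norm_le x (c : R[i]) : 0 <= c -> (forall i, `|x i| <= c) -> dsum_norm x <= c.
Proof. by move=> c0 h; exact: (nnmax_le (g := fun j => `|x j|%:nng)). Qed.

Let norm_lt x (c : R[i]) : 0 < c -> (forall i, `|x i| < c) -> dsum_norm x < c.
Proof. by move=> c0 h; exact: (nnmax_lt (g := fun j => `|x j|%:nng)). Qed.

Let norm_attained x : dsum_norm x = 0 \/ exists i, dsum_norm x = `|x i|.
Proof.
rewrite /dsum_norm; elim/big_ind: _ => [|a b ha hb|i _]; first by left.
  by rewrite /Num.max; case: ifP.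
by right; exists i.
Qed.

Let normD x y : dsum_norm (x + y) <= dsum_norm x + dsum_norm y.
Proof.
apply: norm_le => [|i]; first by rewrite addr_ge0.
by apply: le_trans (ler_normD _ _) _; rewrite lerD// norm_ub.
Qed.

Let normZ (c : R[i]) x : dsum_norm (c *: x) = `|c| * dsum_norm x.
Proof.
apply/le_anti/andP; split.
  apply: norm_le => [|i]; first by rewrite mulr_ge0.
  by rewrite [X in `|X|]/(c *: x i) normrZ ler_wpM2l// norm_ub.
case: (norm_attained x) => [->|[i ->]]; first by rewrite mulr0.
by rewrite -normrZ; exact: (norm_ub (c *: x)).
Qed.

Let norm_eq0 x : dsum_norm x = 0 -> x = 0.
Proof.
move=> x0; apply: ext => i; apply/normr0_eq0/le_anti.
by rewrite normr_ge0 -[in X in _ <= X]x0 norm_ub.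
Qed.

HB.instance Definition _ :=
  @Lmodule_isNormed.Build R[i] dsum_sort dsum_norm normD normZ norm_eq0.

Let complete (G : set_system dsum_sort) : ProperFilter G -> cauchy G -> cvg G.
Proof.
move=> GG /cauchy_ballP Gc.
have cvgi i : cvg ((fun x : dsum_sort => x i) @ G).
  apply: cauchy_cvg; apply/cauchy_ballP => e e0.
  have [[P Q] /= [GP GQ] PQ] := Gc e e0.
  exists ((fun x : dsum_sort => x i) @` P, (fun x : dsum_sort => x i) @` Q) => /=.
    by split; [apply: filterS GP | apply: filterS GQ] => x Px; exists x.
  move=> [_ _] /= [[x Px <-] [y Qy <-]].
  have := PQ (x, y) (conj Px Qy); rewrite -!ball_normE /=.
  by apply: le_lt_trans; exact: (norm_ub (x - y)).
apply/cvg_ex; exists ((fun i => lim ((fun x : dsum_sort => x i) @ G)) : dsum_sort).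
apply/cvgrPdist_lt => e e0; near=> x; apply: norm_lt => // i.
move: i; near: x; apply: filter_forall => i.
by move/cvgrPdist_lt: (cvgi i) => /(_ e e0).
Unshelve. all: by end_near. Qed.

HB.instance Definition _ := Uniform_isComplete.Build dsum_sort complete.

Let dscaleAl (c : R[i]) x y : c *: dsum_mul x y = dsum_mul (c *: x) y.
Proof. by apply: ext => i; exact: cscaleAl. Qed.
Let dscaleAr (c : R[i]) x y : c *: dsum_mul x y = dsum_mul x (c *: y).
Proof. by apply: ext => i; exact: cscaleAr. Qed.
Let dstarK : involutive dsum_star.
Proof. by move=> x; apply: ext => i; exact: cstarK. Qed.
Let dstarD x y : dsum_star (x + y) = dsum_star x + dsum_star y.
Proof. by apply: ext => i; exact: cstarD. Qed.
Let dstarZ (c : R[i]) x : dsum_star (c *: x) = Num.conj c *: dsum_star x.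
Proof. by apply: ext => i; exact: cstarZ. Qed.
Let dstarM x y : dsum_star (dsum_mul x y) = dsum_mul (dsum_star y) (dsum_star x).
Proof. by apply: ext => i; exact: cstarM. Qed.
Let dnormM x y : `|dsum_mul x y| <= `|x| * `|y|.
Proof.
apply: norm_le => [|i]; first by rewrite mulr_ge0.
by apply: le_trans (cnormM _ _) _; rewrite ler_pM//; exact: norm_ub.
Qed.
Let dnorm_starM x : `|dsum_mul (dsum_star x) x| = `|x| ^+ 2.
Proof.
apply/le_anti/andP; split.
  apply: norm_le => [|i]; first by rewrite exprn_ge0.
  rewrite [X in X <= _](cnorm_starM (x i)).
  by rewrite lerXn2r ?nnegrE//; exact: norm_ub.
rewrite -[`|x|]/(dsum_norm x).
case: (norm_attained x) => [->|[i ->]]; first by rewrite expr0n.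
rewrite -[X in X <= _](cnorm_starM (x i)).
exact: (norm_ub (dsum_mul (dsum_star x) x)).
Qed.

Definition dsum : cstarType R := @CStarType R dsum_sort dsum_mul dsum_one dsum_star
  mulA mul1 mulr1' mulDl mulDr dscaleAl dscaleAr dnormM
  dstarK dstarD dstarZ dstarM dnorm_starM.

End DirectSum.

Definition dsum_inj (R : realType) (I : finType) (F : I -> cstarType R) (i : I)
  (x : F i) : dsum F := dfwith (fun j => 0 : F j) i x.

Definition separable_space (T : topologicalType) : Prop :=
  exists2 D : set T, countable D & dense D.

(** The least natural number satisfying [P]; [None] stands for infinity. *)
Definition least (P : nat -> Prop) : option nat :=
  match pselect (exists n, `[< P n >]) with
  | left exP => Some (ex_minn exP)
  | right _ => None
  end.

Section CStarNotions.
Context {R : realType}.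
Implicit Types A B D : cstarType R.

Definition positive A (a : A) : Prop := exists b : A, a = star b * b.

(* the adjoint of the *-algebra M_n(A) *)
Definition mxstar A n (x : 'M[A]_n) : 'M[A]_n := map_mx (@star R A) x^T.

Definition mxpositive A n (x : 'M[A]_n) : Prop :=
  exists y : 'M[A]_n, x = mxstar y *m y.

Definition star_hom A B (f : A -> B) : Prop :=
  [/\ linear f, monoid_morphism f & forall a, f (star a) = star (f a)].

Definition star_automorphism A (alpha : A -> A) : Prop :=
  star_hom alpha /\ bijective alpha.

Definition completely_positive A B (f : A -> B) : Prop :=
  linear f /\
  forall n (x : 'M[A]_n), mxpositive x -> mxpositive (map_mx f x).

Definition contractive A B (f : A -> B) : Prop := forall a, `|f a| <= `|a|.

Definition cpc A B (f : A -> B) : Prop := completely_positive f /\ contractive f.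

Definition order_zero A B (f : A -> B) : Prop :=
  forall x y, positive x -> positive y -> x * y = 0 -> f x * f y = 0.

Definition finite_dimensional A : Prop :=
  exists (n : nat) (e : 'I_n -> A),
    forall x, exists c : 'I_n -> R[i], x = \sum_i c i *: e i.

Definition nuclear_approx A (n : nat) : Prop :=
  forall (F : seq A) (eps : R[i]), 0 < eps ->
  exists (E : 'I_n.+1 -> cstarType R) (psi : A -> dsum E) (phi : dsum E -> A),
    [/\ forall i, finite_dimensional (E i),
        cpc psi,
        completely_positive phi,
        forall b, b \in F -> `|phi (psi b) - b| < eps
      & forall i, cpc (phi \o @dsum_inj R _ E i) /\
                  order_zero (phi \o @dsum_inj R _ E i)].

Definition dim_nuc A : option nat := least (nuclear_approx A).

(** [f l r j] is the tower element f^(l)_{r,j}; only its values at the indices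
    [j < p + r] matter. *)
Definition rokhlin_towers A (alpha : A -> A) (d : nat) : Prop :=
  forall (F : seq A) (p : nat) (eps : R[i]), (0 < p)%N -> 0 < eps ->
  exists f : 'I_d.+1 -> 'I_2 -> nat -> A,
    (forall l (r : 'I_2) j, (j < p + r)%N -> positive (f l r j)) /\
    [/\ forall l (q r : 'I_2) i j, (i < p + q)%N -> (j < p + r)%N ->
          (q, i) <> (r, j) -> `|f l q i * f l r j| < eps,
        `|(\sum_(l < d.+1) \sum_(r < 2) \sum_(j < p + r) f l r j) - 1| < eps,
        forall l (r : 'I_2) j, (j.+1 < p + r)%N ->
          `|alpha (f l r j) - f l r j.+1| < eps,
        forall l, `|alpha (f l ord0 p.-1 + f l ord_max p)
                    - (f l ord0 0%N + f l ord_max 0%N)| < eps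
      & forall l (r : 'I_2) j a, (j < p + r)%N -> a \in F ->
          `|f l r j * a - a * f l r j| < eps].

Definition dim_Rok A (alpha : A -> A) : option nat :=
  least (rokhlin_towers alpha).

Definition covariant A (alpha : A -> A) B (iota : A -> B) (u : B) : Prop :=
  [/\ star_hom iota, star u * u = 1, u * star u = 1
    & forall a, iota (alpha a) = u * iota a * star u].

(** [B], with the canonical copy [iota] of [A] and the canonical unitary [u], is
    the (full) crossed product of [A] by the action of Z generated by [alpha]:
    the unital C*-algebra universal for covariant representations. *)
Definition crossed_product A (alpha : A -> A) B (iota : A -> B) (u : B) : Prop :=
  covariant alpha iota u /\
  forall D (pi : A -> D) (v : D), covariant alpha pi v ->
    exists! f : B -> D, [/\ star_hom f, forall a, f (iota a) = pi a & f u = v].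

End CStarNotions.

(* Main.v *)
(** Taking [p = 2m] in the definition of Rokhlin dimension, each color gives three chains
    [s, alpha s, alpha^2 s, ..] of almost orthogonal, almost central positive elements: the
    two towers and a third chain running through both, started half way up.  With tent
    weights of slope [1/m], the sum of all chains is still close to [1].

    Let [psi, phi] be an approximation of [A] with [n + 1] order zero summands [phi_i], let [h]
    be the height of a chain and [E] the conditional expectation of the crossed product.  The
    compression of [b] to the matrix [psi_i (w_p E (u^-p b u^q) w_q)], followed by the map
    [Y |-> \sum_pq u^p g phi_i (Y_pq) g u^-q] with [g = sqrt s], almost gives [b] when summed
    over [i], the chains and the colors; this is seen on the monomials [u^-i a u^j], because
    the weights vary slowly.

    The second map is close to an order zero map.  If [e_j] is an orthonormal basis of the
    finite-dimensional algebra for the regular trace, then [\sum_j e_j e_j^* = 1], and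
    [phi x] is close to [r X(x) r^*], where [X] is the regular representation and the Gram
    matrix of the row [r_j = (phi 1 + eta)^(-1/2) phi (e_j)] commutes with [X].  Hence the
    second map is close to [V (Y (x) X) V^*] for the row [V = (u^p g r_j)], whose Gram matrix
    is close to a positive matrix [a] commuting with the amplified representation.  Such a [V]
    is close to some [z] whose Gram matrix lies in the bicommutant of [a], and compressing a
    representation by [z^*] is exactly of order zero.

    There are [3 (d + 1) (n + 1)] summands in all. *)

From HB Require Import structures.
Require Import Defs.
From mathcomp Require Import all_boot all_order all_algebra.
From mathcomp Require Import complex.
From mathcomp Require Import all_classical all_reals all_analysis.
From mathcomp Require Import zify ring lra.

Set Implicit Arguments.
Unset Strict Implicit.
Unset Printing Implicit Defensive.

Import Order.TTheory GRing.Theory Num.Theory.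
Import numFieldNormedType.Exports.

Local Open Scope classical_set_scope.
Local Open Scope ring_scope.
Local Open Scope complex_scope.

(** * Noncommutative identities *)

(** The obstacle is exactness: the towers are only approximate, yet the maps built on them must be
    of order zero on the nose. The usual remedy is projectivity of cones over finite-dimensional
    algebras. Here all relations are packed into a single operator, the row [V], and only its Gram
    matrix has to be corrected. The cost is a tolerance that depends on [phi] and on the height, so
    the order of choices is rigid: the monomials fix the height, both fix [psi] and [phi], and these
    fix the accuracy asked of the towers.

    [alpha] links the two towers of a color only through the sum of their tops and the sum of their
    bottoms. One closing chain has to take both towers together, and one is then enough; this gives
    3 chains where two per tower would give 4.

    The crossed product is known by its universal property alone, which is used twice: mapping to
    the regular representation yields [E], and mapping to the subalgebra generated by the covariant
    pair yields the density of the monomials.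

    No spectrum or functional calculus is used: positivity is a metric condition, square roots are
    limits of an iteration, and lying in a bicommutant stands for being a function of an element. *)

Inductive ncexp (K : Type) :=
  | NCvar of nat | NC0 | NC1
  | NCadd of ncexp K & ncexp K | NCmul of ncexp K & ncexp K | NCopp of ncexp K
  | NCscale of K & ncexp K | NCmuln of ncexp K & nat | NCexp of ncexp K & nat.
Arguments NCvar {K}.
Arguments NC0 {K}.
Arguments NC1 {K}.

Section NCRing.
Variables (R : realType) (A : cstarType R).
Local Notation K := R[i].

Fixpoint nc_eval (env : seq A) (e : ncexp K) : A :=
  match e with
  | NCvar i => nth 0 env i
  | NC0 => 0
  | NC1 => 1
  | NCadd a b => nc_eval env a + nc_eval env b
  | NCmul a b => nc_eval env a * nc_eval env b
  | NCopp a => - nc_eval env a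
  | NCscale c a => c *: nc_eval env a
  | NCmuln a n => nc_eval env a *+ n
  | NCexp a n => nc_eval env a ^+ n
  end.

Definition ncpoly := seq (K * seq nat).

Definition word_eval (env : seq A) (w : seq nat) : A :=
  foldr (fun i x => nth 0 env i * x) 1 w.

Definition poly_eval (env : seq A) (p : ncpoly) : A :=
  foldr (fun m x => m.1 *: word_eval env m.2 + x) 0 p.

Definition nc_scale (c : K) (p : ncpoly) : ncpoly :=
  map (fun m => (c * m.1, m.2)) p.

Definition nc_mulm (m : K * seq nat) (p : ncpoly) : ncpoly :=
  map (fun m' => (m.1 * m'.1, app m.2 m'.2)) p.

Definition nc_mul (p q : ncpoly) : ncpoly :=
  foldr (fun m r => app (nc_mulm m q) r) nil p.

Fixpoint nc_exp (p : ncpoly) (n : nat) : ncpoly :=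
  if n is n'.+1 then nc_mul p (nc_exp p n') else [:: (1, [::])].

Fixpoint nc_norm (e : ncexp K) : ncpoly :=
  match e with
  | NCvar i => [:: (1, [:: i])]
  | NC0 => [::]
  | NC1 => [:: (1, [::])]
  | NCadd a b => app (nc_norm a) (nc_norm b)
  | NCmul a b => nc_mul (nc_norm a) (nc_norm b)
  | NCopp a => nc_scale (-1) (nc_norm a)
  | NCscale c a => nc_scale c (nc_norm a)
  | NCmuln a n => nc_scale (n%:R) (nc_norm a)
  | NCexp a n => nc_exp (nc_norm a) n
  end.

(** Comparison of words is a closed recursion, so that [cbv] on a fixed list of constants evaluates
    it while the coefficients in [R[i]], which may contain variables, are left intact for [ring] and
    [field]. *)
Fixpoint nat_eqb (m n : nat) : bool :=
  match m, n with O, O => true | S m, S n => nat_eqb m n | _, _ => false end.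

Fixpoint word_eqb (v w : seq nat) : bool :=
  match v, w with
  | nil, nil => true
  | i :: v, j :: w => if nat_eqb i j then word_eqb v w else false
  | _, _ => false
  end.

Fixpoint nc_insert (c : K) (w : seq nat) (p : ncpoly) : ncpoly :=
  match p with
  | nil => [:: (c, w)]
  | m :: p => if word_eqb w m.2 then (c + m.1, m.2) :: p
              else m :: nc_insert c w p
  end.

Definition nc_collect (p : ncpoly) : ncpoly :=
  foldr (fun m r => nc_insert m.1 m.2 r) nil p.

Fixpoint nc_zero (p : ncpoly) : Prop :=
  match p with
  | nil => True
  | m :: p => m.1 = 0 /\ nc_zero p
  end.

Lemma nat_eqbP m n : nat_eqb m n -> m = n.
Proof. by elim: m n => [|m IH] [|n] //= /IH ->. Qed.

Lemma word_eqbP v w : word_eqb v w -> v = w.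
Proof.
elim: v w => [|i v IH] [|j w] //=.
by case: ifP => // /nat_eqbP -> /IH ->.
Qed.

Lemma word_eval_app env v w :
  word_eval env (app v w) = word_eval env v * word_eval env w.
Proof. by elim: v => [|i v IH] /=; rewrite ?mul1r// IH mulrA. Qed.

Lemma poly_eval_app env p q :
  poly_eval env (app p q) = poly_eval env p + poly_eval env q.
Proof. by elim: p => [|m p IH] /=; rewrite ?add0r// IH addrA. Qed.

Lemma poly_eval_scale env c p : poly_eval env (nc_scale c p) = c *: poly_eval env p.
Proof. by elim: p => [|m p IH] /=; rewrite ?scaler0// IH scalerDr scalerA. Qed.

Lemma scAl (c : K) (x y : A) : c *: x * y = c *: (x * y).
Proof. by symmetry; exact: cscaleAl. Qed.

Lemma scAr (c : K) (x y : A) : x * (c *: y) = c *: (x * y).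
Proof. by symmetry; exact: cscaleAr. Qed.

Lemma poly_eval_mulm env m p :
  poly_eval env (nc_mulm m p) = m.1 *: word_eval env m.2 * poly_eval env p.
Proof.
elim: p => [|m' p IH] /=; first by rewrite mulr0.
by rewrite IH word_eval_app mulrDr !scAl scAr scalerA.
Qed.

Lemma poly_eval_mul env p q :
  poly_eval env (nc_mul p q) = poly_eval env p * poly_eval env q.
Proof.
elim: p => [|m p IH] /=; first by rewrite mul0r.
by rewrite poly_eval_app IH poly_eval_mulm mulrDl.
Qed.

Lemma poly_eval_exp env p n : poly_eval env (nc_exp p n) = poly_eval env p ^+ n.
Proof.
elim: n => [|n IH] /=; first by rewrite scale1r addr0 expr0.
by rewrite poly_eval_mul IH exprS.
Qed.

Lemma nc_normP env e : poly_eval env (nc_norm e) = nc_eval env e.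
Proof.
elim: e => //= [i|||||||].
- by rewrite scale1r addr0 mulr1.
- by rewrite scale1r addr0.
- by move=> a IHa b IHb; rewrite poly_eval_app IHa IHb.
- by move=> a IHa b IHb; rewrite poly_eval_mul IHa IHb.
- by move=> a IH; rewrite poly_eval_scale IH scaleN1r.
- by move=> c a IH; rewrite poly_eval_scale IH.
- by move=> a IH n; rewrite poly_eval_scale IH scaler_nat.
- by move=> a IH n; rewrite poly_eval_exp IH.
Qed.

Lemma nc_insertP env c w p :
  poly_eval env (nc_insert c w p) = c *: word_eval env w + poly_eval env p.
Proof.
elim: p => [|m p IH] //=; case: ifP => [/word_eqbP ->|_] /=.
  by rewrite scalerDl addrA.
by rewrite IH addrCA.
Qed.

Lemma nc_collectP env p : poly_eval env (nc_collect p) = poly_eval env p.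
Proof. by elim: p => //= m p IH; rewrite nc_insertP IH. Qed.

Lemma nc_zeroP env p : nc_zero p -> poly_eval env p = 0.
Proof.
by elim: p => //= m p IH [-> /IH ->]; rewrite scale0r addr0.
Qed.

Lemma nc_correct env e1 e2 :
  nc_zero (nc_collect (nc_norm (NCadd e1 (NCopp e2)))) ->
  nc_eval env e1 = nc_eval env e2.
Proof.
move=> /(nc_zeroP env); rewrite nc_collectP nc_normP /= => /eqP.
by rewrite subr_eq0 => /eqP.
Qed.

End NCRing.

Ltac nc_mem x l :=
  lazymatch l with
  | nil => constr:(false)
  | cons ?y ?l' =>
      match constr:(tt) with
      | _ => let _ := match constr:(tt) with _ => unify x y end in constr:(true)
      | _ => nc_mem x l'
      end
  end.

Ltac nc_index x l :=
  lazymatch l with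
  | cons ?y ?l' =>
      match constr:(tt) with
      | _ => let _ := match constr:(tt) with _ => unify x y end in constr:(O)
      | _ => let n := nc_index x l' in constr:(S n)
      end
  end.

Ltac nc_env A l t :=
  lazymatch t with
  | @Algebra.add _ ?a ?b => let l := nc_env A l a in nc_env A l b
  | @GRing.mul _ ?a ?b => let l := nc_env A l a in nc_env A l b
  | @Algebra.opp _ ?a => nc_env A l a
  | @GRing.scale _ _ _ ?a => nc_env A l a
  | @Algebra.natmul _ ?a _ => nc_env A l a
  | @GRing.exp _ ?a _ => nc_env A l a
  | @Algebra.zero _ => l
  | @GRing.one _ => l
  | _ => let b := nc_mem t l in
         lazymatch b with true => l | false => constr:(@cons (cstar_sort A) t l) end
  end.

Ltac nc_reify K l t :=
  lazymatch t with
  | @Algebra.add _ ?a ?b =>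
      let a := nc_reify K l a in let b := nc_reify K l b in constr:(@NCadd K a b)
  | @GRing.mul _ ?a ?b =>
      let a := nc_reify K l a in let b := nc_reify K l b in constr:(@NCmul K a b)
  | @Algebra.opp _ ?a => let a := nc_reify K l a in constr:(@NCopp K a)
  | @GRing.scale _ _ ?c ?a => let a := nc_reify K l a in constr:(@NCscale K c a)
  | @Algebra.natmul _ ?a ?n => let a := nc_reify K l a in constr:(@NCmuln K a n)
  | @GRing.exp _ ?a ?n => let a := nc_reify K l a in constr:(@NCexp K a n)
  | @Algebra.zero _ => constr:(@NC0 K)
  | @GRing.one _ => constr:(@NC1 K)
  | _ => let n := nc_index t l in constr:(@NCvar K n)
  end.

Ltac nc_start :=
  lazymatch goal with
  | |- @eq _ ?x ?y =>
    let T := type of x in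
    let A := lazymatch type of (x : cstar_sort _) with @cstar_sort _ ?A => A end in
    let R := lazymatch type of A with cstarType ?R => R end in
    let l := nc_env A (@nil (cstar_sort A)) x in
    let l := nc_env A l y in
    let e1 := nc_reify (complex (Real.sort R)) l x in
    let e2 := nc_reify (complex (Real.sort R)) l y in
    refine (@nc_correct R A l e1 e2 _);
    cbv [nc_collect nc_norm nc_mul nc_mulm nc_scale nc_exp nc_insert nc_zero foldr
      map app word_eqb nat_eqb fst snd]
  end.

(* Identities in a C*-algebra, proved by comparing the coefficients in [R[i]] of
   noncommutative normal forms. *)
Ltac nc := nc_start; repeat split; by [ring | field].

(** * Norms and limits *)

Notation "t *^ x" := (t%:C *: x) (at level 40) : ring_scope.

Notation sca t := (t%:C *: (1 : cstar_sort _)).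
Notation imi := (@Complex _ 0 1).

Section Norm.
Variable R : realType.
Implicit Types A : cstarType R.

(** The norm lives in [R[i]], out of reach of [lra] and [nra]. By [nrmE] its real part loses
    nothing. *)
Definition nrm A (x : A) : R := complex.Re `|x|.

Lemma nrmE A (x : A) : `|x| = (nrm x)%:C.
Proof. by rewrite /nrm RRe_real// ger0_real. Qed.

Lemma nrm_ge0 A (x : A) : 0 <= nrm x.
Proof. by rewrite -ler0c -nrmE. Qed.

Lemma nrm0 A : nrm (0 : A) = 0.
Proof. by rewrite /nrm normr0. Qed.

Lemma nrm_eq0 A (x : A) : nrm x = 0 -> x = 0.
Proof. by move=> x0; apply: normr0_eq0; rewrite nrmE x0. Qed.

Lemma nrmD A (x y : A) : nrm (x + y) <= nrm x + nrm y.
Proof. by rewrite -lecR rmorphD/= -!nrmE ler_normD. Qed.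

Lemma nrmN A (x : A) : nrm (- x) = nrm x.
Proof. by rewrite /nrm normrN. Qed.

Lemma nrmB A (x y : A) : nrm (x - y) <= nrm x + nrm y.
Proof. by rewrite -(nrmN y) nrmD. Qed.

Lemma nrmBC A (x y : A) : nrm (x - y) = nrm (y - x).
Proof. by rewrite -nrmN opprB. Qed.

Lemma nrm_tri A (x y z : A) : nrm (x - z) <= nrm (x - y) + nrm (y - z).
Proof. by rewrite -[x - z](subrKA y) nrmD. Qed.

Lemma nrmM A (x y : A) : nrm (x * y) <= nrm x * nrm y.
Proof. by rewrite -lecR rmorphM/= -!nrmE; exact: cnormM. Qed.

Lemma nrmM_le A (x y : A) (C D : R) : nrm x <= C -> nrm y <= D -> nrm (x * y) <= C * D.
Proof. by move=> xC yD; apply: le_trans (nrmM _ _) _; apply: ler_pM => //; exact: nrm_ge0. Qed.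

Lemma nrmM1 A (x y : A) : nrm x <= 1 -> nrm y <= 1 -> nrm (x * y) <= 1.
Proof. by move=> x1 y1; have := nrmM_le x1 y1; rewrite mulr1. Qed.

Lemma nrmZ A (c : R[i]) (x : A) : nrm (c *: x) = complex.Re `|c| * nrm x.
Proof.
apply: complexI; rewrite -nrmE normrZ nrmE rmorphM/=.
by rewrite RRe_real// ger0_real.
Qed.

Lemma nrmZr A (t : R) (x : A) : nrm (t *^ x) = `|t| * nrm x.
Proof.
rewrite nrmZ; congr (_ * _).
by rewrite normc_def /= expr0n addr0 sqrtr_sqr.
Qed.

Lemma nrm_i A (x : A) : nrm (imi *: x) = nrm x.
Proof. by rewrite nrmZ normc_def /= expr0n add0r expr1n sqrtr1 mul1r. Qed.

Lemma nrm_sum A (I : Type) (s : seq I) (P : pred I) (F : I -> A) :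
  nrm (\sum_(i <- s | P i) F i) <= \sum_(i <- s | P i) nrm (F i).
Proof.
elim/big_rec2: _ => [|i y x _ h]; first by rewrite nrm0.
by apply: le_trans (nrmD _ _) _; rewrite lerD2l.
Qed.

Lemma starK A (x : A) : star (star x) = x.
Proof. exact: cstarK. Qed.

Lemma starD A (x y : A) : star (x + y) = star x + star y.
Proof. exact: cstarD. Qed.

Lemma starZ A (c : R[i]) (x : A) : star (c *: x) = conjc c *: star x.
Proof. exact: cstarZ. Qed.

Lemma starZr A (t : R) (x : A) : star (t *^ x) = t *^ star x.
Proof. by rewrite starZ; congr (_ *: _); exact: conjc_real. Qed.

Lemma starM A (x y : A) : star (x * y) = star y * star x.
Proof. exact: cstarM. Qed.

Lemma star0 A : star (0 : A) = 0.
Proof. by apply: (addrI (star 0)); rewrite -starD !addr0. Qed.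

Lemma starN A (x : A) : star (- x) = - star x.
Proof. by apply: (addrI (star x)); rewrite -starD !subrr star0. Qed.

Lemma starB A (x y : A) : star (x - y) = star x - star y.
Proof. by rewrite starD starN. Qed.

Lemma star1 A : star (1 : A) = 1.
Proof. by rewrite -[RHS]starK -[in RHS](mul1r (star 1)) starM starK mul1r. Qed.

Lemma starX A (x : A) n : star (x ^+ n) = star x ^+ n.
Proof. by elim: n => [|n IH]; rewrite ?expr0 ?star1// exprS starM IH -exprSr. Qed.

Lemma star_sum A (I : Type) (s : seq I) (P : pred I) (F : I -> A) :
  star (\sum_(i <- s | P i) F i) = \sum_(i <- s | P i) star (F i).
Proof. by apply: (big_morph _ (@starD A)); exact: star0. Qed.

Lemma nrm_starM A (x : A) : nrm (star x * x) = nrm x ^+ 2.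
Proof. by apply: complexI; rewrite -nrmE rmorphXn/= -nrmE; exact: cnorm_starM. Qed.

Lemma nrm_star A (x : A) : nrm (star x) = nrm x.
Proof.
suff le (y : A) : nrm y <= nrm (star y).
  by apply/le_anti; rewrite le andbT -{2}(starK x) le.
have := nrmM (star y) y; rewrite nrm_starM expr2.
have [y0|y0] := leP (nrm y) 0; first by rewrite (le_trans y0)// nrm_ge0.
by rewrite ler_pM2r.
Qed.

Lemma nrm_sa A (x : A) : star x = x -> nrm (x * x) = nrm x ^+ 2.
Proof. by move=> {1}<-; exact: nrm_starM. Qed.

(** The C*-identity makes [nrm 1] a root of [t^2 = t]; the root 0 belongs to the zero algebra, which
    is allowed. *)
Lemma nrm1_le A : nrm (1 : A) <= 1.
Proof.
have := nrm_sa (star1 A); rewrite mulr1 expr2 => h.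
have := nrm_ge0 (1 : A); nra.
Qed.

Lemma conj_imi : conjc imi = - imi :> R[i].
Proof. by apply/eqP; rewrite eq_complex /= oppr0 !eqxx. Qed.

Lemma mul_imi : imi * imi = -1 :> R[i].
Proof. by rewrite -expr2 sqr_i. Qed.

Definition climit A (x : nat -> A) (l : A) : Prop :=
  forall e : R, 0 < e -> exists N, forall n, (N <= n)%N -> nrm (x n - l) < e.

Lemma climit_unique A (x : nat -> A) l l' : climit x l -> climit x l' -> l = l'.
Proof.
move=> xl xl'; apply/eqP; rewrite -subr_eq0; apply/eqP/nrm_eq0/le_anti.
rewrite nrm_ge0 andbT leNgt; apply/negP => d0.
have d2 : 0 < nrm (l - l') / 2 by lra.
have [N h] := xl _ d2; have [N' h'] := xl' _ d2.
have := h (maxn N N') (leq_maxl _ _); have := h' (maxn N N') (leq_maxr _ _).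
by move=> a b; have := nrm_tri l (x (maxn N N')) l'; rewrite (nrmBC l (x _)); lra.
Qed.

Lemma climit_cauchy A (x : nat -> A) :
  (forall e : R, 0 < e -> exists N, forall m n, (N <= m)%N -> (N <= n)%N ->
     nrm (x m - x n) < e) -> exists l, climit x l.
Proof.
move=> xc.
have /cauchy_cvg/cvg_ex[l xl] : cauchy ((x : nat -> A) @ \oo).
  apply/cauchy_ballP => e; rewrite ltcE => /andP[/eqP/= e0 e1].
  have [N h] := xc _ e1.
  exists ((x @` [set n | (N <= n)%N]), (x @` [set n | (N <= n)%N])).
    by split; exists N => // n Nn; exists n.
  move=> [_ _] /= [[m Nm <-] [n Nn <-]]; rewrite -ball_normE /=.
  by rewrite nrmE ltcE /= e0 eqxx h.
exists l => e e0; have e1 : 0 < e%:C by rewrite ltcR.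
have /cvgrPdist_lt/(_ _ e1)[N _ h] := xl.
by exists N => n Nn; have := h n Nn; rewrite nrmE ltcR nrmBC.
Qed.

(** Telescoping bounds [x m - x n] by the increments of a bounded nondecreasing sequence. This
    serves the Neumann series and the square root iteration. *)
Lemma climit_dom A (x : nat -> A) (s : nat -> R) (C : R) :
  (forall n, nrm (x n.+1 - x n) <= s n.+1 - s n) -> (forall n, s n <= C) ->
  exists l, climit x l.
Proof.
move=> xs sC.
have sS n : s n <= s n.+1 by rewrite -subr_ge0 (le_trans _ (xs n))// nrm_ge0.
have snd : nondecreasing_seq s by apply/nondecreasing_seqP.
have xm m k : nrm (x (m + k)%N - x m) <= s (m + k)%N - s m.
  elim: k => [|k IH]; first by rewrite addn0 !subrr nrm0.
  rewrite addnS; have := xs (m + k)%N => h.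
  have := nrmD (x (m + k).+1 - x (m + k)%N) (x (m + k)%N - x m).
  rewrite subrKA; lra.
have scv : cvgn s.
  by apply: nondecreasing_is_cvgn => //; exists C => _ [n _ <-].
apply: climit_cauchy => e e0; have e2 : 0 < e / 2 by lra.
have /cvgrPdist_lt/(_ _ e2)[N _ h] := scv.
have slim n : s n <= limn s by apply: nondecreasing_cvgn_le.
have xN n : (N <= n)%N -> nrm (x n - x N) < e / 2.
  move=> Nn; rewrite -(subnKC Nn); apply: le_lt_trans (xm _ _) _.
  rewrite subnKC//; have := h N (leqnn N); have := slim n; have := slim N.
  by move=> /= a b c; have := ler_norm (lim (s @ \oo) - s N); lra.
exists N => m n Nm Nn; have := nrm_tri (x m) (x N) (x n); rewrite (nrmBC (x N)).
by have := xN m Nm; have := xN n Nn; lra.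
Qed.

Lemma climit_lip A (B : cstarType R) (f : A -> B) (C : R) (x : nat -> A) (l : A) :
  (forall y z, nrm (f y - f z) <= C * nrm (y - z)) -> climit x l ->
  climit (fun n => f (x n)) (f l).
Proof.
move=> fC xl e e0.
have C1 : 0 < `|C| + 1 by have := normr_ge0 C; lra.
have [N h] := xl (e / (`|C| + 1)) (divr_gt0 e0 C1).
exists N => n /h; rewrite ltr_pdivlMr//= => h'.
have := fC (x n) l; have := nrm_ge0 (x n - l); have := ler_norm C; nra.
Qed.

Lemma climitMl A (a : A) x l : climit x l -> climit (fun n => a * x n) (a * l).
Proof.
apply: (@climit_lip _ _ ( *%R a) (nrm a)) => y z.
by rewrite -mulrBr nrmM.
Qed.

Lemma climitMr A (a : A) x l : climit x l -> climit (fun n => x n * a) (l * a).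
Proof.
apply: (@climit_lip _ _ ( *%R^~ a) (nrm a)) => y z.
by rewrite -mulrBl mulrC nrmM.
Qed.

Lemma climit_star A (x : nat -> A) l : climit x l -> climit (fun n => star (x n)) (star l).
Proof.
by apply: (@climit_lip _ _ (@star R A) 1) => y z; rewrite -starB nrm_star mul1r.
Qed.

Lemma climitD A (x y : nat -> A) l m :
  climit x l -> climit y m -> climit (fun n => x n + y n) (l + m).
Proof.
move=> xl ym e e0; have e2 : 0 < e / 2 by lra.
have [N h] := xl _ e2; have [M h'] := ym _ e2.
exists (maxn N M) => n; rewrite geq_max => /andP[/h a /h' b].
have := nrmD (x n - l) (y n - m); rewrite addrACA -opprD; lra.
Qed.

Lemma climit_cst A (a : A) : climit (fun=> a) a.
Proof. by move=> e e0; exists 0%N => n _; rewrite subrr nrm0. Qed.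

Lemma climitB A (x y : nat -> A) l m :
  climit x l -> climit y m -> climit (fun n => x n - y n) (l - m).
Proof.
move=> xl ym; apply: climitD => //.
apply: (@climit_lip _ _ -%R 1) ym => a b.
by rewrite -opprD nrmN mul1r.
Qed.

Lemma climitM A (x y : nat -> A) l m :
  climit x l -> climit y m -> climit (fun n => x n * y n) (l * m).
Proof.
move=> xl ym e e0.
have [K Kx] : exists K, 0 < K /\ nrm m <= K.
  by exists (nrm m + 1); have := nrm_ge0 m; lra.
have [L Ly] : exists L, 0 < L /\ nrm l <= L.
  by exists (nrm l + 1); have := nrm_ge0 l; lra.
pose d := Num.min 1 (e / (2 * (K + L + 1))).
have KL : 0 < 2 * (K + L + 1) by lra.
have d0 : 0 < d by rewrite lt_min ltr01 divr_gt0.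
have [N h] := xl _ d0; have [M h'] := ym _ d0.
exists (maxn N M) => n; rewrite geq_max => /andP[/h a /h' b].
have -> : x n * y n - l * m = (x n - l) * (y n - m) + (x n - l) * m + l * (y n - m).
  by rewrite !mulrBl !mulrBr !addrA; nc.
have d1 : d <= 1 by rewrite ge_min lexx.
have d2 : d * (2 * (K + L + 1)) <= e by rewrite -ler_pdivlMr// ge_min lexx orbT.
apply: le_lt_trans (nrmD _ _) _.
have := nrmD ((x n - l) * (y n - m)) ((x n - l) * m).
have := nrmM (x n - l) (y n - m); have := nrmM (x n - l) m; have := nrmM l (y n - m).
have := nrm_ge0 (x n - l); have := nrm_ge0 (y n - m).
have := nrm_ge0 m; have := nrm_ge0 l.
move: (nrm (x n - l)) (nrm (y n - m)) a b => u v a b; nra.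
Qed.

Lemma climit_le A (x : nat -> A) l C :
  climit x l -> (forall n, nrm (x n) <= C) -> nrm l <= C.
Proof.
move=> xl xC; rewrite leNgt; apply/negP => h.
have [|N /(_ N (leqnn N)) hN] := xl (nrm l - C); first by lra.
have := nrmB (x N) (x N - l); rewrite opprB addrC subrK.
by have := xC N; lra.
Qed.

Lemma climit_comm A (x : nat -> A) l c :
  climit x l -> (forall n, c * x n = x n * c) -> c * l = l * c.
Proof.
move=> xl cx; apply: (climit_unique (climitMl c xl)).
by under eq_fun do rewrite cx; exact: climitMr.
Qed.

End Norm.

(** * Square roots and positivity *)

Section Sqrt.
Variable R : realType.
Implicit Types A : cstarType R.

(** This is membership in the bicommutant of [a]. It records that [x] is a function of [a]: such
    elements commute with one another and with all that commutes with [a], and the property passes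
    to limits. *)
Definition commutant A (a x : A) : Prop := forall c, c * a = a * c -> c * x = x * c.

Lemma commutant_id A (a : A) : commutant a a. Proof. by []. Qed.

Lemma commutantD A (a x y : A) : commutant a x -> commutant a y -> commutant a (x + y).
Proof. by move=> hx hy c ca; rewrite mulrDl mulrDr hx// hy. Qed.

Lemma commutantB A (a x y : A) : commutant a x -> commutant a y -> commutant a (x - y).
Proof. by move=> hx hy c ca; rewrite mulrBl mulrBr hx// hy. Qed.

Lemma commutantM A (a x y : A) : commutant a x -> commutant a y -> commutant a (x * y).
Proof. by move=> hx hy c ca; rewrite mulrA hx// -!mulrA hy. Qed.

Lemma commutantZ A (a x : A) (t : R[i]) : commutant a x -> commutant a (t *: x).
Proof. by move=> hx c ca; rewrite scAl scAr hx. Qed.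

Lemma commutant1 A (a : A) : commutant a 1.
Proof. by move=> c _; rewrite mulr1 mul1r. Qed.

Lemma commutant_trans A (a x y : A) : commutant a x -> commutant x y -> commutant a y.
Proof. by move=> ax xy c /ax; exact: xy. Qed.

Lemma climit_commutant A (a : A) x l :
  climit x l -> (forall n, commutant a (x n)) -> commutant a l.
Proof. by move=> xl ax c ca; apply: (climit_comm xl) => n; exact: ax. Qed.

Lemma climitS A (x : nat -> A) l : climit x l -> climit (fun n => x n.+1) l.
Proof. by move=> xl e /xl[N h]; exists N => n Nn; apply: h; exact: ltnW. Qed.

Fixpoint neumann A (y : A) n : A := if n is n.+1 then 1 + y * neumann y n else 0.

(** The partial sums, in Horner form, are majorized by the scalar geometric series; the limit solves
    [z = 1 + y z] and commutes with [y], so it inverts [1 - y] on both sides. *)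
Lemma neumann_inv A (y : A) : nrm y < 1 ->
  exists z : A, [/\ z * (1 - y) = 1, (1 - y) * z = 1 & commutant y z].
Proof.
set r := nrm y => r1; have r0 : 0 <= r by exact: nrm_ge0.
have step n : nrm (neumann y n.+1 - neumann y n) <= r ^+ n.
  elim: n => [|n IH]; first by rewrite /= mulr0 addr0 subr0 expr0 nrm1_le.
  rewrite exprS -[neumann y n.+2]/(1 + y * neumann y n.+1) [neumann y n.+1 in X in _ - X]/=.
  rewrite (_ : 1 + _ - _ = y * (neumann y n.+1 - neumann y n)); last by nc.
  apply: le_trans (nrmM _ _) _; exact: ler_wpM2l.
have r1' : 1 - r != 0 by rewrite gt_eqF// subr_gt0.
have [||z zl] := @climit_dom R A (neumann y) (fun n => (1 - r ^+ n) / (1 - r)) (1 / (1 - r)).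
- move=> n; apply: le_trans (step n) _.
  rewrite (_ : _ - _ = r ^+ n)//; rewrite exprS; by field.
- by move=> n; rewrite ler_pM2r ?invr_gt0 ?subr_gt0// gerBl exprn_ge0.
have zE : z = 1 + y * z.
  apply: (climit_unique (climitS zl)); apply: climitD (climit_cst _) _.
  exact: climitMl.
have yz : commutant y z.
  apply: (climit_commutant zl); elim=> [|n IH] /=; first by move=> c _; rewrite mulr0 mul0r.
  exact/commutantD/commutantM/IH/commutant_id/commutant1.
have yzC : y * z = z * y by apply: yz.
exists z; split=> //; last by rewrite mulrBl mul1r {1}zE addrK.
by rewrite mulrBr mulr1 -yzC {1}zE addrK.
Qed.

(* The iteration [s := s + (a - s^2) / 2] converges to the square root of [a] when
   [`|1 - a| <= 1]; the scalar sequence [sqw], for [a = 0], majorizes [1 - s]. *)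
Fixpoint sqi A (a : A) n : A :=
  if n is n.+1 then sqi a n + (2^-1) *^ (a - sqi a n * sqi a n) else 1.

Fixpoint sqw n : R := if n is n.+1 then (1 + sqw n ^+ 2) / 2 else 0.

Lemma sqw_bounds n : 0 <= sqw n <= 1.
Proof. by elim: n => [|n /andP[IH1 IH2]] /=; apply/andP; split=> //; nra. Qed.

(** With [w = sqw n], [1 - sqw n.+1 = (1 - w) - (1 - w)^2 / 2]: a gap that stayed above [e] would
    lose at least [e^2 / 2] at each step and become negative. *)
Lemma sqw_cvg (e : R) : 0 < e -> exists n, 1 - sqw n < e.
Proof.
move=> e0; apply/not_existsP => h.
have h' n : e <= 1 - sqw n by have /negP := h n; rewrite -leNgt.
have lin n : 1 - sqw n <= 1 - (e ^+ 2 / 2) *+ n.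
  elim: n => [|n IH]; first by rewrite mulr0n /= !subr0.
  rewrite mulrSr /=; have := h' n; have := sqw_bounds n => /andP[a b] c; nra.
have e2 : 0 < e ^+ 2 / 2 by rewrite divr_gt0// exprn_gt0.
have := archi_boundP (ltW (divr_gt0 (@ltr01 R) e2)).
set N := Num.bound _; rewrite ltr_pdivrMr// mulr_natl => hN.
by have := lin N; have := h' N; lra.
Qed.

(** For [y_n = 1 - sqi a n] the iteration reads [y_(n+1) = ((1 - a) + y_n^2) / 2], which is the
    recursion of [sqw] with [1 - a] in place of 1. *)
Lemma sqi_spec A (a : A) : nrm (1 - a) <= 1 ->
  (forall n, nrm (1 - sqi a n) <= sqw n) /\
  (forall n, nrm (sqi a n.+1 - sqi a n) <= sqw n.+1 - sqw n).
Proof.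
move=> a1.
have w n : 1 - sqi a n.+1 = (2^-1) *^ ((1 - a) + (1 - sqi a n) * (1 - sqi a n)).
  by rewrite /=; nc.
have b n : nrm (1 - sqi a n) <= sqw n.
  elim: n => [|n IH]; first by rewrite subrr nrm0.
  rewrite w nrmZr ger0_norm ?invr_ge0// -[sqw _]/((1 + sqw n ^+ 2) / 2) mulrC.
  rewrite ler_wpM2r ?invr_ge0//; apply: le_trans (nrmD _ _) _; apply: lerD => //.
  apply: le_trans (nrmM _ _) _; rewrite expr2; apply: ler_pM => //; exact: nrm_ge0.
split=> // n; elim: n => [|n IH].
  rewrite (_ : _ - _ = (2^-1) *^ (a - 1)); last by rewrite /=; nc.
  rewrite nrmZr ger0_norm ?invr_ge0// (nrmBC a) /= expr0n /=; lra.
have -> : sqi a n.+2 - sqi a n.+1 =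
    (4^-1) *^ ((sqi a n.+1 - sqi a n) * ((1 - sqi a n) + (1 - sqi a n.+1)) +
             ((1 - sqi a n) + (1 - sqi a n.+1)) * (sqi a n.+1 - sqi a n)).
  rewrite (_ : _ - _ = (1 - sqi a n.+1) - (1 - sqi a n.+2)); last by nc.
  transitivity ((2^-1) *^ (1 - a + (1 - sqi a n) * (1 - sqi a n)) -
    (2^-1) *^ (1 - a + (1 - sqi a n.+1) * (1 - sqi a n.+1))); first by rewrite -!w.
  by nc.
rewrite nrmZr ger0_norm ?invr_ge0//.
have := nrmD ((sqi a n.+1 - sqi a n) * (1 - sqi a n + (1 - sqi a n.+1)))
  ((1 - sqi a n + (1 - sqi a n.+1)) * (sqi a n.+1 - sqi a n)).
have := nrmM (sqi a n.+1 - sqi a n) (1 - sqi a n + (1 - sqi a n.+1)).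
have := nrmM (1 - sqi a n + (1 - sqi a n.+1)) (sqi a n.+1 - sqi a n).
have := nrmD (1 - sqi a n) (1 - sqi a n.+1).
have := b n; have := b n.+1; have := nrm_ge0 (sqi a n.+1 - sqi a n).
have := nrm_ge0 (1 - sqi a n + (1 - sqi a n.+1)).
rewrite -[sqw n.+2]/((1 + sqw n.+1 ^+ 2) / 2) {3}[sqw n.+1]/=.
move: IH; move: (nrm (sqi a n.+1 - sqi a n)) (nrm (1 - sqi a n + (1 - sqi a n.+1))) => u v.
move=> uW v0 u0 bS bn vb; rewrite !(mulrC v).
have uv : u * v <= (sqw n.+1 - sqw n) * (sqw n + sqw n.+1).
  by apply: ler_pM => //; lra.
move=> n1 n2 n3; nra.
Qed.

Lemma sqi_lim A (a : A) : nrm (1 - a) <= 1 ->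
  exists s : A, [/\ climit (sqi a) s, forall n, nrm (s - sqi a n) <= 1 - sqw n,
     s * s = a, commutant a s & star a = a -> star s = s].
Proof.
move=> a1; have [b d] := sqi_spec a1.
have [|s sl] := @climit_dom R A (sqi a) sqw 1 d; first by move=> n; case/andP: (sqw_bounds n).
exists s.
have sS := climitS sl.
have ss : s * s = a.
  have E : s = s + (2^-1) *^ (a - s * s).
    apply: (climit_unique sS); apply: climitD => //.
    apply: (@climit_lip _ _ _ ( *:%R 2^-1%:C) 1) => [y z|].
      rewrite -scalerBr nrmZr ger0_norm ?invr_ge0//; have := nrm_ge0 (y - z); nra.
    by apply: climitB; [exact: climit_cst|exact: climitM].
  rewrite -[LHS](subrK a) -[RHS]add0r; congr (_ + _).
  have : (2^-1) *^ (a - s * s) = 0 by apply: (addrI s); rewrite addr0 -E.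
  move=> /(congr1 (fun x => (-2) *^ x)); rewrite scaler0 => <-; nc.
split=> //.
- move=> n; apply: (@climit_le _ _ (fun k => sqi a (n + k)%N - sqi a n)).
    apply: climitB (climit_cst _); move=> e /sl[N h].
    by exists N => k Nk; apply: h; rewrite (leq_trans Nk)// leq_addl.
  move=> k; apply: (@le_trans _ _ (sqw (n + k)%N - sqw n)).
    elim: k => [|k IH]; first by rewrite addn0 !subrr nrm0.
    by rewrite addnS; have := nrm_tri (sqi a (n + k).+1) (sqi a (n + k)%N) (sqi a n); have := d (n + k)%N; lra.
  by have /andP[_] := sqw_bounds (n + k)%N; lra.
- apply: (climit_commutant sl); elim=> [|n IH] /=; first exact: commutant1.
  exact/commutantD/commutantZ/commutantB/commutantM.
- move=> sa; apply: (climit_unique (climit_star sl)).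
  rewrite (_ : (fun n => star (sqi a n)) = sqi a)//; apply/funext; elim=> [|n IH] /=.
    by rewrite star1.
  by rewrite starD starZr starB starM sa IH.
Qed.

(* Positivity without spectra. *)
Definition Pcone A (a : A) : Prop :=
  star a = a /\ exists2 t : R, 0 <= t & nrm (sca t - a) <= t.

Lemma Pcone_sa A (a : A) : Pcone a -> star a = a. Proof. by case. Qed.

(** The bound in [Pcone] says that [1 - a / t] has norm at most 1, where the iteration converges;
    [t = 0] forces [a = 0]. Positivity of the root itself waits for [Pcone_sqrt]. *)
Lemma Pcone_sqrt_raw A (a : A) : Pcone a ->
  exists s : A, [/\ star s = s, s * s = a & commutant a s].
Proof.
case=> sa [t]; rewrite le_eqVlt => /predU1P[<- h|t0 h].
  exists 0; have -> : a = 0.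
    by apply: nrm_eq0; apply/le_anti; rewrite nrm_ge0 andbT -nrmN; move: h; rewrite scale0r sub0r.
  by split; [rewrite star0|rewrite mul0r|].
have tn : t != 0 by rewrite gt_eqF.
have [|s [_ _ ss cs ssa]] := @sqi_lim A ((t^-1) *^ a).
  rewrite (_ : _ - _ = (t^-1) *^ (sca t - a)).
    by rewrite nrmZr ger0_norm ?invr_ge0 ?(ltW t0)// mulrC ler_pdivrMr// mul1r.
  by rewrite scalerBr scalerA -rmorphM/= mulVf// scale1r.
exists (Num.sqrt t *^ s); split.
- by rewrite starZr ssa// starZr sa.
- rewrite scAl scAr ss !scalerA -!rmorphM/= -expr2 sqr_sqrtr ?(ltW t0)//.
  by rewrite mulfV// scale1r.
- apply: commutantZ; apply: commutant_trans cs; exact/commutantZ/commutant_id.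
Qed.

(** The iteration gives a self-adjoint [c] with [c^2 = 1 - s^2]. Then [u = s + i c] satisfies
    [u^* u = 1], and [c] is the imaginary part of [u]. *)
Lemma one_minus_sq A (s : A) : star s = s -> nrm s <= 1 -> nrm (1 - s * s) <= 1.
Proof.
move=> ssa s1.
have [|c [_ _ cc sc csa]] := @sqi_lim A (1 - s * s).
  rewrite opprB addrCA subrr addr0 nrm_sa//; have := nrm_ge0 s; nra.
have {}csa : star c = c by apply: csa; rewrite starB star1 starM ssa.
have {}sc : s * c = c * s.
  by apply: sc; rewrite mulrBr mulrBl mulr1 mul1r mulrA.
rewrite -cc nrm_sa//.
pose u : A := s + imi *: c.
have uE : star u = s - imi *: c.
  by rewrite starD starZ ssa csa conj_imi scaleNr.
have u1 : nrm u <= 1.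
  have : star u * u = 1.
    rewrite uE /u (_ : _ * _ = s * s - (imi * imi) *: (c * c) + imi *: (s * c - c * s)).
      by rewrite mul_imi sc subrr scaler0 cc; nc.
    by nc.
  move=> /(congr1 (@nrm R A)); rewrite nrm_starM => E.
  have := nrm1_le A; rewrite -E expr2; have := nrm_ge0 u; nra.
have cE : c = (2^-1) *^ (imi *: (star u - u)).
  rewrite uE /u (_ : s - imi *: c - (s + imi *: c) = (-2 * imi) *: c); last by nc.
  rewrite !scalerA -mulrA (mulrCA imi) mul_imi mulrN1 opprK.
  by rewrite -[LHS]scale1r; congr (_ *: _); field.
have : nrm c <= 1.
  rewrite cE nrmZr nrm_i ger0_norm ?invr_ge0//.
  have := nrmB (star u) u; rewrite nrm_star; lra.
have := nrm_ge0 c; nra.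
Qed.


(** [one_minus_sq] rescaled. Any [t] above the norm now witnesses positivity, so a single [t] can
    serve a whole convergent sequence in [Pcone_climit]. *)
Lemma Pcone_sq A (s : A) (t : R) : star s = s -> nrm (s * s) <= t ->
  nrm (sca t - s * s) <= t.
Proof.
move=> ssa; have [t0|t0] := ltP 0 t; last first.
  rewrite nrm_sa// => h; have s0 : s = 0.
    by apply: nrm_eq0; have := nrm_ge0 s; nra.
  have -> : t = 0 by move: h; rewrite s0 nrm0 expr0n /=; lra.
  by rewrite s0 mulr0 scale0r subr0 nrm0.
rewrite nrm_sa// => st.
have r0 : 0 < Num.sqrt t by rewrite sqrtr_gt0.
have rt : Num.sqrt t ^+ 2 = t by rewrite sqr_sqrtr// ltW.
have := @one_minus_sq A (((Num.sqrt t)^-1) *^ s).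
rewrite starZr ssa nrmZr ger0_norm ?invr_ge0 ?(ltW r0)//.
have tn : t != 0 by rewrite gt_eqF.
have rn : Num.sqrt t != 0 by rewrite gt_eqF.
move=> /(_ erefl); rewrite mulrC ler_pdivrMr// mul1r.
rewrite -[X in _ <= X -> _]ger0_norm ?(ltW r0)// -[nrm s]ger0_norm ?nrm_ge0//.
rewrite -ler_sqr ?nnegrE// !real_normK ?num_real// rt => /(_ st).
rewrite (_ : 1 - _ = (t^-1) *^ (sca t - s * s)).
  by rewrite nrmZr ger0_norm ?invr_ge0 ?(ltW t0)// mulrC ler_pdivrMr// mul1r.
rewrite scalerBr scalerA -rmorphM/= mulVf// scale1r; congr (_ - _).
by rewrite scAl scAr scalerA -rmorphM/= -invrM ?unitfE// -expr2 rt.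
Qed.

Lemma PconeS A (s : A) : star s = s -> Pcone (s * s).
Proof.
move=> ssa; split; first by rewrite starM ssa.
by exists (nrm (s * s)); [exact: nrm_ge0|exact: Pcone_sq].
Qed.

Lemma Pcone_nrm A (a : A) (t : R) : Pcone a -> nrm a <= t -> nrm (sca t - a) <= t.
Proof. by move=> /Pcone_sqrt_raw[s [ssa <- _]]; exact: Pcone_sq. Qed.

(** The witnesses add up. Closure under sums, hard to see for squares, is what the metric definition
    buys. *)
Lemma PconeD A (a b : A) : Pcone a -> Pcone b -> Pcone (a + b).
Proof.
move=> [sa [t t0 ht]] [sb [u u0 hu]]; split; first by rewrite starD sa sb.
exists (t + u); first exact: addr_ge0.
rewrite (_ : _ - _ = (sca t - a) + (sca u - b)); last by nc.
by apply: le_trans (nrmD _ _) _; exact: lerD.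
Qed.

Lemma Pcone0 A : Pcone (0 : A).
Proof. by split; [exact: star0|exists 0; rewrite // scale0r subrr nrm0]. Qed.

Lemma PconeZ A (t : R) (a : A) : 0 <= t -> Pcone a -> Pcone (t *^ a).
Proof.
move=> t0 [sa [u u0 hu]]; split; first by rewrite starZr sa.
exists (t * u); first exact: mulr_ge0.
rewrite (_ : _ - _ = t *^ (sca u - a)); last by nc.
by rewrite nrmZr ger0_norm// ler_wpM2l.
Qed.

Lemma Pcone_cst A (t : R) : 0 <= t -> Pcone (sca t : A).
Proof.
by move=> t0; apply: PconeZ => //; rewrite -[1]mulr1; apply: PconeS; exact: star1.
Qed.

Lemma Pcone_sum A (I : Type) (s : seq I) (P : pred I) (F : I -> A) :
  (forall i, P i -> Pcone (F i)) -> Pcone (\sum_(i <- s | P i) F i).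
Proof. by move=> h; apply: big_ind => //; [exact: Pcone0|exact: PconeD]. Qed.

Lemma PconeM A (a b : A) : Pcone a -> Pcone b -> a * b = b * a -> Pcone (a * b).
Proof.
move=> /Pcone_sqrt_raw[s [ssa ss sc]] /Pcone_sqrt_raw[r [rsa rr rc]] ab.
have br : b * s = s * b by apply: sc.
have sr : s * r = r * s by apply: rc.
rewrite -ss -rr (_ : _ * _ = (s * r) * (s * r)).
  by apply: PconeS; rewrite starM ssa rsa sr.
by rewrite !mulrA -(mulrA s r s) -sr !mulrA.
Qed.

Lemma Pcone_climit A (x : nat -> A) l :
  climit x l -> (forall n, Pcone (x n)) -> Pcone l.
Proof.
move=> xl xP.
have sl : star l = l.
  apply: (climit_unique (climit_star xl)).
  by rewrite (_ : (fun n => _) = x)//; apply/funext => n; exact/Pcone_sa.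
split=> //; exists (nrm l + 1); first by have := nrm_ge0 l; lra.
have [N h] := xl 1 ltr01.
apply: (@climit_le _ _ (fun n => sca (nrm l + 1) - x (n + N)%N)).
  apply: climitB; first exact: climit_cst.
  by move=> e /xl[M hM]; exists M => n Mn; apply: hM; rewrite (leq_trans Mn)// leq_addr.
move=> n; apply: Pcone_nrm => //.
by have := nrm_tri (x (n + N)%N) l 0; rewrite !subr0; have := h (n + N)%N (leq_addl _ _); lra.
Qed.

(* With [a = s^2] and [t - a = c^2] the element [s + ic] is [sqrt t] times a unitary. *)
Lemma Pcone_le_nrm A (a : A) (t : R) : 0 <= t -> Pcone a -> Pcone (sca t - a) -> nrm a <= t.
Proof.
move=> t0 /Pcone_sqrt_raw[s [ssa ss sc]] /Pcone_sqrt_raw[c [csa cc hc]].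
have {}sc : s * a = a * s by apply/esym/sc.
have {}hc : s * c = c * s.
  by apply: hc; rewrite mulrBr mulrBl scAl scAr mulr1 mul1r sc.
pose u : A := s + imi *: c.
have uE : star u = s - imi *: c by rewrite starD starZ ssa csa conj_imi scaleNr.
have uu : star u * u = sca t.
  rewrite uE /u (_ : _ * _ = s * s - (imi * imi) *: (c * c) + imi *: (s * c - c * s)); last by nc.
  by rewrite mul_imi hc subrr scaler0 cc ss; nc.
have u1 : nrm u ^+ 2 <= t.
  by rewrite -nrm_starM uu nrmZr ger0_norm//; have := nrm1_le A; nra.
have sE : s = (2^-1) *^ (star u + u) by rewrite uE /u; nc.
have su : nrm s <= nrm u.
  rewrite {1}sE nrmZr ger0_norm ?invr_ge0//.
  have := nrmD (star u) u; rewrite nrm_star; lra.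
by rewrite -ss nrm_sa//; have := nrm_ge0 s; nra.
Qed.

Lemma Pcone_sub_nrm A (y : A) (t : R) : star y = y -> nrm y <= t -> Pcone (sca t - y).
Proof.
move=> sy yt; have t0 := le_trans (nrm_ge0 y) yt.
split; first by rewrite starB starZr star1 sy.
by exists t => //; rewrite opprB addrCA subrr addr0.
Qed.

Lemma Pcone_anti A (a : A) : Pcone a -> Pcone (- a) -> a = 0.
Proof.
move=> Pa Na; apply/nrm_eq0/le_anti; rewrite nrm_ge0 andbT.
by apply: Pcone_le_nrm => //; rewrite scale0r sub0r.
Qed.

Lemma Pcone_lenrm A (a b : A) : Pcone a -> Pcone (b - a) -> nrm a <= nrm b.
Proof.
move=> Pa Pba; apply: Pcone_le_nrm => //; first exact: nrm_ge0.
have -> : sca (nrm b) - a = (sca (nrm b) - b) + (b - a) by nc.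
apply: PconeD => //; apply: Pcone_sub_nrm => //.
by rewrite -(subrK a b) starD (Pcone_sa Pba) (Pcone_sa Pa).
Qed.

(** The iterates stay within distance 1 of [1], hence so does their limit, which is the metric
    condition with witness 1. Scaling by [nrm a + 1] avoids a separate case for 0. *)
Lemma Pcone_sqrt A (a : A) : Pcone a ->
  exists s : A, [/\ Pcone s, s * s = a & commutant a s].
Proof.
move=> Pa; have [Ca] : exists C, 0 < C /\ nrm a <= C.
  by exists (nrm a + 1); have := nrm_ge0 a; lra.
case=> C0 aC; have Cn : Ca != 0 by rewrite gt_eqF.
have aE : 1 - (Ca^-1) *^ a = (Ca^-1) *^ (sca Ca - a).
  by rewrite scalerBr scalerA -rmorphM/= mulVf// scale1r.
have a1 : nrm (1 - (Ca^-1) *^ a) <= 1.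
  rewrite aE nrmZr ger0_norm ?invr_ge0 ?(ltW C0)// mulrC ler_pdivrMr// mul1r.
  exact: Pcone_nrm.
have [s [sl _ ss cs ssa]] := sqi_lim a1.
have Ps : Pcone s.
  split; first by apply: ssa; rewrite starZr Pcone_sa.
  exists 1 => //; rewrite scale1r.
  apply: (climit_le (climitB (climit_cst 1) sl)) => n.
  have [b _] := sqi_spec a1; apply: le_trans (b n) _.
  by case/andP: (sqw_bounds n).
exists (Num.sqrt Ca *^ s); split.
- exact/PconeZ.
- rewrite scAl scAr ss !scalerA -!rmorphM/= -expr2 sqr_sqrtr ?(ltW C0)//.
  by rewrite mulfV// scale1r.
- apply: commutantZ; apply: commutant_trans cs; exact/commutantZ/commutant_id.
Qed.

End Sqrt.

(** * Positive and negative parts, resolvents, and positivity of [b^* b] *)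

Section Positive.
Variable R : realType.
Implicit Types A : cstarType R.

(** For [q = sqi (x * x) n] and [y] either [x] or [-x], the next iterate minus [y] is
    [(q - y) (1 - (q + y) / 2)], a product of commuting positive elements. In the limit [|x|]
    dominates [x] and [-x]. *)
Lemma sqi_abs A (x : A) : star x = x -> nrm x <= 1 ->
  forall n, Pcone (sqi (x * x) n - x) /\ Pcone (sqi (x * x) n + x).
Proof.
move=> sx x1; set a : A := x * x.
have aS : star a = a by rewrite starM sx.
have qa n : commutant x (sqi a n).
  elim: n => [|n IH] /=; first exact: commutant1.
  by do 2?[apply/commutantD => //; apply/commutantZ]; apply/commutantB/commutantM => //; exact: commutantM.
have qS n : star (sqi a n) = sqi a n.
  by elim: n => [|n IH] /=; rewrite ?star1// starD starZr starB starM aS IH.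
have w n : Pcone (1 - sqi a n).
  elim: n => [|n IH]; first by rewrite subrr; exact: Pcone0.
  have -> : 1 - sqi a n.+1 = (2^-1) *^ ((sca 1 - a) + (1 - sqi a n) * (1 - sqi a n)).
    by rewrite /=; nc.
  apply: PconeZ; rewrite ?invr_ge0//; apply: PconeD.
    by apply: Pcone_sub_nrm => //; rewrite nrm_sa//; have := nrm_ge0 x; nra.
  by apply: PconeS; exact: Pcone_sa.
have x2 (y : A) : star y = y -> nrm y <= 1 -> Pcone (1 - y).
  by move=> sy y1; have := Pcone_sub_nrm sy y1; rewrite scale1r.
have main y n : star y = y -> nrm y <= 1 -> y * y = a -> commutant y (sqi a n) ->
  Pcone (sqi a n - y) -> Pcone (sqi a n.+1 - y).
  move=> sy y1 yy yq P1.
  have qy : sqi a n * y = y * sqi a n by rewrite yq.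
  have E : sqi a n.+1 - y = (sqi a n - y) * (1 - (2^-1) *^ (sqi a n + y)).
    have qn : sqi a n.+1 = sqi a n + (2^-1) *^ (a - sqi a n * sqi a n) by [].
    have E0 : (2^-1) *^ (y * sqi a n - sqi a n * y) = 0 by rewrite qy subrr scaler0.
    rewrite qn -[LHS]addr0 -E0; move: (sqi a n) => q; rewrite -yy; nc.
  rewrite E; apply: PconeM => //.
    have -> : 1 - (2^-1) *^ (sqi a n + y) = (2^-1) *^ ((1 - sqi a n) + (1 - y)) by nc.
    by apply: PconeZ; rewrite ?invr_ge0//; apply: PconeD (w n) (x2 _ _ _).
  by rewrite !mulrBl !mulrBr !scAl !scAr !mulrDl !mulrDr qy; nc.
elim=> [|n [IH1 IH2]]; first by split; [exact: x2|rewrite -[x]opprK; apply: x2; rewrite ?starN ?sx ?nrmN].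
split; first exact: main.
rewrite -[x]opprK; apply: main; rewrite ?starN ?sx ?nrmN ?mulrNN ?opprK// => c.
by rewrite mulrN mulNr => /oppr_inj/qa.
Qed.

(** After scaling into the unit ball the parts are [(s + x) / 2] and [(s - x) / 2] with [s = |x|];
    they are positive by [sqi_abs], and their product is [(s^2 - x^2) / 4 = 0]. *)
Lemma pos_neg_parts A (x : A) : star x = x -> exists p n : A,
  [/\ Pcone p, Pcone n, x = p - n, p * n = 0 /\ n * p = 0
    & commutant x p /\ commutant x n].
Proof.
move=> sx.
suff main (y : A) : star y = y -> nrm y <= 1 -> exists p n : A,
  [/\ Pcone p, Pcone n, y = p - n, p * n = 0 /\ n * p = 0
    & commutant y p /\ commutant y n].
  have C0 : 0 < nrm x + 1 by have := nrm_ge0 x; lra.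
  have Cn : nrm x + 1 != 0 by rewrite gt_eqF.
  have [||p [n [Pp Pn yE [pn np] [cp cn]]]] := main (((nrm x + 1)^-1) *^ x).
  - by rewrite starZr sx.
  - by rewrite nrmZr ger0_norm ?invr_ge0 ?(ltW C0)// mulrC ler_pdivrMr// mul1r; lra.
  have xE : x = (nrm x + 1) *^ (p - n).
    by rewrite -yE scalerA -rmorphM/= mulfV// scale1r.
  exists ((nrm x + 1) *^ p), ((nrm x + 1) *^ n).
  split; [exact/PconeZ/Pp/ltW|exact/PconeZ/Pn/ltW|by rewrite {1}xE scalerBr| |].
    by rewrite !scAl !scAr pn np !scaler0.
  have ty : commutant x (((nrm x + 1)^-1) *^ x) by apply/commutantZ/commutant_id.
  by split; apply/commutantZ/(commutant_trans ty).
move=> {x sx} sx x1; set a : A := y * y.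
have [|s [sl _ ss sc _]] := @sqi_lim R A a.
  rewrite -[1]scale1r; apply: Pcone_sq => //.
  by rewrite nrm_sa//; have := nrm_ge0 y; nra.
have Pm : Pcone (s - y).
  apply: (Pcone_climit (climitB sl (climit_cst y))) => n.
  by have [] := sqi_abs sx x1 n.
have Pp : Pcone (s + y).
  apply: (Pcone_climit (climitD sl (climit_cst y))) => n.
  by have [] := sqi_abs sx x1 n.
have ys : commutant y s.
  by apply: commutant_trans sc; exact/commutantM/commutant_id/commutant_id.
have sy : y * s = s * y by apply: ys.
exists ((2^-1) *^ (s + y)), ((2^-1) *^ (s - y)); split.
- by apply: PconeZ; rewrite ?invr_ge0.
- by apply: PconeZ; rewrite ?invr_ge0.
- by nc.
- split.
    rewrite (_ : _ * _ = (4^-1) *^ (s * s - y * y + (y * s - s * y))); last by nc.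
    by rewrite sy ss !subrr addr0 scaler0.
  rewrite (_ : _ * _ = (4^-1) *^ (s * s - y * y + (s * y - y * s))); last by nc.
  by rewrite sy ss !subrr addr0 scaler0.
- by split; apply/commutantZ; [apply/commutantD|apply/commutantB].
Qed.

(** Write [a + t = T (1 - y)] with [T = nrm a + t] and [y = (nrm a - a) / T], of norm below 1. If
    [s] is the root of [a + t], the inverse [k] equals [(k s)^2], hence is positive. *)
Lemma Pcone_inv A (a : A) (t : R) : Pcone a -> 0 < t -> exists k : A,
  [/\ Pcone k, k * (a + sca t) = 1, (a + sca t) * k = 1 & commutant a k].
Proof.
move=> Pa t0; set T := nrm a + t.
have T0 : 0 < T by have := nrm_ge0 a; rewrite /T; lra.
have Tn : T != 0 by rewrite gt_eqF.
set y : A := (T^-1) *^ (sca (nrm a) - a).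
have y1 : nrm y < 1.
  rewrite /y nrmZr ger0_norm ?invr_ge0 ?(ltW T0)// mulrC ltr_pdivrMr// mul1r.
  by apply: le_lt_trans (Pcone_nrm Pa (lexx _)) _; rewrite /T; lra.
have yE : a + sca t = T *^ (1 - y).
  rewrite /y scalerBr scalerA -rmorphM/= mulfV// scale1r /T; nc.
have [z [z1 z2 yz]] := neumann_inv y1.
have ay : commutant a y by apply/commutantZ/commutantB/commutant_id/commutantZ/commutant1.
have az : commutant a z by apply: commutant_trans ay yz.
exists ((T^-1) *^ z).
have k1 : (T^-1 *^ z) * (a + sca t) = 1.
  by rewrite yE scAl scAr z1 scalerA -rmorphM/= mulVf// scale1r.
have k2 : (a + sca t) * (T^-1 *^ z) = 1.
  by rewrite yE scAl scAr z2 scalerA -rmorphM/= mulfV// scale1r.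
have ak : commutant a (T^-1 *^ z) by exact: commutantZ.
split=> //; set k := _ *: z in k1 k2 ak *.
have Pat : Pcone (a + sca t) by apply: PconeD => //; apply: Pcone_cst; exact: ltW.
have ks : star k = k.
  rewrite -[RHS]mul1r -star1 -k2 starM (Pcone_sa Pat) -mulrA k2 mulr1//.
have [s [Ps ss sc]] := Pcone_sqrt Pat.
have ksC : k * s = s * k by apply: sc; rewrite k1 k2.
have -> : k = (k * s) * (k * s).
  by rewrite {2}ksC -mulrA (mulrA s s) ss mulrA k1 mul1r.
by apply: PconeS; rewrite starM ks (Pcone_sa Ps).
Qed.

(* [1 + c^* c] and [1 + c c^*] are simultaneously invertible. *)
Lemma Pcone_starN A (c : A) : Pcone (c * star c) -> Pcone (- (star c * c)) -> c = 0.
Proof.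
set d : A := c * star c; set e : A := - (star c * c) => Pd Pe.
suff e0 : nrm e = 0.
  apply: nrm_eq0; have := nrm_starM c; rewrite -[star c * c]opprK -/e nrmN e0.
  by move/esym/eqP; rewrite sqrf_eq0 => /eqP.
apply/le_anti; rewrite nrm_ge0 andbT leNgt; apply/negP => t0.
move te : (nrm e) t0 => t t0; have tn : t != 0 by rewrite gt_eqF.
have [k [Pk k1 k2 _]] := Pcone_inv Pd t0.
(* The inverse of [t + c^* c], computed from the inverse [k] of [t + c c^*]. *)
pose j : A := (t^-1) *^ (1 - star c * k * c).
have j1 : j * (sca t - e) = 1.
  have : (1 - star c * k * c) * (sca t + star c * c) = (sca t : A).
    transitivity (sca t + star c * c - star c * (k * (c * star c + sca t)) * c); first by nc.
    by rewrite k1 mulr1 addrK.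
  move=> E; rewrite /j /e opprK scAl E scalerA -rmorphM/= mulVf// scale1r//.
have j2 : (sca t - e) * j = 1.
  have : (sca t + star c * c) * (1 - star c * k * c) = (sca t : A).
    transitivity (sca t + star c * c - star c * ((c * star c + sca t) * k) * c); first by nc.
    by rewrite k2 mulr1 addrK.
  move=> E; rewrite /j /e opprK scAr E scalerA -rmorphM/= mulVf// scale1r//.
have Pte : Pcone (sca t - e) by apply: Pcone_sub_nrm; [exact: Pcone_sa|rewrite te].
have sj : star j = j.
  by rewrite -[RHS]mul1r -star1 -j2 starM (Pcone_sa Pte) -mulrA j2 mulr1.
have [s [Ps ss sc]] := Pcone_sqrt Pte.
have Pj : Pcone j.
  have jsC : j * s = s * j by apply: sc; rewrite j1 j2.
  have -> : j = (j * s) * (j * s) by rewrite {2}jsC -mulrA (mulrA s s) ss mulrA j1 mul1r.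
  by apply: PconeS; rewrite starM sj (Pcone_sa Ps).
have [M0|M0] := leP (nrm j) 0.
  have j0 : j = 0 by apply/nrm_eq0/le_anti; rewrite M0 nrm_ge0.
  have E : e = 0 by rewrite -[e]mulr1 -j2 j0 !mulr0.
  by move: t0; rewrite -te E nrm0 ltxx.
set M := nrm j in M0; have Mn : M != 0 by rewrite gt_eqF.
have PM : Pcone (sca M - j) by apply: Pcone_sub_nrm.
(* The commuting positive elements [M - j] and [t - e] have product [M (t - e) - 1]. So
   [e <= t - 1 / M], against [nrm e = t]. *)
have : Pcone (sca (t - M^-1) - e).
  have -> : sca (t - M^-1) - e = (M^-1) *^ ((sca M - j) * (sca t - e)).
    rewrite mulrBl j1 scAl mul1r scalerBr scalerA -rmorphM/= mulVf// scale1r; nc.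
  apply: PconeZ; first by rewrite invr_ge0 ltW.
  by apply: PconeM => //; rewrite [LHS]mulrBl [RHS]mulrBr j1 j2 scAl scAr mul1r mulr1.
have iM : 0 < M^-1 by rewrite invr_gt0.
have [tM|tM] := leP 0 (t - M^-1).
  by move=> /(Pcone_le_nrm tM Pe); rewrite te; lra.
move=> P1; have e00 : e = 0.
  apply: Pcone_anti => //.
  have -> : - e = (sca (t - M^-1) - e) + sca (M^-1 - t) by nc.
  by apply: PconeD => //; apply: Pcone_cst; lra.
by move: t0; rewrite -te e00 nrm0 ltxx.
Qed.

(** Let [n] be the negative part of [b^* b] and [c = b n], so that [c^* c = - n^3]. With
    [c = x + i y], [c c^* = 2 (x^2 + y^2) - c^* c] is positive, and [Pcone_starN] gives [c = 0],
    hence [n^4 = 0]. *)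
Lemma Pcone_star_mul A (b : A) : Pcone (star b * b).
Proof.
have sx : star (star b * b) = star b * b by rewrite starM starK.
have [p [n [Pp Pn xE [pn np] _]]] := pos_neg_parts sx.
have ns : star n = n by exact: Pcone_sa.
pose c : A := b * n.
have cc : star c * c = - (n * (n * n)).
  rewrite /c starM ns -mulrA (mulrA (star b)) xE mulrBl pn sub0r mulrN//.
have Pn3 : Pcone (n * (n * n)).
  by apply: PconeM => //; [apply: PconeS|rewrite mulrA].
suff c0 : c = 0.
  suff n0 : n = 0 by rewrite xE n0 subr0.
  have : n * (n * n) = 0 by rewrite -[LHS]opprK -cc c0 mulr0 oppr0.
  move=> n3; have n4 : (n * n) * (n * n) = 0 by rewrite -mulrA n3 mulr0.
  have : nrm ((n * n) * (n * n)) = 0 by rewrite n4 nrm0.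
  rewrite !nrm_sa ?starM ?ns// => /eqP; rewrite !sqrf_eq0 => /eqP; exact: nrm_eq0.
apply: Pcone_starN; last by rewrite cc opprK.
pose x : A := (2^-1) *^ (c + star c); pose y : A := (2^-1) *^ (imi *: (star c - c)).
have sxx : star x = x by rewrite /x starZr starD starK addrC.
have syy : star y = y.
  by rewrite /y starZr starZ conj_imi starB starK; nc.
have -> : c * star c = 2 *^ (x * x + y * y) - star c * c.
  pose v : A := (2^-1) *^ (star c - c).
  have yE : y = imi *: v by rewrite /y /v; nc.
  have -> : y * y = - (v * v) by rewrite yE scAl scAr scalerA mul_imi scaleN1r.
  rewrite /v /x; nc.
apply: PconeD; last by rewrite cc opprK.
by apply: PconeZ => //; apply: PconeD; exact: PconeS.
Qed.

Lemma positiveP A (a : A) : positive a <-> Pcone a.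
Proof.
split=> [[b ->]|/Pcone_sqrt_raw[s [ss <- _]]]; first exact: Pcone_star_mul.
by exists s; rewrite ss.
Qed.

Lemma Pcone_conj A (a c : A) : Pcone a -> Pcone (star c * a * c).
Proof.
move=> /Pcone_sqrt_raw[s [ss <- _]]; rewrite (_ : _ * c = star (s * c) * (s * c)).
  exact: Pcone_star_mul.
by rewrite starM ss !mulrA.
Qed.

Lemma Pcone_conj_le A (a b c : A) : Pcone (b - a) ->
  Pcone (star c * b * c - star c * a * c).
Proof. by move=> /Pcone_conj-/(_ c); rewrite mulrBr mulrBl. Qed.

Lemma nrm_mul_sqrt A (x a s : A) : star s = s -> s * s = a ->
  nrm (x * s) ^+ 2 = nrm (x * a * star x).
Proof.
move=> ss <-; rewrite -nrm_star -nrm_starM starK starM ss.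
by rewrite !mulrA.
Qed.

End Positive.

(** * Uniform estimates for square roots, and perturbed polar decompositions *)

Section SqrtFun.
Variable R : realType.
Implicit Types A : cstarType R.

Definition csqrt A (a : A) : A :=
  xget 0 [set s : A | [/\ Pcone s, s * s = a & commutant a s]].

Lemma csqrtP A (a : A) : Pcone a ->
  [/\ Pcone (csqrt a), csqrt a * csqrt a = a & commutant a (csqrt a)].
Proof.
move=> /Pcone_sqrt[s hs].
by apply: (@xgetPex _ 0 [set s : A | [/\ Pcone s, s * s = a & commutant a s]]); exists s.
Qed.

(** For [z = s - t] one has [z (s + t) = 0], so the positive elements [z s z] and [z t z] are
    opposite and both vanish; then [z^4 = (z s z - z t z) z = 0]. *)
Lemma csqrt_unique A (a s : A) : Pcone s -> s * s = a -> s = csqrt a.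
Proof.
move=> Ps ss; have Pa : Pcone a by rewrite -ss; exact/PconeS/Pcone_sa.
have [Pt tt ct] := csqrtP Pa; move: (csqrt a) Pt tt ct => t Pt tt ct.
have ts : t * s = s * t by apply/esym/ct; rewrite -ss mulrA.
have sS := Pcone_sa Ps; have tS := Pcone_sa Pt.
pose z := s - t; have zS : star z = z by rewrite starB sS tS.
have zst : z * (s + t) = 0.
  rewrite /z (_ : _ * _ = s * s - t * t + (s * t - t * s)); last by nc.
  by rewrite ts ss tt !subrr addr0.
have Pzs : Pcone (z * s * z) by rewrite -{1}zS; exact: Pcone_conj.
have Pzt : Pcone (z * t * z) by rewrite -{1}zS; exact: Pcone_conj.
have E : z * s * z = - (z * t * z).
  by apply/eqP; rewrite -subr_eq0 opprK -mulrDl -mulrDr zst mul0r.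
have zs0 : z * s * z = 0 by apply: Pcone_anti => //; rewrite E opprK.
have zt0 : z * t * z = 0 by apply/oppr_inj; rewrite -E zs0 oppr0.
have z3 : (z * z) * (z * z) = 0.
  have -> : (z * z) * (z * z) = (z * s * z - z * t * z) * z by rewrite /z; nc.
  by rewrite zs0 zt0 subrr mul0r.
have : nrm ((z * z) * (z * z)) = 0 by rewrite z3 nrm0.
rewrite !nrm_sa ?starM ?zS// => /eqP; rewrite !sqrf_eq0 => /eqP/nrm_eq0/eqP.
by rewrite subr_eq0 => /eqP.
Qed.

Lemma csqrt_nrm A (a : A) : Pcone a -> nrm (csqrt a) ^+ 2 = nrm a.
Proof. by move=> Pa; have [Ps ss _] := csqrtP Pa; rewrite -nrm_sa ?ss//; exact: Pcone_sa. Qed.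

Lemma csqrt_nrm1 A (a : A) : Pcone a -> nrm a <= 1 -> nrm (csqrt a) <= 1.
Proof. by move=> /csqrt_nrm <-; have := nrm_ge0 (csqrt a); nra. Qed.

Lemma Pcone_one_sub A (a : A) : Pcone a -> nrm a <= 1 -> nrm (1 - a) <= 1.
Proof. by move=> Pa a1; have := Pcone_nrm Pa a1; rewrite scale1r. Qed.

(** The rate depends neither on [a] nor on the algebra, so uniform statements about roots reduce to
    the polynomials [sqi a n]. *)
Lemma csqrt_sqi A (a : A) n : Pcone a -> nrm a <= 1 ->
  nrm (csqrt a - sqi a n) <= 1 - sqw R n.
Proof.
move=> Pa a1; have a1' := Pcone_one_sub Pa a1.
have [s [sl sn ss cs ssa]] := sqi_lim a1'.
rewrite -(@csqrt_unique _ a s)//.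
split; first exact/ssa/Pcone_sa.
exists 1 => //; rewrite scale1r.
apply: (climit_le (climitB (climit_cst 1) sl)) => k.
have [b _] := sqi_spec a1'; apply: le_trans (b k) _.
by case/andP: (sqw_bounds R k).
Qed.

Lemma sqi_nrm A (a : A) n : Pcone a -> nrm a <= 1 -> nrm (sqi a n) <= 2.
Proof.
move=> Pa a1; have [b _] := sqi_spec (Pcone_one_sub Pa a1).
have := nrmB 1 (1 - sqi a n); rewrite opprB addrC subrK.
by have := b n; have := nrm1_le A; have /andP[_] := sqw_bounds R n; lra.
Qed.

(** Since the iterates have norm at most 2, a distance [u] between two of them becomes at most
    [u + (|a - b| + 2 u + 2 u) / 2]. Commutators obey the same recursion. *)
Fixpoint sqi_lip (n : nat) : R := if n is n.+1 then 3 * sqi_lip n + 2^-1 else 0.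

Lemma sqi_lip_ge0 n : 0 <= sqi_lip n.
Proof. by elim: n => //= n IH; have : (0 : R) <= 2^-1 by []; lra. Qed.

Lemma sqi_lipP A (a b : A) n : Pcone a -> nrm a <= 1 -> Pcone b -> nrm b <= 1 ->
  nrm (sqi a n - sqi b n) <= sqi_lip n * nrm (a - b).
Proof.
move=> Pa a1 Pb b1; elim: n => [|n IH]; first by rewrite subrr nrm0 mul0r.
have -> : sqi a n.+1 - sqi b n.+1 = (sqi a n - sqi b n) + (2^-1) *^ ((a - b)
    - (sqi a n * (sqi a n - sqi b n) + (sqi a n - sqi b n) * sqi b n)).
  by rewrite /=; nc.
have := nrmD (sqi a n - sqi b n) ((2^-1) *^ ((a - b)
    - (sqi a n * (sqi a n - sqi b n) + (sqi a n - sqi b n) * sqi b n))).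
rewrite nrmZr ger0_norm ?invr_ge0//.
have := nrmB (a - b) (sqi a n * (sqi a n - sqi b n) + (sqi a n - sqi b n) * sqi b n).
have := nrmD (sqi a n * (sqi a n - sqi b n)) ((sqi a n - sqi b n) * sqi b n).
have := nrmM (sqi a n) (sqi a n - sqi b n); have := nrmM (sqi a n - sqi b n) (sqi b n).
have := sqi_nrm n Pa a1; have := sqi_nrm n Pb b1.
have := nrm_ge0 (sqi a n - sqi b n).
move: (nrm (sqi a n - sqi b n)) IH (nrm (sqi a n)) (nrm (sqi b n)) => u IH v w u0 w2 v2.
have vu : v * u <= 2 * u by apply: ler_wpM2r.
have uw : u * w <= 2 * u by rewrite mulrC; apply: ler_wpM2r.
by rewrite [sqi_lip n.+1]/=; lra.
Qed.

Lemma sqi_commP A (a c : A) n : Pcone a -> nrm a <= 1 ->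
  nrm (sqi a n * c - c * sqi a n) <= sqi_lip n * nrm (a * c - c * a).
Proof.
move=> Pa a1; elim: n => [|n IH]; first by rewrite mul1r mulr1 subrr nrm0 mul0r.
set d := sqi a n * c - c * sqi a n in IH *.
have -> : sqi a n.+1 * c - c * sqi a n.+1 = d + (2^-1) *^ ((a * c - c * a)
    - (sqi a n * d + d * sqi a n)).
  by rewrite /d /=; nc.
have := nrmD d ((2^-1) *^ ((a * c - c * a) - (sqi a n * d + d * sqi a n))).
rewrite nrmZr ger0_norm ?invr_ge0//.
have := nrmB (a * c - c * a) (sqi a n * d + d * sqi a n).
have := nrmD (sqi a n * d) (d * sqi a n).
have := nrmM (sqi a n) d; have := nrmM d (sqi a n).
have := sqi_nrm n Pa a1; have := nrm_ge0 d.
move: (nrm d) IH (nrm (sqi a n)) => u IH v u0 v2.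
have vu : v * u <= 2 * u by apply: ler_wpM2r.
by rewrite [sqi_lip n.+1]/= (mulrC u); lra.
Qed.

(** Three times [e / 3]: two for replacing the roots by a fixed iterate, one for the Lipschitz bound
    of this iterate. The algebra is quantified after [d]. *)
Lemma csqrt_unif (e : R) : 0 < e -> exists2 d : R, 0 < d & forall A (a b : A),
  Pcone a -> Pcone b -> nrm a <= 1 -> nrm b <= 1 -> nrm (a - b) <= d ->
  nrm (csqrt a - csqrt b) <= e.
Proof.
move=> e0; have [|n hn] := @sqw_cvg R (e / 3); first by lra.
have L0 := sqi_lip_ge0 n.
exists (e / 3 / (sqi_lip n + 1)); first by rewrite !divr_gt0//; lra.
move=> A a b Pa Pb a1 b1; rewrite ler_pdivlMr; last by lra.
move=> ab; have := csqrt_sqi n Pa a1; have := csqrt_sqi n Pb b1.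
have := sqi_lipP n Pa a1 Pb b1; have := nrm_ge0 (a - b).
have := nrm_tri (csqrt a) (sqi a n) (csqrt b).
have := nrm_tri (sqi a n) (sqi b n) (csqrt b); rewrite (nrmBC (sqi b n) (csqrt b)).
nra.
Qed.

Lemma csqrt_comm_unif (e C : R) : 0 < e -> 0 <= C ->
  exists2 d : R, 0 < d & forall A (a c : A), Pcone a -> nrm a <= 1 -> nrm c <= C ->
  nrm (a * c - c * a) <= d -> nrm (csqrt a * c - c * csqrt a) <= e.
Proof.
move=> e0 C0; have C1 : 0 < 2 * C + 1 by lra.
have [|n hn] := @sqw_cvg R (e / 2 / (2 * C + 1)); first by rewrite !divr_gt0.
have L0 := sqi_lip_ge0 n.
exists (e / 2 / (sqi_lip n + 1)); first by rewrite !divr_gt0//; lra.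
move=> A a c Pa a1 cC; rewrite ler_pdivlMr; last by lra.
move: hn; rewrite ltr_pdivlMr// => hn ac.
have -> : csqrt a * c - c * csqrt a = (csqrt a - sqi a n) * c
    - c * (csqrt a - sqi a n) + (sqi a n * c - c * sqi a n) by nc.
have := nrmD ((csqrt a - sqi a n) * c - c * (csqrt a - sqi a n)) (sqi a n * c - c * sqi a n).
have := nrmB ((csqrt a - sqi a n) * c) (c * (csqrt a - sqi a n)).
have := nrmM (csqrt a - sqi a n) c; have := nrmM c (csqrt a - sqi a n).
have := csqrt_sqi n Pa a1; have := sqi_commP c n Pa a1.
have := nrm_ge0 (a * c - c * a); have := nrm_ge0 (csqrt a - sqi a n); have := nrm_ge0 c.
move: (nrm (csqrt a - sqi a n)) (nrm c) cC => u v vC v0 u0 ac0 h1 h2; rewrite (mulrC v).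
have uv : u * v <= (1 - sqw R n) * C by apply: ler_pM.
nra.
Qed.

Lemma star_absl A (x r u : A) : star x * x = r * r -> star r = r ->
  star (x * u) * (x * u) = star (r * u) * (r * u).
Proof. by move=> xr rS; rewrite !starM rS !mulrA -(mulrA _ (star x)) xr !mulrA. Qed.

Lemma nrm_absl A (x r u : A) : star x * x = r * r -> star r = r ->
  nrm (x * u) = nrm (r * u).
Proof.
move=> xr rS; apply/eqP; rewrite -(@eqrXn2 _ 2)// ?nrm_ge0//; apply/eqP.
by rewrite -!nrm_starM (star_absl _ xr rS).
Qed.

(* The polar decomposition of [x = x0 e], cut down to [e (a - d) e <= x^* x]:
   [z] is the limit of [x (sqrt (x^* x) + 1/n)^-1 sqrt (e (a - d) e)]. *)
Lemma polar_perturb (e : R) : 0 < e -> exists2 d : R, 0 < d & forall A (x0 a : A),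
  nrm x0 <= 1 -> Pcone a -> nrm (star x0 * x0 - a) <= d ->
  exists z : A, [/\ nrm (z - x0) <= e, nrm z <= 1, commutant a (star z * z)
    & forall c, c * x0 = x0 -> c * z = z].
Proof.
move=> e0; have e2 : 0 < e / 2 by lra.
have [d1 d1_gt0 sqrt_d1] := csqrt_unif e2.
(* [2 d <= d1] brings the roots [r] and [w] within [e / 2] of each other, and [2 d <= (e / 2)^2]
   brings [x] within [e / 2] of [x0]. *)
pose d := Num.min (d1 / 2) (e ^+ 2 / 8).
have d0 : 0 < d by rewrite lt_min !divr_gt0// exprn_gt0.
have dd1 : 2 * d <= d1.
  by have : d <= d1 / 2 by [rewrite ge_min lexx]; lra.
have de : d <= e ^+ 2 / 8 by rewrite ge_min lexx orbT.
move: d d0 dd1 de => d d0 dd1 de; have dn : d != 0 by rewrite gt_eqF.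
exists d => // A x0 a x01 Pa Ta; set T : A := star x0 * x0 in Ta.
have TS : star T = T by rewrite /T starM starK.
have aS := Pcone_sa Pa.
have adS : star (a - sca d) = a - sca d by rewrite starB starZr star1 aS.
have [p [n [Pp Pn adE [pn np] [cp _]]]] := pos_neg_parts adS.
have [k [Pk k1 k2 ck]] := Pcone_inv Pp d0.
have ca : commutant a (a - sca d) by apply/commutantB/commutantZ/commutant1/commutant_id.
have cap : commutant a p by exact: commutant_trans cp.
have cak : commutant a k by exact: commutant_trans ck.
have pk : p * k = k * p by apply: ck.
(* [E = p (p + d)^-1] is a cutoff in the bicommutant of [a], where [p] is the positive part of
   [a - d]. It removes the negative part, so that [m] below is positive. *)
pose E : A := p * k.
have PE : Pcone E by apply: PconeM.
have ES := Pcone_sa PE.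
have E1 : 1 - E = d *^ k by rewrite -k2 /E; nc.
have P1E : Pcone (1 - E) by rewrite E1; apply: PconeZ => //; exact: ltW.
have nE : nrm E <= 1 by apply: Pcone_le_nrm => //; rewrite scale1r.
have n1E : nrm (1 - E) <= 1 by apply: Pcone_one_sub.
have cE : commutant a E by exact: commutantM.
pose m : A := E * (a - sca d) * E.
have Pm : Pcone m.
  have -> : m = star E * p * E.
    by rewrite ES /m adE [E * (p - n)]mulrBr /E pk -(mulrA k p n) pn mulr0 subr0.
  exact: Pcone_conj.
have cm : commutant a m by exact/commutantM/cE/commutantM.
pose x : A := x0 * E; pose y : A := star x * x.
have yE : y = E * T * E by rewrite /y /x starM ES /T !mulrA.
have Py : Pcone y by exact: Pcone_star_mul.
have ym : y - m = E * (sca d - (a - T)) * E by rewrite yE /m; nc.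
have Pym : Pcone (y - m).
  rewrite ym -{1}ES; apply/Pcone_conj/Pcone_sub_nrm; first by rewrite starB aS TS.
  by rewrite nrmBC.
have ny : nrm y <= 1.
  by rewrite /y nrm_starM exprn_ile1 ?nrm_ge0//; exact: nrmM1.
have nm : nrm m <= 1 by apply: le_trans ny; exact: Pcone_lenrm.
have nym : nrm (y - m) <= d1.
  rewrite ym; apply: le_trans dd1; rewrite -[2 * d]mul1r -[1 * _]mulr1.
  apply: nrmM_le => //; apply: nrmM_le => //.
  have := nrmB (sca d) (a - T); rewrite (nrmBC a) nrmZr (ger0_norm (ltW d0)).
  by have := nrm1_le A; nra.
pose r := csqrt y; pose w := csqrt m.
have [Pr rr cr] := csqrtP Py; have [Pw ww cw] := csqrtP Pm.
rewrite -/r in Pr rr cr; rewrite -/w in Pw ww cw.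
have rS := Pcone_sa Pr; have wS := Pcone_sa Pw.
have nrw : nrm (r - w) <= e / 2 by exact: sqrt_d1.
have [v [v_gt0 small]] : exists v : nat -> R, (forall i, 0 < v i) /\
    forall eta : R, 0 < eta -> exists N, forall i, (N <= i)%N -> v i < eta.
  exists (fun i => i.+1%:R^-1); split=> [i|eta eta0]; first by rewrite invr_gt0.
  have := archi_boundP (ltW (divr_gt0 (@ltr01 R) eta0)); rewrite div1r.
  set N := Num.bound _ => hN; exists N => i Ni.
  rewrite -[eta]invrK ltf_pV2 ?posrE ?invr_gt0//.
  by apply: lt_le_trans hN _; rewrite ler_nat (leq_trans Ni).
pose s i := projT1 (cid (Pcone_inv Pr (v_gt0 i))).
have sP i : [/\ Pcone (s i), s i * (r + sca (v i)) = 1,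
    (r + sca (v i)) * s i = 1 & commutant r (s i)].
  by rewrite /s; case: cid.
have rs i : r * s i = s i * r by have [_ _ _ c] := sP i; exact: c.
pose t i : A := v i *^ s i.
have tE i : t i = 1 - r * s i.
  by have [_ _ <- _] := sP i; rewrite /t; nc.
have Pt i : Pcone (t i).
  by have [Ps _ _ _] := sP i; apply: PconeZ => //; exact: ltW.
have tS i : star (t i) = t i by exact/Pcone_sa.
have Prs i : Pcone (r * s i) by have [Ps _ _ _] := sP i; exact: PconeM.
have nrs i : nrm (r * s i) <= 1.
  by apply: Pcone_le_nrm => //; rewrite scale1r -tE.
have nrt i : nrm (r * t i) <= v i.
  rewrite /t scAr nrmZr (ger0_norm (ltW (v_gt0 i))).
  by rewrite ler_piMr// ltW.
(* This is where [m <= y] enters: [t m t <= t y t] bounds the norm of [t w] by that of [r t]. *)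
have ntw i : nrm (t i * w) <= v i.
  suff : nrm (t i * w) ^+ 2 <= nrm (r * t i) ^+ 2.
    by rewrite ler_sqr ?nnegrE ?nrm_ge0// => /le_trans; exact.
  have -> : nrm (t i * w) ^+ 2 = nrm (star (t i) * m * t i).
    by rewrite (nrm_mul_sqrt _ wS ww) tS.
  have -> : nrm (r * t i) ^+ 2 = nrm (star (t i) * y * t i).
    by rewrite -nrm_starM starM rS -rr !mulrA.
  by apply: Pcone_lenrm; [exact: Pcone_conj|exact: Pcone_conj_le].
pose z i : A := x * s i * w.
have xr : star x * x = r * r by rewrite rr.
have zd i j : nrm (z i - z j) <= v i + v j.
  have -> : z i - z j = x * ((s i - s j) * w) by rewrite /z; nc.
  rewrite (nrm_absl _ xr rS).
  have -> : r * ((s i - s j) * w) = t j * w - t i * w by rewrite !tE; nc.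
  by apply: le_trans (nrmB _ _) _; rewrite addrC lerD.
have [Z zZ] : exists Z, climit z Z.
  apply: climit_cauchy => eta eta0; have [|N hN] := small (eta / 2); first by lra.
  exists N => i j Ni Nj; have := zd i j; have := hN i Ni; have := hN j Nj; lra.
have zzE i : star (z i) * z i = star (w - t i * w) * (w - t i * w).
  have -> : w - t i * w = r * s i * w by rewrite tE; nc.
  by rewrite /z -!(mulrA _ (s i)) (star_absl _ xr rS).
have ZZ : star Z * Z = m.
  apply: (climit_unique (climitM (climit_star zZ) zZ)).
  rewrite (funext zzE).
  have lw : climit (fun i => w - t i * w) w.
    move=> eta eta0; have [N hN] := small eta eta0; exists N => i Ni.
    rewrite (_ : _ - _ = - (t i * w)); last by nc.
    by rewrite nrmN; apply: le_lt_trans (ntw i) (hN i Ni).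
  by have := climitM (climit_star lw) lw; rewrite wS ww.
exists Z; split.
- have nZx : nrm (Z - x) <= e / 2.
    apply/ler_addgt0Pr => eta eta0.
    have [|N hN] := small (eta / 2); first by lra.
    have [|M hM] := zZ (eta / 2); first by lra.
    have := hN (maxn N M) (leq_maxl _ _); have := hM (maxn N M) (leq_maxr _ _).
    set i := maxn N M.
    have : nrm (z i - x) <= e / 2 + v i.
      have -> : z i - x = - (x * (s i * (r - w))) - x * t i.
        rewrite /z (_ : - _ - _ = x * s i * w - x * (s i * r + t i)); last by nc.
        by rewrite (_ : s i * r + t i = 1) ?mulr1// -rs tE addrC subrK.
      apply: le_trans (nrmB _ _) _; rewrite nrmN !(nrm_absl _ xr rS).
      by apply: lerD (nrt i); rewrite mulrA -[e / 2]mul1r; exact: nrmM_le.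
    have := nrm_tri Z (z i) x; rewrite (nrmBC Z (z i)); lra.
  have nx : nrm (x - x0) <= e / 2.
    have -> : x - x0 = - (x0 * (1 - E)) by rewrite /x; nc.
    rewrite nrmN; suff : nrm (x0 * (1 - E)) ^+ 2 <= (e / 2) ^+ 2.
      by rewrite ler_sqr ?nnegrE ?nrm_ge0// ltW.
    have sE : star (1 - E) = 1 - E by exact: Pcone_sa.
    rewrite -nrm_starM starM sE.
    have -> : (1 - E) * star x0 * (x0 * (1 - E)) =
      (1 - E) * (T - a) * (1 - E) + (1 - E) * a * (1 - E) by rewrite /T; nc.
    have n2 : nrm ((1 - E) * a * (1 - E)) <= d.
      have Q1 : Pcone ((1 - E) * a * (1 - E)) by rewrite -{1}sE; exact: Pcone_conj.
      (* From [1 - E = d (p + d)^-1] the difference is [(1 - E) n (1 - E)], with [n] the negative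
         part of [a - d]. *)
      have Q2 : Pcone (d *^ (1 - E) - (1 - E) * a * (1 - E)).
        have -> : d *^ (1 - E) = (1 - E) * (p + sca d) * (1 - E).
          by rewrite {3}E1 scAr -mulrA k2 mulr1.
        rewrite -mulrBl -mulrBr -{1}sE; apply: Pcone_conj.
        have -> : a = p - n + sca d by rewrite -adE subrK.
        by have -> : p + sca d - (p - n + sca d) = n by nc.
      apply: le_trans (Pcone_lenrm Q1 Q2) _; rewrite nrmZr (ger0_norm (ltW d0)).
      by have := nrm_ge0 (1 - E); nra.
    have := nrmD ((1 - E) * (T - a) * (1 - E)) ((1 - E) * a * (1 - E)).
    have : nrm ((1 - E) * (T - a) * (1 - E)) <= 1 * d * 1 by do 2?apply: nrmM_le.
    rewrite mul1r mulr1; lra.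
  by have := nrm_tri Z x x0; lra.
- by have := nrm_starM Z; rewrite ZZ => h; have := nrm_ge0 Z; nra.
- by rewrite ZZ.
- move=> c cx0; apply: (climit_unique (climitMl c zZ)).
  rewrite (_ : (fun n => _) = z)//; apply/funext => i.
  by rewrite /z /x !mulrA cx0.
Qed.

End SqrtFun.

(* Unlike in [cstarType], the norm is real-valued and completeness is sequential. *)
Record cstar_data (R : realType) := CstarData {
  cd_sort : lmodType R[i] ;
  cd_mul : cd_sort -> cd_sort -> cd_sort ;
  cd_one : cd_sort ;
  cd_star : cd_sort -> cd_sort ;
  cd_nr : cd_sort -> R ;
  cd_mulA : associative cd_mul ;
  cd_mul1 : left_id cd_one cd_mul ;
  cd_mulr1 : right_id cd_one cd_mul ;
  cd_mulDl : left_distributive cd_mul +%R ;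
  cd_mulDr : right_distributive cd_mul +%R ;
  cd_scaleAl : forall (c : R[i]) x y, c *: cd_mul x y = cd_mul (c *: x) y ;
  cd_scaleAr : forall (c : R[i]) x y, c *: cd_mul x y = cd_mul x (c *: y) ;
  cd_starK : involutive cd_star ;
  cd_starD : forall x y, cd_star (x + y) = cd_star x + cd_star y ;
  cd_starZ : forall (c : R[i]) x, cd_star (c *: x) = Num.conj c *: cd_star x ;
  cd_starM : forall x y, cd_star (cd_mul x y) = cd_mul (cd_star y) (cd_star x) ;
  cd_nrD : forall x y, cd_nr (x + y) <= cd_nr x + cd_nr y ;
  cd_nrZ : forall (c : R[i]) x, cd_nr (c *: x) = complex.Re `|c| * cd_nr x ;
  cd_nr_eq0 : forall x, cd_nr x = 0 -> x = 0 ;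
  cd_nrM : forall x y, cd_nr (cd_mul x y) <= cd_nr x * cd_nr y ;
  cd_nr_starM : forall x, cd_nr (cd_mul (cd_star x) x) = cd_nr x ^+ 2 ;
  cd_complete : forall u : nat -> cd_sort,
    (forall e : R, 0 < e -> exists N, forall m n, (N <= m)%N -> (N <= n)%N ->
       cd_nr (u m - u n) < e) ->
    exists l, forall e : R, 0 < e -> exists N, forall n, (N <= n)%N -> cd_nr (u n - l) < e
}.

Section CstarOfData.
Variable R : realType.

Lemma cd_nrBC (d : cstar_data R) (x y : cd_sort d) : cd_nr (x - y) = cd_nr (y - x).
Proof. by rewrite -(opprB y x) -(scaleN1r (y - x)) cd_nrZ normrN normr1 /= mul1r. Qed.

Definition data_sort (d : cstar_data R) : Type := cd_sort d.

Section Instances.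
Variable d : cstar_data R.
HB.instance Definition _ := GRing.Lmodule.copy (data_sort d) (cd_sort d).

Definition data_norm (x : data_sort d) : R[i] := (cd_nr x)%:C.

Let normD (x y : data_sort d) : data_norm (x + y) <= data_norm x + data_norm y.
Proof. by rewrite /data_norm -rmorphD/= lecR; exact: cd_nrD. Qed.

Let normZ (c : R[i]) (x : data_sort d) : data_norm (c *: x) = `|c| * data_norm x.
Proof.
by rewrite /data_norm (cd_nrZ c x) rmorphM/=; congr (_ * _).
Qed.

Let norm_eq0 (x : data_sort d) : data_norm x = 0 -> x = 0.
Proof. by move=> /complexI/cd_nr_eq0. Qed.

HB.instance Definition _ :=
  @Lmodule_isNormed.Build R[i] (data_sort d) data_norm normD normZ norm_eq0.

(** From filters to sequences: pick sets [P n] of the filter of diameter below [1 / (n + 1)] and a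
    point [u n] in the first [n + 1] of them. The limit of [u] is the limit of the filter. *)
Let complete (G : set_system (data_sort d)) : ProperFilter G -> cauchy G -> cvg G.
Proof.
move=> GG /cauchy_ballP Gc.
have PN n : exists P : set (data_sort d), G P /\
    forall x y, P x -> P y -> cd_nr (x - y) < n.+1%:R^-1.
  have [|[P Q] /= [GP GQ] PQ] := Gc (n.+1%:R^-1)%:C; first by rewrite ltcR invr_gt0.
  exists (P `&` Q); split; first exact: filterI.
  move=> x y [Px _] [_ Qy]; have := PQ (x, y) (conj Px Qy).
  by rewrite -ball_normE /= [`|_|]/(data_norm _) ltcR.
pose P n := projT1 (cid (PN n)).
have GP n : G (P n) by rewrite /P; case: cid => ? [].
have PP n x y : P n x -> P n y -> cd_nr (x - y) < n.+1%:R^-1.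
  by rewrite /P; case: cid => ? [] /= _; exact.
have un n : exists x, forall k, (k <= n)%N -> P k x.
  suff [Q [GQ QP]] : exists Q, G Q /\ forall x, Q x -> forall k, (k <= n)%N -> P k x.
    by have [x Qx] := filter_ex GQ; exists x; exact: QP.
  elim: n => [|n [Q [GQ QP]]].
    by exists (P 0%N); split=> // x Px k; rewrite leqn0 => /eqP ->.
  exists (Q `&` P n.+1); split; first exact: filterI.
  by move=> x [/QP Qx Px] k; rewrite leq_eqVlt ltnS => /predU1P[->//|/Qx].
pose u n := projT1 (cid (un n)).
have uP k n : (k <= n)%N -> P k (u n) by rewrite /u; case: cid => /= x; exact.
have small (e : R) : 0 < e -> exists N : nat, N.+1%:R^-1 < e.
  move=> e0; have := archi_boundP (ltW (divr_gt0 (@ltr01 R) e0)); rewrite div1r.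
  set N := Num.bound _ => hN; exists N.
  rewrite -[e]invrK ltf_pV2 ?posrE ?invr_gt0//.
  by apply: lt_le_trans hN _; rewrite ler_nat.
have [e e0|l ul] := @cd_complete R d u.
  have [N hN] := small e e0; exists N => m n Nm Nn.
  by apply: lt_trans hN; apply: (PP N); exact: uP.
apply/cvg_ex; exists (l : data_sort d); apply/cvgrPdist_lt => e.
rewrite ltcE => /andP[/eqP/= e0 e1].
have [|N hN] := small (complex.Re e / 2); first by lra.
have [|M hM] := ul (complex.Re e / 2); first by lra.
near=> x; rewrite [`|_|]/(data_norm _) ltcE /= e0 eqxx /=.
have Px : P N x by near: x; exact: GP.
have := PP N _ _ (uP N (maxn N M) (leq_maxl _ _)) Px; have := hM _ (leq_maxr N M).
have := cd_nrD (l - u (maxn N M)) (u (maxn N M) - x); rewrite subrKA.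
have -> : cd_nr (l - u (maxn N M)) = cd_nr (u (maxn N M) - l) by exact: cd_nrBC.
by move: (N.+1%:R^-1) hN => v hN h1 h2 h3; lra.
Unshelve. all: by end_near. Qed.

HB.instance Definition _ := Uniform_isComplete.Build (data_sort d) complete.

Let dnormM (x y : data_sort d) : `|cd_mul x y : data_sort d| <= `|x| * `|y|.
Proof. by rewrite [`|_|]/(data_norm _) [`|x|]/(data_norm _) [`|y|]/(data_norm _) -rmorphM/= lecR cd_nrM. Qed.

Let dnorm_starM (x : data_sort d) : `|cd_mul (cd_star x) x : data_sort d| = `|x| ^+ 2.
Proof. by rewrite [`|_|]/(data_norm _) [`|x|]/(data_norm _) -rmorphXn/=; congr _%:C; exact: cd_nr_starM. Qed.

Definition cstar_of_data : cstarType R := @CStarType R (data_sort d)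
  (@cd_mul R d) (@cd_one R d) (@cd_star R d)
  (@cd_mulA R d) (@cd_mul1 R d) (@cd_mulr1 R d) (@cd_mulDl R d) (@cd_mulDr R d)
  (@cd_scaleAl R d) (@cd_scaleAr R d) dnormM
  (@cd_starK R d) (@cd_starD R d) (@cd_starZ R d) (@cd_starM R d) dnorm_starM.

End Instances.

End CstarOfData.

(** * Hilbert modules and their operators *)

Section HilbertModule.
Variables (R : realType) (I : choiceType) (A : cstarType R).
Implicit Types (x y z : I -> A) (S T : seq I).

(** For [N >= nrm X], the choice [b = a / N] leaves [Y - a^* a / N] positive; [N] then decreases to
    [nrm X], which may be 0. Stated for a bare form because it serves inner products, completely
    positive maps and, with [X = 0], order zero maps. *)
Lemma Pcone_CS (X Y a : A) : Pcone X ->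
  (forall b : A, Pcone (Y - star b * a - star a * b + star b * X * b)) ->
  nrm a ^+ 2 <= nrm X * nrm Y.
Proof.
move=> PX h.
have key (N : R) : 0 < N -> nrm X <= N -> nrm a ^+ 2 <= N * nrm Y.
  move=> N0 XN; have Nn : N != 0 by rewrite gt_eqF.
  have P1 : Pcone (Y - (N^-1) *^ (star a * a)).
    have -> : Y - (N^-1) *^ (star a * a) =
       (Y - star ((N^-1) *^ a) * a - star a * ((N^-1) *^ a) +
        star ((N^-1) *^ a) * X * ((N^-1) *^ a)) +
       star ((N^-1) *^ a) * (sca N - X) * ((N^-1) *^ a).
      rewrite starZr; transitivity (Y - (N^-1 + N^-1 - N^-1 * (N * N^-1)) *^ (star a * a)).
        by rewrite mulfV// mulr1 addrK.
      by nc.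
    by apply: PconeD (h _) (Pcone_conj _ (Pcone_sub_nrm (Pcone_sa PX) XN)).
  have P0 : Pcone ((N^-1) *^ (star a * a)).
    by apply/PconeZ/Pcone_star_mul; rewrite invr_ge0 ltW.
  have := Pcone_lenrm P0 P1.
  by rewrite nrmZr ger0_norm ?invr_ge0 ?(ltW N0)// nrm_starM mulrC ler_pdivrMr// mulrC.
have X0 := nrm_ge0 X; have Y0 := nrm_ge0 Y.
apply/ler_addgt0Pr => e e0.
have Y1 : 0 < nrm Y + 1 by lra.
have := key (nrm X + e / (nrm Y + 1)).
have q0 : 0 < e / (nrm Y + 1) by rewrite divr_gt0.
move=> /(_ _ _)/le_trans; apply; [lra|lra|].
by rewrite mulrDl lerD2l mulrAC ler_pdivrMr//; nra.
Qed.

Definition ips S x y : A := \sum_(i <- S) star (x i) * y i.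

Lemma ips_ge0 S x : Pcone (ips S x x).
Proof. by apply: Pcone_sum => i _; exact: Pcone_star_mul. Qed.

Lemma ipsDr S x y z : ips S x (fun i => y i + z i) = ips S x y + ips S x z.
Proof. by rewrite /ips -big_split; apply: eq_bigr => i _; rewrite mulrDr. Qed.

Lemma ipsBr S x y z : ips S x (fun i => y i - z i) = ips S x y - ips S x z.
Proof. by rewrite /ips -sumrB; apply: eq_bigr => i _; rewrite mulrBr. Qed.

Lemma ipsMr S x y (b : A) : ips S x (fun i => y i * b) = ips S x y * b.
Proof. by rewrite /ips mulr_suml; apply: eq_bigr => i _; rewrite mulrA. Qed.

Lemma ipsZr S x y (c : R[i]) : ips S x (fun i => c *: y i) = c *: ips S x y.
Proof. by rewrite /ips scaler_sumr; apply: eq_bigr => i _; rewrite scAr. Qed.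

Lemma ips_star S x y : star (ips S x y) = ips S y x.
Proof. by rewrite /ips star_sum; apply: eq_bigr => i _; rewrite starM starK. Qed.

Lemma ipsDl S x y z : ips S (fun i => y i + z i) x = ips S y x + ips S z x.
Proof. by rewrite -ips_star ipsDr starD !ips_star. Qed.

Lemma ipsBl S x y z : ips S (fun i => y i - z i) x = ips S y x - ips S z x.
Proof. by rewrite -ips_star ipsBr starB !ips_star. Qed.

Lemma ips_CS S x y : nrm (ips S x y) ^+ 2 <= nrm (ips S x x) * nrm (ips S y y).
Proof.
apply: Pcone_CS; first exact: ips_ge0.
move=> b; suff -> : ips S y y - star b * ips S x y - star (ips S x y) * b
    + star b * ips S x x * b = ips S (fun i => y i - x i * b) (fun i => y i - x i * b).
  exact: ips_ge0.
have h u : ips S (fun i => x i * b) u = star b * ips S x u.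
  by rewrite -ips_star ipsMr starM ips_star.
by rewrite ipsBr !ipsBl !ipsMr !h !ips_star; nc.
Qed.

Lemma ips_par S x y : nrm (ips S (fun i => x i + y i) (fun i => x i + y i)) <=
  2 * nrm (ips S x x) + 2 * nrm (ips S y y).
Proof.
have -> : ips S (fun i => x i + y i) (fun i => x i + y i) =
   2 *^ ips S x x + 2 *^ ips S y y
   - ips S (fun i => x i - y i) (fun i => x i - y i).
  by rewrite !(ipsBr, ipsBl) !(ipsDr, ipsDl); nc.
have P1 : Pcone (2 *^ ips S x x + 2 *^ ips S y y
   - ips S (fun i => x i - y i) (fun i => x i - y i)).
  have -> : 2 *^ ips S x x + 2 *^ ips S y y
   - ips S (fun i => x i - y i) (fun i => x i - y i) =
    ips S (fun i => x i + y i) (fun i => x i + y i).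
    by rewrite !(ipsBr, ipsBl) !(ipsDr, ipsDl); nc.
  exact: ips_ge0.
have := @Pcone_lenrm _ _ _ (2 *^ ips S x x + 2 *^ ips S y y) P1.
rewrite opprB addrCA subrr addr0 => /(_ (ips_ge0 _ _)) h.
apply: le_trans h _; apply: le_trans (nrmD _ _) _.
by rewrite !nrmZr ger0_norm.
Qed.

Definition disj S T := all (fun i => i \notin T) S.

(** Norm convergence expressed by tails, with duplicate-free lists as finite sets. Bounded partial
    sums would be too weak over a C*-algebra, where increasing bounded nets may diverge. *)
Definition l2 x := forall e : R, 0 < e ->
  exists T, forall S, uniq S -> disj S T -> nrm (ips S x x) <= e.

Lemma disj_cat S T U : disj S (T ++ U) -> disj S T /\ disj S U.
Proof.
by move=> /allP h; split; apply/allP => i /h; rewrite mem_cat negb_or => /andP[].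
Qed.

Lemma l2_dom x y (C : R) : (forall S, nrm (ips S y y) <= C * nrm (ips S x x)) ->
  l2 x -> l2 y.
Proof.
move=> yx xl e e0; have C1 : 0 < `|C| + 1 by have := normr_ge0 C; lra.
have [T hT] := xl (e / (`|C| + 1)) (divr_gt0 e0 C1).
exists T => S uS ST; have := hT S uS ST; rewrite ler_pdivlMr// => h.
have := yx S; have := nrm_ge0 (ips S x x); have := ler_norm C; nra.
Qed.

Lemma l2D x y : l2 x -> l2 y -> l2 (fun i => x i + y i).
Proof.
move=> xl yl e e0; have e4 : 0 < e / 4 by lra.
have [T hT] := xl _ e4; have [U hU] := yl _ e4.
exists (T ++ U) => S uS /disj_cat[ST SU].
by have := ips_par S x y; have := hT S uS ST; have := hU S uS SU; lra.
Qed.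

Lemma l2Z (c : R[i]) x : l2 x -> l2 (fun i => c *: x i).
Proof.
apply: (@l2_dom _ _ (complex.Re `|c| * complex.Re `|conjc c|)) => S.
by rewrite ipsZr -ips_star ipsZr starZ ips_star !nrmZ mulrA.
Qed.

Lemma l2Mr x (b : A) : l2 x -> l2 (fun i => x i * b).
Proof.
apply: (@l2_dom _ _ (nrm b ^+ 2)) => S.
rewrite ipsMr -ips_star ipsMr starM ips_star.
apply: le_trans (nrmM _ _) _; rewrite expr2 -mulrA (mulrC (nrm b)).
have := nrmM (star b) (ips S x x); rewrite nrm_star; have := nrm_ge0 b.
have := nrm_ge0 (ips S x x); nra.
Qed.

Lemma l20 : l2 (fun=> 0).
Proof.
by move=> e e0; exists [::] => S _ _; rewrite /ips big1 ?nrm0 ?ltW// => i _; rewrite mulr0.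
Qed.

Lemma sum_filter S T (f : I -> A) : uniq S -> uniq T -> {subset T <= S} ->
  \sum_(i <- S) f i = \sum_(i <- T) f i + \sum_(i <- [seq i <- S | i \notin T]) f i.
Proof.
move=> uS uT TS; rewrite (bigID (mem T)) /= big_filter; congr (_ + _).
rewrite -big_filter; apply: perm_big; apply: uniq_perm => //; first exact: filter_uniq.
by move=> i; rewrite mem_filter; case: (boolP (i \in T)) => //= /TS ->.
Qed.

Definition netlim (f : seq I -> A) (l : A) := forall e : R, 0 < e ->
  exists T, forall S, uniq S -> {subset T <= S} -> nrm (f S - l) <= e.

Lemma netlim_unique f l l' : netlim f l -> netlim f l' -> l = l'.
Proof.
move=> fl fl'; apply/eqP; rewrite -subr_eq0; apply/eqP/nrm_eq0/le_anti.
rewrite nrm_ge0 andbT; apply/ler_addgt0Pr => e e0; rewrite add0r.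
have e2 : 0 < e / 2 by lra.
have [T hT] := fl _ e2; have [U hU] := fl' _ e2.
have uS := undup_uniq (T ++ U).
set S := undup (T ++ U) in uS.
have h1 : nrm (f S - l) <= e / 2.
  by apply: hT => // i iT; rewrite mem_undup mem_cat iT.
have h2 : nrm (f S - l') <= e / 2.
  by apply: hU => // i iT; rewrite mem_undup mem_cat iT orbT.
by have := nrm_tri l (f S) l'; rewrite (nrmBC l (f S)); lra.
Qed.

Lemma netlim_ex (f : seq I -> A) :
  (forall e : R, 0 < e -> exists T, uniq T /\ forall S, uniq S -> {subset T <= S} ->
     nrm (f S - f T) <= e) -> exists l, netlim f l.
Proof.
move=> fc.
have v_gt0 (n : nat) : 0 < n.+1%:R^-1 :> R by rewrite invr_gt0.
pose T n := projT1 (cid (fc _ (v_gt0 n))).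
have Tu n : uniq (T n) by rewrite /T; case: cid => ? [].
have TP n S : uniq S -> {subset T n <= S} -> nrm (f S - f (T n)) <= n.+1%:R^-1.
  by rewrite /T; case: cid => ? [] /= _; exact.
have small (e : R) : 0 < e -> exists N : nat, forall n, (N <= n)%N -> n.+1%:R^-1 < e.
  move=> e0; have := archi_boundP (ltW (divr_gt0 (@ltr01 R) e0)); rewrite div1r.
  set N := Num.bound _ => hN; exists N => n Nn.
  rewrite -[e]invrK ltf_pV2 ?posrE ?invr_gt0//.
  by apply: lt_le_trans hN _; rewrite ler_nat (leq_trans Nn).
have [|l fl] := @climit_cauchy _ _ (fun n => f (T n)).
  move=> e e0; have [|N hN] := small (e / 2); first by lra.
  exists N => m n Nm Nn; set S := undup (T m ++ T n).
  have uS : uniq S by exact: undup_uniq.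
  have h1 : nrm (f S - f (T m)) <= m.+1%:R^-1.
    by apply: TP => // i; rewrite mem_undup mem_cat => ->.
  have h2 : nrm (f S - f (T n)) <= n.+1%:R^-1.
    by apply: TP => // i; rewrite mem_undup mem_cat orbC => ->.
  have := nrm_tri (f (T m)) (f S) (f (T n)); rewrite (nrmBC _ (f S)).
  by have := hN m Nm; have := hN n Nn; move: (m.+1%:R^-1) (n.+1%:R^-1) h1 h2 => u v; lra.
exists l => e e0; have [|N hN] := small (e / 2); first by lra.
have [|M hM] := fl (e / 2); first by lra.
exists (T (maxn N M)) => S uS TS; have := TP _ S uS TS.
have := hM _ (leq_maxr N M); have := hN _ (leq_maxl N M).
move: (_.+1%:R^-1) => v h1 h2 h3.
by have := nrm_tri (f S) (f (T (maxn N M))) l; lra.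
Qed.

Lemma netlim_lip (f g : seq I -> A) (C : R) (l m : A) :
  (forall S, nrm (g S - m) <= C * nrm (f S - l)) -> netlim f l -> netlim g m.
Proof.
move=> gf fl e e0; have C1 : 0 < `|C| + 1 by have := normr_ge0 C; lra.
have [T hT] := fl (e / (`|C| + 1)) (divr_gt0 e0 C1).
exists T => S uS TS; have := hT S uS TS; rewrite ler_pdivlMr// => h.
have := gf S; have := nrm_ge0 (f S - l); have := ler_norm C; nra.
Qed.

Lemma netlimD (f g : seq I -> A) (l m : A) :
  netlim f l -> netlim g m -> netlim (fun S => f S + g S) (l + m).
Proof.
move=> fl gm e e0; have e2 : 0 < e / 2 by lra.
have [T hT] := fl _ e2; have [U hU] := gm _ e2.
exists (T ++ U) => S uS TS.
have h1 : nrm (f S - l) <= e / 2.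
  by apply: hT => // i iT; apply: TS; rewrite mem_cat iT.
have h2 : nrm (g S - m) <= e / 2.
  by apply: hU => // i iT; apply: TS; rewrite mem_cat iT orbT.
have := nrmD (f S - l) (g S - m); rewrite addrACA -opprD; lra.
Qed.

Lemma netlim_Pcone (f : seq I -> A) l : netlim f l -> (forall S, Pcone (f S)) -> Pcone l.
Proof.
move=> fl fP.
have v_gt0 (n : nat) : 0 < n.+1%:R^-1 :> R by rewrite invr_gt0.
pose T n := undup (projT1 (cid (fl _ (v_gt0 n)))).
have TP n : nrm (f (T n) - l) <= n.+1%:R^-1.
  rewrite /T; case: cid => /= U; apply; first exact: undup_uniq.
  by move=> i; rewrite mem_undup.
apply: (@Pcone_climit _ _ (fun n => f (T n))) => // e e0.
have := archi_boundP (ltW (divr_gt0 (@ltr01 R) e0)); rewrite div1r.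
set N := Num.bound _ => hN; exists N => n Nn; apply: le_lt_trans (TP n) _.
rewrite -[e]invrK ltf_pV2 ?posrE ?invr_gt0//.
by apply: lt_le_trans hN _; rewrite ler_nat (leq_trans Nn).
Qed.

Lemma netlim_le (f : seq I -> A) l (C : R) :
  netlim f l -> (forall S, uniq S -> nrm (f S) <= C) -> nrm l <= C.
Proof.
move=> fl fC; apply/ler_addgt0Pr => e e0; have [T hT] := fl e e0.
have h1 : nrm (f (undup T) - l) <= e.
  by apply: hT => [|i]; rewrite ?undup_uniq ?mem_undup.
have := fC (undup T) (undup_uniq _).
by have := nrm_tri l (f (undup T)) 0; rewrite !subr0 (nrmBC l (f _)); lra.
Qed.

Lemma ip_ex x y : l2 x -> l2 y -> exists l, netlim (fun S => ips S x y) l.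
Proof.
move=> xl yl; apply: netlim_ex => e e0.
have [T hT] := xl e e0; have [U hU] := yl e e0.
exists (undup (T ++ U)); split; first exact: undup_uniq.
move=> S uS TS; rewrite {1}/ips (sum_filter _ uS (undup_uniq _) TS) addrAC subrr add0r.
set V := [seq i <- S | _].
have uV : uniq V by exact: filter_uniq.
have VTU : disj V (T ++ U).
  by apply/allP => i; rewrite mem_filter mem_undup => /andP[].
have [VT VU] := disj_cat VTU.
have h1 := hT V uV VT; have h2 := hU V uV VU; have := ips_CS V x y.
rewrite -/(ips V x y); have := nrm_ge0 (ips V x x); have := nrm_ge0 (ips V y y).
have := nrm_ge0 (ips V x y); nra.
Qed.

End HilbertModule.

Section HM.
Variables (R : realType) (I : choiceType) (A : cstarType R).

(* The Hilbert module of the families with norm-convergent [\sum_i x_i^* x_i]. *)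
Definition hm : Type := {x : I -> A | `[< l2 x >]}.
Definition hmf (x : hm) : I -> A := sval x.
Coercion hmf : hm >-> Funclass.
Definition mkhm (x : I -> A) (h : l2 x) : hm := exist _ x (asboolT h).

Implicit Types x y z : hm.

Lemma hmP x : l2 x. Proof. by case: x => x /= /asboolP. Qed.

Lemma hm_ext x y : (forall i, x i = y i) -> x = y.
Proof. by move=> h; apply: val_inj; apply/funext. Qed.

HB.instance Definition _ := gen_eqMixin hm.
HB.instance Definition _ := gen_choiceMixin hm.

Definition hm_add x y : hm := mkhm (l2D (hmP x) (hmP y)).
Definition hm_scale (c : R[i]) x : hm := mkhm (l2Z c (hmP x)).
Definition hm_zero : hm := mkhm (@l20 R I A).
Definition hm_opp x : hm := hm_scale (-1) x.

Let addA : associative hm_add.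
Proof. by move=> x y z; apply: hm_ext => i; exact: addrA. Qed.
Let addC : commutative hm_add.
Proof. by move=> x y; apply: hm_ext => i; exact: addrC. Qed.
Let add0 : left_id hm_zero hm_add.
Proof. by move=> x; apply: hm_ext => i; exact: add0r. Qed.
Let addN : left_inverse hm_zero hm_opp hm_add.
Proof. by move=> x; apply: hm_ext => i; rewrite /= scaleN1r addNr. Qed.

HB.instance Definition _ := GRing.isZmodule.Build hm addA addC add0 addN.

Let scaleA (a b : R[i]) x : hm_scale a (hm_scale b x) = hm_scale (a * b) x.
Proof. by apply: hm_ext => i; exact: scalerA. Qed.
Let scale1 : left_id 1 hm_scale.
Proof. by move=> x; apply: hm_ext => i; exact: scale1r. Qed.
Let scaleDr : right_distributive hm_scale +%R.
Proof. by move=> c x y; apply: hm_ext => i; exact: scalerDr. Qed.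
Let scaleDl x : {morph hm_scale^~ x : a b / a + b}.
Proof. by move=> a b; apply: hm_ext => i; exact: scalerDl. Qed.

HB.instance Definition _ :=
  GRing.Zmodule_isLmodule.Build R[i] hm scaleA scale1 scaleDr scaleDl.

Lemma hmDE x y i : hmf (x + y) i = x i + y i. Proof. by []. Qed.
Lemma hmZE (c : R[i]) x i : hmf (c *: x) i = c *: x i. Proof. by []. Qed.
Lemma hmNE x i : hmf (- x) i = - x i. Proof. by rewrite -scaleN1r hmZE scaleN1r. Qed.
Lemma hmBE x y i : hmf (x - y) i = x i - y i. Proof. by rewrite hmDE hmNE. Qed.
Lemma hm0E i : hmf 0 i = 0. Proof. by []. Qed.

Lemma hm_sumE (J : Type) (s : seq J) (F : J -> hm) i :
  hmf (\sum_(j <- s) F j) i = \sum_(j <- s) F j i.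
Proof. by elim: s => [|j s IH]; rewrite ?big_nil ?big_cons ?hm0E// hmDE IH. Qed.

Definition hm_mulr x (b : A) : hm := mkhm (l2Mr b (hmP x)).

Lemma hm_mulrE x b i : hm_mulr x b i = x i * b. Proof. by []. Qed.

Definition ip x y : A := projT1 (cid (ip_ex (hmP x) (hmP y))).

Lemma ipP x y : netlim (fun S => ips S x y) (ip x y).
Proof. by rewrite /ip; case: cid. Qed.

Lemma ip_unique x y l : netlim (fun S => ips S x y) l -> ip x y = l.
Proof. exact: (netlim_unique (@ipP x y)). Qed.

Lemma ip_star x y : star (ip x y) = ip y x.
Proof.
apply/esym/ip_unique; apply: (@netlim_lip _ _ _ _ _ 1 _ _ _ (@ipP x y)) => S.
by rewrite -ips_star -starB nrm_star mul1r.
Qed.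

Lemma ipDr x y z : ip x (y + z) = ip x y + ip x z.
Proof.
apply: ip_unique.
rewrite (_ : (fun S => _) = (fun S => ips S x y + ips S x z)); first exact/netlimD/ipP/ipP.
by apply/funext => S; rewrite -ipsDr.
Qed.

Lemma ipZr x y (c : R[i]) : ip x (c *: y) = c *: ip x y.
Proof.
apply: ip_unique; apply: (@netlim_lip _ _ _ _ _ (complex.Re `|c|) _ _ _ (@ipP x y)) => S.
by rewrite (_ : ips S x (hmf (c *: y)) = c *: ips S x y) ?ipsZr// -scalerBr nrmZ.
Qed.

Lemma ipMr x y (b : A) : ip x (hm_mulr y b) = ip x y * b.
Proof.
apply: ip_unique; apply: (@netlim_lip _ _ _ _ _ (nrm b) _ _ _ (@ipP x y)) => S.
by rewrite (_ : ips S x (hm_mulr y b) = ips S x y * b) ?ipsMr// -mulrBl mulrC nrmM.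
Qed.

Lemma ipNr x y : ip x (- y) = - ip x y.
Proof. by rewrite -scaleN1r ipZr scaleN1r. Qed.

Lemma ipBr x y z : ip x (y - z) = ip x y - ip x z.
Proof. by rewrite ipDr ipNr. Qed.

Lemma ip0r x : ip x 0 = 0.
Proof. by rewrite -(scale0r (0 : hm)) ipZr scale0r. Qed.

Lemma ipDl x y z : ip (y + z) x = ip y x + ip z x.
Proof. by rewrite -ip_star ipDr starD !ip_star. Qed.

Lemma ipBl x y z : ip (y - z) x = ip y x - ip z x.
Proof. by rewrite -ip_star ipBr starB !ip_star. Qed.

Lemma ipZl x y (c : R[i]) : ip (c *: x) y = conjc c *: ip x y.
Proof. by rewrite -ip_star ipZr starZ ip_star. Qed.

Lemma ipMl x y (b : A) : ip (hm_mulr x b) y = star b * ip x y.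
Proof. by rewrite -ip_star ipMr starM ip_star. Qed.

Lemma ip_sumr (J : Type) (s : seq J) (F : J -> hm) x :
  ip x (\sum_(j <- s) F j) = \sum_(j <- s) ip x (F j).
Proof. by apply: (big_morph _ (@ipDr x)); exact: ip0r. Qed.

Lemma ip_suml (J : Type) (s : seq J) (F : J -> hm) x :
  ip (\sum_(j <- s) F j) x = \sum_(j <- s) ip (F j) x.
Proof. by rewrite -ip_star ip_sumr star_sum; apply: eq_bigr => j _; rewrite ip_star. Qed.

Lemma ip_ge0 x : Pcone (ip x x).
Proof. by apply: (netlim_Pcone (@ipP x x)) => S; exact: ips_ge0. Qed.

Lemma ip_CS x y : nrm (ip x y) ^+ 2 <= nrm (ip x x) * nrm (ip y y).
Proof.
apply: Pcone_CS; first exact: ip_ge0.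
move=> b; rewrite (_ : _ + _ = ip (y - hm_mulr x b) (y - hm_mulr x b)); first exact: ip_ge0.
by rewrite ipBr !ipBl !ipMr !ipMl ip_star; nc.
Qed.

Definition hn x : R := Num.sqrt (nrm (ip x x)).

Lemma hn_ge0 x : 0 <= hn x. Proof. exact: sqrtr_ge0. Qed.

Lemma hn_sq x : hn x ^+ 2 = nrm (ip x x).
Proof. by rewrite sqr_sqrtr ?nrm_ge0. Qed.

Lemma ler_sq (a b : R) : 0 <= b -> a ^+ 2 <= b ^+ 2 -> a <= b.
Proof. by move=> b0; have [a0|a0 _] := ltP 0 a; [rewrite ler_sqr ?nnegrE// ltW|exact: le_trans b0]. Qed.

Lemma ip_hn x y : nrm (ip x y) <= hn x * hn y.
Proof.
apply: ler_sq; first by rewrite mulr_ge0// hn_ge0.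
by rewrite exprMn !hn_sq ip_CS.
Qed.

Lemma hnD x y : hn (x + y) <= hn x + hn y.
Proof.
apply: ler_sq; first by rewrite addr_ge0// hn_ge0.
rewrite hn_sq ipDr !ipDl sqrrD !hn_sq.
have := nrmD (ip x x + ip y x) (ip x y + ip y y).
have := nrmD (ip x x) (ip y x); have := nrmD (ip x y) (ip y y).
have := ip_hn x y; have := ip_hn y x; rewrite (mulrC (hn y)) mulr2n; lra.
Qed.

Lemma hnZ (c : R[i]) x : hn (c *: x) = complex.Re `|c| * hn x.
Proof.
rewrite /hn ipZr ipZl scalerA nrmZ normrM normcJ.
have -> : complex.Re (`|c| * `|c|) = complex.Re `|c| ^+ 2.
  by rewrite normc_def /= mul0r subr0 expr2.
rewrite sqrtrM ?sqr_ge0// sqrtr_sqr ger0_norm//.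
by rewrite normc_def /= sqrtr_ge0.
Qed.

Lemma hnN x : hn (- x) = hn x.
Proof. by rewrite -scaleN1r hnZ normrN normr1 mul1r. Qed.

Lemma hnBC x y : hn (x - y) = hn (y - x).
Proof. by rewrite -hnN opprB. Qed.

Lemma hn_tri x y z : hn (x - z) <= hn (x - y) + hn (y - z).
Proof. by rewrite -[x - z](subrKA y) hnD. Qed.

Lemma hn0 : hn 0 = 0. Proof. by rewrite /hn ip0r nrm0 sqrtr0. Qed.

Lemma entry_hn x i : nrm (x i) <= hn x.
Proof.
apply: ler_sq; first exact: hn_ge0.
rewrite hn_sq -nrm_starM; apply/ler_addgt0Pr => e e0.
have [T hT] := @ipP x x e e0.
have := hT (undup (i :: T)) (undup_uniq _).
set S := undup _ => h; have {}h : nrm (ips S x x - ip x x) <= e.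
  by apply: h => j jT; rewrite mem_undup inE jT orbT.
have : nrm (star (x i) * x i) <= nrm (ips S x x).
  apply: Pcone_lenrm; first exact: Pcone_star_mul.
  have iS : i \in S by rewrite mem_undup inE eqxx.
  rewrite /ips (perm_big _ (perm_to_rem iS)) big_cons /= addrAC subrr add0r.
  exact: ips_ge0.
by have := nrm_tri (ips S x x) (ip x x) 0; rewrite !subr0; lra.
Qed.

Lemma hn_eq0 x : hn x = 0 -> x = 0.
Proof.
move=> x0; apply: hm_ext => i; apply/nrm_eq0/le_anti.
by rewrite nrm_ge0 andbT -x0 entry_hn.
Qed.

(** Take limits entrywise. Each finite partial sum for [u n - x] is a limit of those for
    [u n - u m], so the Cauchy bound passes to [x], and [x] is square summable because [u N] is and
    the difference is small. *)
Lemma hm_complete (u : nat -> hm) :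
  (forall e : R, 0 < e -> exists N, forall m n, (N <= m)%N -> (N <= n)%N ->
     hn (u m - u n) < e) ->
  exists x, forall e : R, 0 < e -> exists N, forall n, (N <= n)%N -> hn (u n - x) < e.
Proof.
move=> uc.
have ex i : exists a, climit (fun n => u n i) a.
  apply: climit_cauchy => e /uc[N hN]; exists N => m n Nm Nn.
  by apply: le_lt_trans (hN m n Nm Nn); rewrite -hmBE entry_hn.
pose x i := projT1 (cid (ex i)).
have xP i : climit (fun n => u n i) (x i) by rewrite /x; case: cid.
have key (e : R) : 0 < e -> exists N, forall n S, (N <= n)%N -> uniq S ->
    nrm (ips S (fun i => u n i - x i) (fun i => u n i - x i)) <= e.
  move=> e0; have se0 : 0 < Num.sqrt e by rewrite sqrtr_gt0.
  have [N hN] := uc _ se0; exists N => n S Nn uS.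
  apply: (@climit_le _ _ (fun m => ips S (hmf (u n - u (N + m)%N)) (hmf (u n - u (N + m)%N)))).
    rewrite /ips; elim: S {uS} => [|i S IH].
      rewrite big_nil; under eq_fun do rewrite big_nil; exact: climit_cst.
    rewrite big_cons; under eq_fun do rewrite big_cons.
    have L : climit (fun m => hmf (u n - u (N + m)%N) i) (u n i - x i).
      under eq_fun do rewrite hmBE; apply: climitB; first exact: climit_cst.
      by move=> d d0; have [M hM] := xP i d d0; exists M => m Mm; apply: hM; rewrite (leq_trans Mm)// leq_addl.
    by apply: climitD => //; apply: climitM => //; exact: climit_star.
  move=> m; have := hN n (N + m)%N Nn (leq_addr _ _).
  have [y ->] : exists y : hm, u n - u (N + m)%N = y by exists (u n - u (N + m)%N).
  move=> hy.
  have ee : Num.sqrt e ^+ 2 = e by rewrite sqr_sqrtr// ltW.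
  have : nrm (ips S y y) <= nrm (ip y y).
    apply/ler_addgt0Pr => d d0; have [T hT] := @ipP y y d d0.
    have uST : uniq (undup (S ++ T)) by exact: undup_uniq.
    have h : nrm (ips (undup (S ++ T)) y y - ip y y) <= d.
      by apply: hT => // j jT; rewrite mem_undup mem_cat jT orbT.
    have : nrm (ips S y y) <= nrm (ips (undup (S ++ T)) y y).
      apply: Pcone_lenrm; first exact: ips_ge0.
      rewrite {1}/ips (sum_filter _ uST uS); last first.
        by move=> j jS; rewrite mem_undup mem_cat jS.
      rewrite addrAC subrr add0r; exact: ips_ge0.
    by have := nrm_tri (ips (undup (S ++ T)) y y) (ip y y) 0; rewrite !subr0; lra.
  rewrite -hn_sq => h; apply: le_trans h _; rewrite -ee.
  by rewrite ler_sqr ?nnegrE ?hn_ge0 ?ltW.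
have xl : l2 x.
  move=> e e0; have [|N hN] := key (e / 4); first by lra.
  have [|T hT] := hmP (u N) (e := e / 4); first by lra.
  exists T => S uS ST; have := ips_par S (u N) (fun i => - (u N i - x i)).
  rewrite (_ : (fun i => u N i + - (u N i - x i)) = x); last first.
    by apply/funext => i; rewrite opprB addrCA subrr addr0.
  rewrite (_ : ips S (fun i => - _) _ = ips S (fun i => u N i - x i) (fun i => u N i - x i)).
    by have := hT S uS ST; have := hN N S (leqnn N) uS; lra.
  by apply: eq_bigr => i _; rewrite starN mulrNN.
exists (mkhm xl) => e e0; have e2 : 0 < (e / 2) ^+ 2 by rewrite exprn_gt0// divr_gt0.
have [N hN] := key _ e2; exists N => n Nn.
suff : hn (u n - mkhm xl) <= e / 2 by lra.
apply: ler_sq; first by rewrite divr_ge0// ltW.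
rewrite hn_sq; apply: (netlim_le (@ipP _ _)) => S uS.
have -> : ips S (hmf (u n - mkhm xl)) (hmf (u n - mkhm xl)) = ips S (fun i => u n i - x i) (fun i => u n i - x i).
  by apply: eq_bigr => i _; rewrite hmBE.
exact: hN.
Qed.

Lemma l2_delta (i : I) (b : A) : l2 (fun j => if j == i then b else 0).
Proof.
move=> e e0; exists [:: i] => S _ /allP Si.
rewrite /ips big_seq big1 ?nrm0 ?ltW// => j /Si; rewrite inE => /negbTE ->.
by rewrite mulr0.
Qed.

Definition hdelta i b : hm := mkhm (l2_delta i b).

Lemma hdeltaE i b j : hdelta i b j = if j == i then b else 0.
Proof. by []. Qed.

Lemma ip_delta i b y : ip (hdelta i b) y = star b * y i.
Proof.
apply: ip_unique => e e0; exists [:: i] => S uS iS.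
rewrite /ips (perm_big _ (perm_to_rem (iS i (mem_head _ _)))) big_cons big_seq big1.
  by rewrite /= addr0 eqxx subrr nrm0 ltW.
by move=> j; rewrite mem_rem_uniq// !inE => /andP[/negbTE ji _]; rewrite hdeltaE ji star0 mul0r.
Qed.

Lemma ip_ext y z : (forall x, ip x y = ip x z) -> y = z.
Proof.
by move=> h; apply: hm_ext => i; have := h (hdelta i 1); rewrite !ip_delta star1 !mul1r.
Qed.

End HM.

(** * The C*-algebra of adjointable operators on a Hilbert module *)

Section Adjointable.
Variables (R : realType) (I : choiceType) (A : cstarType R).
Local Notation H := (hm I A).
Implicit Types (x y z : H) (T : H -> H).

Definition is_adj T T' := forall x y, ip (T x) y = ip x (T' y).

(** Linearity over the scalars and over [A] comes with the adjoint, since by [ip_ext] inner products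
    determine a vector: see [is_adjD], [is_adjZ] and [is_adjMr]. *)
Definition adjble T := exists T', is_adj T T' /\ exists C : R, forall x, hn (T x) <= C * hn x.

Lemma is_adj_sym T T' : is_adj T T' -> is_adj T' T.
Proof. by move=> h x y; rewrite -ip_star -h ip_star. Qed.

Lemma is_adjD T T' x y : is_adj T T' -> T (x + y) = T x + T y.
Proof.
move=> /is_adj_sym h; apply: ip_ext => z.
by rewrite -h ipDr !h -ipDr.
Qed.

Lemma is_adjZ T T' (c : R[i]) x : is_adj T T' -> T (c *: x) = c *: T x.
Proof. by move=> /is_adj_sym h; apply: ip_ext => z; rewrite -h !ipZr h. Qed.

Lemma is_adjMr T T' x (b : A) : is_adj T T' -> T (hm_mulr x b) = hm_mulr (T x) b.
Proof. by move=> /is_adj_sym h; apply: ip_ext => z; rewrite -h !ipMr h. Qed.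

Lemma adj_bound T T' (C : R) : is_adj T T' -> (forall x, hn (T x) <= C * hn x) ->
  forall x, hn (T' x) <= C * hn x.
Proof.
move=> h TC x; have : hn (T' x) ^+ 2 <= hn (T' x) * (C * hn x).
  rewrite hn_sq -h; apply: le_trans (ip_hn _ _) _.
  rewrite mulrA (mulrC (hn (T' x))); apply: ler_wpM2r => //; exact: hn_ge0.
rewrite expr2; have := hn_ge0 (T' x); rewrite le_eqVlt => /predU1P[<- _|T0]; last by rewrite ler_pM2l.
have := TC x; have := hn_ge0 (T x); exact: le_trans.
Qed.

Lemma hnZr (t : R) x : hn (t *^ x) = `|t| * hn x.
Proof. by rewrite hnZ normc_def /= expr0n addr0 sqrtr_sqr. Qed.

Definition bop : Type := {T : H -> H | `[< adjble T >]}.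
Definition bopf (T : bop) : H -> H := sval T.
Coercion bopf : bop >-> Funclass.
Definition mkbop T (h : adjble T) : bop := exist _ T (asboolT h).

Lemma bopP (T : bop) : adjble T. Proof. by case: T => T /= /asboolP. Qed.

Lemma bop_ext (S T : bop) : (forall x, S x = T x) -> S = T.
Proof. by move=> h; apply: val_inj; apply/funext. Qed.

Definition adjf (T : bop) : H -> H := projT1 (cid (bopP T)).

Lemma adjfP (T : bop) : is_adj T (adjf T).
Proof. by rewrite /adjf; case: cid => T' []. Qed.

Lemma bop_bounded (T : bop) : exists C : R, forall x, hn (T x) <= C * hn x.
Proof. by have [_ [_]] := bopP T. Qed.

Lemma adjble_adjf (T : bop) : adjble (adjf T).
Proof.
have [C hC] := bop_bounded T; exists (bopf T); split; first exact/is_adj_sym/adjfP.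
by exists C; apply: adj_bound hC; exact: adjfP.
Qed.

Definition bop_star (T : bop) : bop := mkbop (adjble_adjf T).

Lemma bop_starP (T : bop) x y : ip (T x) y = ip x (bop_star T y).
Proof. exact: adjfP. Qed.

Lemma bop_starP' (T : bop) x y : ip (bop_star T x) y = ip x (T y).
Proof. exact/is_adj_sym/adjfP. Qed.

Lemma bopD (T : bop) x y : T (x + y) = T x + T y.
Proof. exact/is_adjD/adjfP. Qed.

Lemma bopZ (T : bop) (c : R[i]) x : T (c *: x) = c *: T x.
Proof. exact/is_adjZ/adjfP. Qed.

Lemma bopMr (T : bop) x b : T (hm_mulr x b) = hm_mulr (T x) b.
Proof. exact/is_adjMr/adjfP. Qed.

Lemma bop0 (T : bop) : T 0 = 0.
Proof. by rewrite -(scale0r (0 : H)) bopZ !scale0r. Qed.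

Lemma bop_sum (T : bop) (J : Type) (s : seq J) (F : J -> H) :
  T (\sum_(j <- s) F j) = \sum_(j <- s) T (F j).
Proof. by apply: (big_morph _ (bopD T)); exact: bop0. Qed.

Lemma adjble_add (S T : bop) : adjble (fun x => S x + T x).
Proof.
exists (fun x => adjf S x + adjf T x); split=> [x y|].
  by rewrite ipDl ipDr !adjfP.
have [C hC] := bop_bounded S; have [D hD] := bop_bounded T.
exists (C + D) => x; apply: le_trans (hnD _ _) _.
by rewrite mulrDl lerD.
Qed.

Lemma adjble_scale (c : R[i]) (T : bop) : adjble (fun x => c *: T x).
Proof.
exists (fun x => conjc c *: adjf T x); split=> [x y|].
  by rewrite ipZl ipZr adjfP.
have [C hC] := bop_bounded T; exists (complex.Re `|c| * C) => x.
rewrite hnZ -mulrA; apply: ler_wpM2l => //.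
by rewrite normc_def /= sqrtr_ge0.
Qed.

Lemma adjble_zero : adjble (fun=> 0).
Proof.
exists (fun=> 0); split=> [x y|]; first by rewrite ip0r -ip_star ip0r star0.
by exists 0 => x; rewrite mul0r hn0.
Qed.

Lemma adjble_id : adjble id.
Proof. by exists id; split=> //; exists 1 => x; rewrite mul1r. Qed.

Lemma adjble_comp (S T : bop) : adjble (fun x => S (T x)).
Proof.
exists (fun x => adjf T (adjf S x)); split=> [x y|]; first by rewrite !adjfP.
have [C hC] := bop_bounded S; have [D hD] := bop_bounded T.
exists (`|C| * D) => x; rewrite -mulrA; apply: le_trans (hC _) _.
have := hD x; have := hn_ge0 (T x); have := ler_norm C; have := normr_ge0 C; nra.
Qed.

HB.instance Definition _ := gen_eqMixin bop.
HB.instance Definition _ := gen_choiceMixin bop.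

Definition bop_add (S T : bop) : bop := mkbop (adjble_add S T).
Definition bop_scale (c : R[i]) (T : bop) : bop := mkbop (adjble_scale c T).
Definition bop_zero : bop := mkbop adjble_zero.
Definition bop_one : bop := mkbop adjble_id.
Definition bop_mul (S T : bop) : bop := mkbop (adjble_comp S T).
Definition bop_opp (T : bop) : bop := bop_scale (-1) T.

Let addA : associative bop_add.
Proof. by move=> S T U; apply: bop_ext => x; exact: addrA. Qed.
Let addC : commutative bop_add.
Proof. by move=> S T; apply: bop_ext => x; exact: addrC. Qed.
Let add0 : left_id bop_zero bop_add.
Proof. by move=> T; apply: bop_ext => x; exact: add0r. Qed.
Let addN : left_inverse bop_zero bop_opp bop_add.
Proof. by move=> T; apply: bop_ext => x /=; rewrite scaleN1r addNr. Qed.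

HB.instance Definition _ := GRing.isZmodule.Build bop addA addC add0 addN.

Let scaleA (a b : R[i]) (T : bop) : bop_scale a (bop_scale b T) = bop_scale (a * b) T.
Proof. by apply: bop_ext => x; exact: scalerA. Qed.
Let scale1 : left_id 1 bop_scale.
Proof. by move=> T; apply: bop_ext => x; exact: scale1r. Qed.
Let scaleDr : right_distributive bop_scale +%R.
Proof. by move=> c S T; apply: bop_ext => x; exact: scalerDr. Qed.
Let scaleDl (T : bop) : {morph bop_scale^~ T : a b / a + b}.
Proof. by move=> a b; apply: bop_ext => x; exact: scalerDl. Qed.

HB.instance Definition _ :=
  GRing.Zmodule_isLmodule.Build R[i] bop scaleA scale1 scaleDr scaleDl.

Lemma bopDE (S T : bop) x : bopf (S + T) x = S x + T x. Proof. by []. Qed.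
Lemma bopZE (c : R[i]) (T : bop) x : bopf (c *: T) x = c *: T x. Proof. by []. Qed.
Lemma bopNE (T : bop) x : bopf (- T) x = - T x.
Proof. by rewrite -scaleN1r bopZE scaleN1r. Qed.
Lemma bopBE (S T : bop) x : bopf (S - T) x = S x - T x.
Proof. by rewrite bopDE bopNE. Qed.

Definition opn (T : bop) : R := sup [set hn (T x) | x in [set x | hn x <= 1]].

Lemma opn_has_sup (T : bop) : has_sup [set hn (T x) | x in [set x | hn x <= 1]].
Proof.
split; first by exists (hn (T 0)), 0 => //=; rewrite hn0.
have [C hC] := bop_bounded T; exists `|C| => _ [x /= x1 <-].
apply: le_trans (hC x) _; have := ler_norm C; have := normr_ge0 C; have := hn_ge0 x; nra.
Qed.

Lemma opn_ge0 (T : bop) : 0 <= opn T.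
Proof.
apply: le_trans (hn_ge0 (T 0)) _; apply: (ub_le_sup (proj2 (opn_has_sup T))).
by exists 0 => //=; rewrite hn0.
Qed.

Lemma opn_ub (T : bop) x : hn (T x) <= opn T * hn x.
Proof.
have := hn_ge0 x; rewrite le_eqVlt => /predU1P[x0|x0].
  by rewrite (hn_eq0 (esym x0)) bop0 hn0 mulr0.
have xn : hn x != 0 by rewrite gt_eqF.
rewrite -ler_pdivrMr// mulrC.
have E : (hn x)^-1 * hn (T x) = hn (T ((hn x)^-1 *^ x)).
  by rewrite bopZ hnZr ger0_norm// invr_ge0 ltW.
rewrite E; apply: (ub_le_sup (proj2 (opn_has_sup T))).
exists ((hn x)^-1 *^ x) => //=.
by rewrite hnZr ger0_norm ?mulVf// invr_ge0 ltW.
Qed.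

Lemma opn_le (T : bop) (C : R) : 0 <= C -> (forall x, hn (T x) <= C * hn x) -> opn T <= C.
Proof.
move=> C0 hC; apply: ge_sup; first exact: (proj1 (opn_has_sup T)).
move=> _ [x /= x1 <-]; apply: le_trans (hC x) _; have := hn_ge0 x; nra.
Qed.

Let mulA : associative bop_mul.
Proof. by move=> S T U; apply: bop_ext. Qed.
Let mul1 : left_id bop_one bop_mul.
Proof. by move=> T; apply: bop_ext. Qed.
Let mulr1' : right_id bop_one bop_mul.
Proof. by move=> T; apply: bop_ext. Qed.
Let mulDl : left_distributive bop_mul +%R.
Proof. by move=> S T U; apply: bop_ext. Qed.
Let mulDr : right_distributive bop_mul +%R.
Proof. by move=> S T U; apply: bop_ext => x; exact: bopD. Qed.
Let mscaleAl (c : R[i]) (S T : bop) : c *: bop_mul S T = bop_mul (c *: S) T.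
Proof. exact: bop_ext. Qed.
Let mscaleAr (c : R[i]) (S T : bop) : c *: bop_mul S T = bop_mul S (c *: T).
Proof. by apply: bop_ext => x; apply/esym; exact: bopZ. Qed.

Lemma bop_star_unique (T : bop) (S : bop) :
  (forall x y, ip (T x) y = ip x (S y)) -> bop_star T = S.
Proof. by move=> h; apply: bop_ext => y; apply: ip_ext => x; rewrite -h bop_starP. Qed.

Let mstarK : involutive bop_star.
Proof. by move=> T; apply: bop_star_unique => x y; rewrite bop_starP'. Qed.
Let mstarD (S T : bop) : bop_star (S + T) = bop_star S + bop_star T.
Proof. by apply: bop_star_unique => x y; rewrite !bopDE ipDl ipDr !bop_starP. Qed.
Let mstarB (S T : bop) : bop_star (S - T) = bop_star S - bop_star T.
Proof. by apply: bop_star_unique => x y; rewrite !bopBE ipBl ipBr !bop_starP. Qed.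
Let mstarZ (c : R[i]) (T : bop) : bop_star (c *: T) = Num.conj c *: bop_star T.
Proof. by apply: bop_star_unique => x y; rewrite !bopZE ipZl ipZr !bop_starP. Qed.
Let mstarM (S T : bop) : bop_star (bop_mul S T) = bop_mul (bop_star T) (bop_star S).
Proof. by apply: bop_star_unique => x y; rewrite -!bop_starP. Qed.

Let nD (S T : bop) : opn (S + T) <= opn S + opn T.
Proof.
apply: opn_le => [|x]; first by rewrite addr_ge0// opn_ge0.
by rewrite mulrDl; apply: le_trans (hnD _ _) _; rewrite lerD// opn_ub.
Qed.

Let nZ (c : R[i]) (T : bop) : opn (c *: T) = complex.Re `|c| * opn T.
Proof.
have c0 (a : R[i]) : 0 <= complex.Re `|a| by rewrite normc_def /= sqrtr_ge0.
have le (a : R[i]) (S : bop) : opn (a *: S) <= complex.Re `|a| * opn S.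
  apply: opn_le => [|x]; first by rewrite mulr_ge0// opn_ge0.
  by rewrite bopZE hnZ -mulrA ler_wpM2l// opn_ub.
apply/le_anti; rewrite le andTb; have [->|cn] := eqVneq c 0.
  have -> : complex.Re (`|0 : R[i]|) = 0 by rewrite normr0.
  by rewrite mul0r opn_ge0.
have := le c^-1 (c *: T); rewrite scalerA mulVf// scale1r.
have cc : complex.Re `|c| * complex.Re `|c^-1| = 1.
  have : `|c| * `|c^-1| = 1 by rewrite -normrM mulfV// normr1.
  rewrite !normc_def => /(congr1 (@complex.Re R)) /=.
  by rewrite mul0r subr0.
have := c0 c; have := c0 c^-1; move=> h1 h2 h3.
have := ler_wpM2l h2 h3; rewrite mulrA cc mul1r//.
Qed.

Let n0 (T : bop) : opn T = 0 -> T = 0.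
Proof.
move=> T0; apply: bop_ext => x; apply: hn_eq0; apply/le_anti.
by rewrite hn_ge0 andbT; have := opn_ub T x; rewrite T0 mul0r.
Qed.

Let nM (S T : bop) : opn (bop_mul S T) <= opn S * opn T.
Proof.
apply: opn_le => [|x]; first by rewrite mulr_ge0// opn_ge0.
rewrite -mulrA; apply: le_trans (opn_ub S (T x)) _.
by rewrite ler_wpM2l ?opn_ge0// opn_ub.
Qed.

Lemma opn_star (T : bop) : opn (bop_star T) <= opn T.
Proof.
apply: opn_le => [|x]; first exact: opn_ge0.
by apply: (adj_bound (adjfP T)) => y; exact: opn_ub.
Qed.

Let nS (T : bop) : opn (bop_mul (bop_star T) T) = opn T ^+ 2.
Proof.
apply/le_anti/andP; split.
  apply: le_trans (nM _ _) _; rewrite expr2 ler_wpM2r ?opn_ge0//; exact: opn_star.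
set M := opn (bop_mul _ _); have M0 : 0 <= M by exact: opn_ge0.
have : opn T <= Num.sqrt M.
  apply: opn_le; first exact: sqrtr_ge0.
  move=> x; apply: ler_sq; first by rewrite mulr_ge0 ?sqrtr_ge0 ?hn_ge0.
  rewrite exprMn (sqr_sqrtr M0) hn_sq bop_starP; apply: le_trans (ip_hn _ _) _.
  rewrite expr2 mulrA mulrC; apply: ler_wpM2r; first exact: hn_ge0.
  exact: (opn_ub (bop_mul (bop_star T) T)).
rewrite -[X in X <= _]ger0_norm ?opn_ge0// -[X in _ <= X]ger0_norm ?sqrtr_ge0//.
by rewrite -ler_sqr ?nnegrE// !real_normK ?num_real// sqr_sqrtr.
Qed.

(** Pointwise limits are taken both of the operators and of their adjoints; the second limit
    provides the adjoint of the first. *)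
Let ncomplete (u : nat -> bop) :
  (forall e : R, 0 < e -> exists N, forall m n, (N <= m)%N -> (N <= n)%N ->
     opn (u m - u n) < e) ->
  exists l, forall e : R, 0 < e -> exists N, forall n, (N <= n)%N -> opn (u n - l) < e.
Proof.
move=> uc.
have ptw (v : nat -> bop) : (forall e : R, 0 < e -> exists N, forall m n,
    (N <= m)%N -> (N <= n)%N -> opn (v m - v n) < e) ->
    forall x, exists y, forall e : R, 0 < e -> exists N, forall n, (N <= n)%N -> hn (v n x - y) < e.
  move=> vc x; apply: hm_complete => e e0.
  have x1 : 0 < hn x + 1 by have := hn_ge0 x; lra.
  have [N hN] := vc (e / (hn x + 1)) (divr_gt0 e0 x1); exists N => m n Nm Nn.
  have := hN m n Nm Nn; rewrite ltr_pdivlMr// => h; rewrite -bopBE.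
  apply: le_lt_trans (opn_ub _ _) _; apply: le_lt_trans h.
  by have := opn_ge0 (v m - v n); have := hn_ge0 x; nra.
have us : forall e : R, 0 < e -> exists N, forall m n,
    (N <= m)%N -> (N <= n)%N -> opn (bop_star (u m) - bop_star (u n)) < e.
  move=> e /uc[N hN]; exists N => m n Nm Nn.
  rewrite (_ : _ - _ = bop_star (u m - u n)); first exact: le_lt_trans (opn_star _) (hN _ _ Nm Nn).
  by rewrite mstarB.
pose l x := projT1 (cid (ptw _ uc x)); pose l' x := projT1 (cid (ptw _ us x)).
have lP x e : 0 < e -> exists N, forall n, (N <= n)%N -> hn (u n x - l x) < e.
  by rewrite /l; case: cid => /= y h; exact: h.
have lP' x e : 0 < e -> exists N, forall n, (N <= n)%N -> hn (bop_star (u n) x - l' x) < e.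
  by rewrite /l'; case: cid => /= y h; exact: h.
have ladj : is_adj l l'.
  move=> x y; apply/eqP; rewrite -subr_eq0; apply/eqP/nrm_eq0/le_anti.
  rewrite nrm_ge0 andbT; apply/ler_addgt0Pr => e e0; rewrite add0r.
  have C0 : 0 < hn x + hn y + 1 by have := hn_ge0 x; have := hn_ge0 y; lra.
  have d0 := divr_gt0 e0 C0.
  have [N hN] := lP x _ d0; have [M hM] := lP' y _ d0.
  have := hN _ (leq_maxl N M); have := hM _ (leq_maxr N M); set n := maxn N M.
  rewrite !ltr_pdivlMr// => h1 h2.
  have -> : ip (l x) y - ip x (l' y) = ip x (bop_star (u n) y - l' y) - ip (u n x - l x) y.
    by rewrite ipBr ipBl bop_starP; nc.
  have := nrmB (ip x (bop_star (u n) y - l' y)) (ip (u n x - l x) y).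
  have := ip_hn x (bop_star (u n) y - l' y); have := ip_hn (u n x - l x) y.
  have := hn_ge0 x; have := hn_ge0 y; have := hn_ge0 (u n x - l x).
  have := hn_ge0 (bop_star (u n) y - l' y); nra.
have key (e : R) : 0 < e -> exists N, forall n x, (N <= n)%N -> hn (u n x - l x) <= e * hn x.
  move=> /uc[N hN]; exists N => n x Nn; apply/ler_addgt0Pr => d d0.
  have [M hM] := lP x d d0.
  have := hM _ (leq_maxr N M); have := hN n _ Nn (leq_maxl N M); set m := maxn N M => h1 h2.
  have := hn_tri (u n x) (u m x) (l x); rewrite -bopBE.
  by have := opn_ub (u n - u m) x; have := hn_ge0 x; nra.
have lb : adjble l.
  exists l'; split=> //; have [N hN] := key 1 ltr01.
  exists (opn (u N) + 1) => x; have := hN N x (leqnn N); rewrite mul1r => h.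
  have := hn_tri (l x) (u N x) 0; rewrite !subr0 (hnBC (l x)).
  by have := opn_ub (u N) x; rewrite mulrDl mul1r; lra.
exists (mkbop lb) => e e0; have [|N hN] := key (e / 2); first by lra.
exists N => n Nn; apply: (@le_lt_trans _ _ (e / 2)); last by lra.
apply: opn_le => [|x]; first by lra.
by rewrite bopBE; exact: hN.
Qed.

Definition bop_data : cstar_data R := @CstarData R bop bop_mul bop_one bop_star opn
  mulA mul1 mulr1' mulDl mulDr mscaleAl mscaleAr mstarK mstarD mstarZ mstarM
  nD nZ n0 nM nS ncomplete.

(* The adjointable operators on [hm I A]; for a finite [I], the matrices over [A]. *)
Definition bopc : cstarType R := cstar_of_data bop_data.

Definition ev (T : bopc) : H -> H := bopf (T : bop).

Lemma bopc_ext (S T : bopc) : (forall x, ev S x = ev T x) -> S = T.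
Proof. exact: bop_ext. Qed.

Lemma evM (S T : bopc) x : ev (S * T) x = ev S (ev T x). Proof. by []. Qed.
Lemma ev1 x : ev 1 x = x. Proof. by []. Qed.
Lemma evD (S T : bopc) x : ev (S + T) x = ev S x + ev T x. Proof. by []. Qed.
Lemma evZ (c : R[i]) (T : bopc) x : ev (c *: T) x = c *: ev T x. Proof. by []. Qed.
Lemma evB (S T : bopc) x : ev (S - T) x = ev S x - ev T x.
Proof. exact: bopBE. Qed.
Lemma evN (T : bopc) x : ev (- T) x = - ev T x.
Proof. exact: bopNE. Qed.
Lemma ev_star (T : bopc) x y : ip (ev T x) y = ip x (ev (star T) y).
Proof. exact: bop_starP. Qed.
Lemma ev_hn (T : bopc) x : hn (ev T x) <= nrm T * hn x.
Proof. exact: opn_ub. Qed.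
Lemma ev_nrm_le (T : bopc) (C : R) : 0 <= C -> (forall x, hn (ev T x) <= C * hn x) -> nrm T <= C.
Proof. exact: opn_le. Qed.
Lemma evxD (T : bopc) x y : ev T (x + y) = ev T x + ev T y. Proof. exact: bopD. Qed.
Lemma evxMr (T : bopc) x b : ev T (hm_mulr x b) = hm_mulr (ev T x) b.
Proof. exact: bopMr. Qed.
Lemma evx_sum (T : bopc) (J : Type) (s : seq J) (F : J -> H) :
  ev T (\sum_(j <- s) F j) = \sum_(j <- s) ev T (F j).
Proof. exact: bop_sum. Qed.

Definition mkop T (h : adjble T) : bopc := mkbop h.

(* With [n] the negative part of [T], [<n x, T n x> = - <x, n^3 x>]. *)
Lemma Pcone_opP (T : bopc) : star T = T -> (forall x, Pcone (ip x (ev T x))) -> Pcone T.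
Proof.
move=> TS TP; have [p [n [Pp Pn TE [pn np] _]]] := pos_neg_parts TS.
have nS' := Pcone_sa Pn.
have n3P : Pcone (n * n * n).
  by apply: PconeM; [exact/PconeS|exact: Pn|rewrite mulrA].
have [s [sS ss _]] := Pcone_sqrt_raw n3P.
have s0 : s = 0.
  apply: bopc_ext => x; apply: hn_eq0; apply/eqP; rewrite -sqrf_eq0 hn_sq.
  have E : ip (ev s x) (ev s x) = ip x (ev (n * n * n) x) by rewrite ev_star sS -evM ss.
  have E2 : ip x (ev (n * n * n) x) = - ip (ev n x) (ev T (ev n x)).
    have En : n * (T * n) = - (n * n * n) by rewrite TE mulrBl pn sub0r mulrN mulrA.
    by rewrite ev_star nS' -(evM T n) -(evM n) En evN ipNr opprK.
  have : ip (ev s x) (ev s x) = 0.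
    by apply: Pcone_anti; [exact: ip_ge0|rewrite E E2 opprK].
  by move=> ->; rewrite nrm0.
have n0' : n = 0.
  have n4 : (n * n) * (n * n) = 0 by rewrite mulrA -ss s0 !mul0r.
  have : nrm ((n * n) * (n * n)) = 0 by rewrite n4 nrm0.
  rewrite !nrm_sa ?starM ?nS'// => /eqP; rewrite !sqrf_eq0 => /eqP; exact: nrm_eq0.
by rewrite TE n0' subr0.
Qed.

End Adjointable.

Section OpMore.
Variables (R : realType) (I : choiceType) (A : cstarType R).

(** Polarization with [x + y] and [x + i y]. Applied to [T - T^*] it shows in [Pcone_op] that an
    operator with a positive form is self-adjoint. *)
Lemma op_polar (S : bopc I A) : (forall x, ip x (ev S x) = 0) ->
  forall x y, ip x (ev S y) = 0.
Proof.
move=> S0 x y.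
have h1 : ip x (ev S y) + ip y (ev S x) = 0.
  have := S0 (x + y); rewrite evxD ipDl (ipDr x) (ipDr y) (S0 x) (S0 y).
  by rewrite add0r addr0.
have h2 : ip x (ev S y) - ip y (ev S x) = 0.
  have := S0 (x + imi *: y).
  have evxZ c z : ev S (c *: z) = c *: ev S z by exact: bopZ.
  rewrite evxD evxZ ipDl (ipDr x) (ipDr (imi *: y)) (S0 x) ipZr ipZl ipZl ipZr (S0 y).
  rewrite !scaler0 add0r addr0 conj_imi => E.
  have := congr1 (fun a => - imi *: a) E; rewrite scaler0 scalerDr !scalerA.
  by rewrite mulNr mul_imi opprK mulrNN mul_imi scale1r scaleN1r.
have : 2 *^ ip x (ev S y) = 0.
  have -> : 2 *^ ip x (ev S y) = (ip x (ev S y) + ip y (ev S x)) + (ip x (ev S y) - ip y (ev S x)) by nc.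
  by rewrite h1 h2 addr0.
move=> /(congr1 (fun a => (2^-1) *^ a)); rewrite scaler0 scalerA -rmorphM/= mulVf//.
by rewrite scale1r.
Qed.

Lemma Pcone_op (T : bopc I A) : (forall x, Pcone (ip x (ev T x))) -> Pcone T.
Proof.
move=> TP; apply: Pcone_opP => //; apply/esym/eqP; rewrite -subr_eq0; apply/eqP.
apply: bopc_ext => y; apply: ip_ext => x; rewrite op_polar ?ip0r// => {}x.
by rewrite evB ipBr -ev_star -[ip (ev T x) x]ip_star (Pcone_sa (TP x)) subrr.
Qed.

Lemma hdelta_mulr (i : I) (b : A) : hdelta i b = hm_mulr (hdelta i 1) b.
Proof. by apply: hm_ext => j; rewrite hm_mulrE !hdeltaE; case: eqP; rewrite ?mul1r ?mul0r. Qed.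

Lemma hn_delta (i : I) (b : A) : hn (hdelta i b) = nrm b.
Proof.
have : hn (hdelta i b) ^+ 2 = nrm b ^+ 2 by rewrite hn_sq ip_delta hdeltaE eqxx nrm_starM.
by move=> /eqP; rewrite eqrXn2 ?hn_ge0 ?nrm_ge0// => /eqP.
Qed.

Definition ent (T : bopc I A) (i j : I) : A := ev T (hdelta j 1) i.

Lemma entE (T : bopc I A) (i j : I) : ent T i j = ip (hdelta i 1) (ev T (hdelta j 1)).
Proof. by rewrite ip_delta star1 mul1r. Qed.

Lemma ent_nrm (T : bopc I A) (i j : I) : nrm (ent T i j) <= nrm T.
Proof.
apply: le_trans (entry_hn _ _) _; apply: le_trans (ev_hn _ _) _.
by rewrite hn_delta; have := nrm1_le A; have := nrm_ge0 T; nra.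
Qed.

Lemma entD (S T : bopc I A) i j : ent (S + T) i j = ent S i j + ent T i j.
Proof. by rewrite /ent evD hmDE. Qed.

Lemma entZ (c : R[i]) (T : bopc I A) i j : ent (c *: T) i j = c *: ent T i j.
Proof. by rewrite /ent evZ hmZE. Qed.

Lemma ent_star (T : bopc I A) i j : ent (star T) i j = star (ent T j i).
Proof. by rewrite !entE ip_star ev_star. Qed.

End OpMore.

(** * Matrices over a C*-algebra as operators on a finite Hilbert module *)

Section FinMatrix.
Variables (R : realType) (J : finType) (A : cstarType R).
Implicit Types (m : J -> J -> A).

Lemma l2_fin (v : J -> A) : l2 v.
Proof.
move=> e e0; exists (enum J) => S _ /allP h; rewrite /ips big_seq big1 ?nrm0 ?ltW// => i /h.
by rewrite mem_enum.
Qed.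

Definition hfin (v : J -> A) : hm J A := mkhm (l2_fin v).

Lemma hfinE (v : J -> A) j : hfin v j = v j. Proof. by []. Qed.

Lemma ip_fin (x y : hm J A) : ip x y = \sum_j star (x j) * y j.
Proof.
apply: ip_unique => e e0; exists (enum J) => S uS JS.
rewrite (_ : ips S x y = \sum_j star (x j) * y j) ?subrr ?nrm0 ?ltW//.
rewrite /ips -[in RHS]big_enum; apply: perm_big; apply: uniq_perm => //.
  exact: enum_uniq.
by move=> i; rewrite mem_enum JS ?mem_enum.
Qed.

Lemma hfin_sum (x : hm J A) : x = \sum_j hdelta j (x j).
Proof.
apply: hm_ext => i; rewrite hm_sumE (bigD1 i)// big1.
  by rewrite /= addr0 eqxx.
by move=> j ji; rewrite hdeltaE eq_sym (negbTE ji).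
Qed.

Lemma hn_fin (x : hm J A) : hn x <= \sum_j nrm (x j).
Proof.
rewrite {1}(hfin_sum x); elim/big_rec2: _ => [|j r y _ h]; first by rewrite hn0.
by apply: le_trans (hnD _ _) _; rewrite hn_delta lerD2l.
Qed.

Definition mxfun m (v : hm J A) : hm J A := hfin (fun i => \sum_j m i j * v j).

Lemma mxfun_bound m v : hn (mxfun m v) <= (\sum_i \sum_j nrm (m i j)) * hn v.
Proof.
apply: le_trans (hn_fin _) _; rewrite mulr_suml; apply: ler_sum => i _.
rewrite hfinE mulr_suml; apply: le_trans (nrm_sum _ _ _) _; apply: ler_sum => j _.
by apply: nrmM_le => //; exact: entry_hn.
Qed.

Lemma mxfun_adj m : is_adj (mxfun m) (mxfun (fun i j => star (m j i))).
Proof.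
move=> x y; rewrite !ip_fin.
under eq_bigr do rewrite hfinE star_sum mulr_suml.
under [RHS]eq_bigr do rewrite hfinE mulr_sumr.
rewrite exchange_big; apply: eq_bigr => i _; apply: eq_bigr => j _.
by rewrite starM mulrA.
Qed.

Lemma adjble_mx m : adjble (mxfun m).
Proof.
by exists (mxfun (fun i j => star (m j i))); split; [exact: mxfun_adj|eexists; exact: mxfun_bound].
Qed.

Definition mxop m : bopc J A := mkop (adjble_mx m).

Lemma ev_mxop m v i : ev (mxop m) v i = \sum_j m i j * v j.
Proof. by []. Qed.

Lemma nrm_mxop m : nrm (mxop m) <= \sum_i \sum_j nrm (m i j).
Proof.
apply: ev_nrm_le => [|v]; last exact: mxfun_bound.
by do 2?[apply: sumr_ge0 => ? _]; exact: nrm_ge0.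
Qed.

Lemma ent_mxop m i j : ent (mxop m) i j = m i j.
Proof.
rewrite /ent ev_mxop (bigD1 j)// big1 /= ?addr0; first by rewrite eqxx mulr1.
by move=> k kj; rewrite (negbTE kj) mulr0.
Qed.

Lemma ev_ent (T : bopc J A) v i : ev T v i = \sum_j ent T i j * v j.
Proof.
rewrite {1}(hfin_sum v) evx_sum hm_sumE; apply: eq_bigr => j _.
by rewrite hdelta_mulr evxMr hm_mulrE.
Qed.

Lemma ent_ext (S T : bopc J A) : (forall i j, ent S i j = ent T i j) -> S = T.
Proof.
move=> h; apply: bopc_ext => v; apply: hm_ext => i; rewrite !ev_ent.
by apply: eq_bigr => j _; rewrite h.
Qed.

Lemma mxop_ent (T : bopc J A) : T = mxop (ent T).
Proof. by apply: ent_ext => i j; rewrite ent_mxop. Qed.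

Lemma entM (S T : bopc J A) i j : ent (S * T) i j = \sum_k ent S i k * ent T k j.
Proof. by rewrite /ent evM ev_ent. Qed.

Lemma ent1 i j : ent (1 : bopc J A) i j = if i == j then 1 else 0.
Proof. by rewrite /ent ev1 hdeltaE. Qed.

Lemma Pcone_mx (T : bopc J A) :
  (forall c : J -> A, Pcone (\sum_i \sum_j star (c i) * ent T i j * c j)) -> Pcone T.
Proof.
move=> h; apply: Pcone_op => x; rewrite ip_fin.
rewrite (_ : \sum_j _ = \sum_i \sum_j star (x i) * ent T i j * x j); first exact: h.
by apply: eq_bigr => i _; rewrite ev_ent mulr_sumr; apply: eq_bigr => j _; rewrite mulrA.
Qed.

Lemma nrm_mx_le (T : bopc J A) : nrm T <= \sum_i \sum_j nrm (ent T i j).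
Proof. by rewrite {1}(mxop_ent T) nrm_mxop. Qed.

End FinMatrix.

(** * Completely positive maps *)

Section CP.
Variables (R : realType).
Implicit Types A B : cstarType R.

(** Conversely, [x] acts on a finite Hilbert module over [A], with a positive form, and the matrix
    of its square root is the required [y]. The module makes matrices over [A] a C*-algebra without
    representing [A]. *)
Lemma mxpositiveP A n (x : 'M[A]_n) :
  mxpositive x <-> forall c : 'I_n -> A, Pcone (\sum_i \sum_j star (c i) * x i j * c j).
Proof.
split=> [[y ->] c|h].
  rewrite (_ : \sum_i _ = \sum_k star (\sum_j y k j * c j) * (\sum_j y k j * c j)).
    by apply: Pcone_sum => k _; exact: Pcone_star_mul.
  under [RHS]eq_bigr do rewrite star_sum mulr_suml.
  rewrite [RHS]exchange_big; apply: eq_bigr => i _.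
  under [RHS]eq_bigr do rewrite mulr_sumr.
  rewrite [RHS]exchange_big; apply: eq_bigr => j _.
  rewrite mxE mulr_sumr mulr_suml; apply: eq_bigr => k _.
  by rewrite !mxE starM !mulrA.
have PT : Pcone (mxop x).
  apply: Pcone_mx => c; rewrite (_ : \sum_i _ = \sum_i \sum_j star (c i) * x i j * c j) //.
  by apply: eq_bigr => i _; apply: eq_bigr => j _; rewrite ent_mxop.
have [s [sS ss _]] := Pcone_sqrt_raw PT.
exists (\matrix_(i, j) ent s i j); apply/matrixP => i j; rewrite -[LHS]ent_mxop -ss entM !mxE.
by apply: eq_bigr => k _; rewrite !mxE -{1}sS ent_star.
Qed.

(** Complete positivity as a positive kernel. The index is any finite type, so that pairs can be
    used, as in [compress_cpf]. *)
Definition cpf A B (f : A -> B) := forall (J : finType) (a : J -> A) (b : J -> B),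
  Pcone (\sum_i \sum_j star (b i) * f (star (a i) * a j) * b j).

Lemma linfD A B (f : A -> B) x y : linear f -> f (x + y) = f x + f y.
Proof. by move=> h; have := h 1 x y; rewrite !scale1r. Qed.

Lemma linf0 A B (f : A -> B) : linear f -> f 0 = 0.
Proof. by move=> h; apply: (addrI (f 0)); rewrite -linfD// !addr0. Qed.

Lemma linfZ A B (f : A -> B) (c : R[i]) x : linear f -> f (c *: x) = c *: f x.
Proof. by move=> h; have := h c x 0; rewrite !addr0 linf0// addr0. Qed.

Lemma linfN A B (f : A -> B) x : linear f -> f (- x) = - f x.
Proof. by move=> h; rewrite -scaleN1r linfZ// scaleN1r. Qed.

Lemma linfB A B (f : A -> B) x y : linear f -> f (x - y) = f x - f y.
Proof. by move=> h; rewrite linfD// linfN. Qed.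

Lemma linf_sum A B (f : A -> B) (K : Type) (s : seq K) (P : pred K) (F : K -> A) : linear f ->
  f (\sum_(k <- s | P k) F k) = \sum_(k <- s | P k) f (F k).
Proof.
by move=> h; apply: (big_morph _ (fun x y => linfD x y h)); exact: linf0.
Qed.

Lemma sum_enum A (K : finType) (F : K -> A) : \sum_k F k = \sum_(i < #|K|) F (enum_val i).
Proof. by rewrite (reindex _ (onW_bij _ (@enum_val_bij K))). Qed.

(** The matrix [a_i^* a_j] is positive, and conversely [y^* y] is a sum of such matrices, one for
    each row of [y]. *)
Lemma cpP A B (f : A -> B) : completely_positive f <-> linear f /\ cpf f.
Proof.
split=> [[fl fp]|[fl fp]]; split=> //.
  move=> J a b.
  pose x : 'M[A]_#|J| := \matrix_(i, j) (star (a (enum_val i)) * a (enum_val j)).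
  have /fp/mxpositiveP/(_ (fun i => b (enum_val i))) : mxpositive x.
    apply/mxpositiveP => c.
    rewrite (_ : \sum_i _ = star (\sum_j a (enum_val j) * c j) * (\sum_j a (enum_val j) * c j)).
      exact: Pcone_star_mul.
    rewrite star_sum mulr_suml; apply: eq_bigr => i _; rewrite mulr_sumr.
    by apply: eq_bigr => j _; rewrite mxE starM !mulrA.
  move=> h; rewrite sum_enum; under eq_bigr do rewrite sum_enum.
  set F := (F in Pcone F); rewrite (_ : F = \sum_i \sum_j star (b (enum_val i)) * map_mx f x i j * b (enum_val j)) //.
  by apply: eq_bigr => i _; apply: eq_bigr => j _; rewrite !mxE.
move=> n _ [y ->]; apply/mxpositiveP => c.
rewrite (_ : \sum_i _ = \sum_k \sum_i \sum_j star (c i) * f (star (y k i) * y k j) * c j).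
  by apply: Pcone_sum => k _; exact: fp.
rewrite [RHS]exchange_big; apply: eq_bigr => i _.
rewrite [RHS]exchange_big; apply: eq_bigr => j _.
rewrite !mxE linf_sum// mulr_sumr mulr_suml; apply: eq_bigr => k _.
by rewrite !mxE.
Qed.

Lemma cpf_pos A B (f : A -> B) a : cpf f -> Pcone a -> Pcone (f a).
Proof.
move=> fp /Pcone_sqrt_raw[s [sS ss _]].
have := fp 'I_1 (fun=> s) (fun=> 1).
by rewrite !big_ord1 star1 mul1r mulr1 sS ss.
Qed.

Lemma cpf_sa A B (f : A -> B) a : linear f -> cpf f -> star a = a -> star (f a) = f a.
Proof.
move=> fl fp aS.
have -> : a = sca (nrm a) - (sca (nrm a) - a) by nc.
have P1 : Pcone (f (sca (nrm a))) by apply: cpf_pos => //; exact/Pcone_cst/nrm_ge0.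
have P2 : Pcone (f (sca (nrm a) - a)) by apply: cpf_pos => //; exact: Pcone_sub_nrm.
by rewrite linfB// starB (Pcone_sa P1) (Pcone_sa P2).
Qed.

Lemma re_im A (a : A) : exists x y : A, [/\ star x = x, star y = y & a = x + imi *: y].
Proof.
exists ((2^-1) *^ (a + star a)), ((2^-1) *^ (imi *: (star a - a))); split.
- by rewrite starZr starD starK addrC.
- by rewrite starZr starZ conj_imi starB starK; nc.
- have -> : imi *: ((2^-1) *^ (imi *: (star a - a))) = (imi * imi) *: ((2^-1) *^ (star a - a)) by nc.
  by rewrite mul_imi; nc.
Qed.

Lemma cpf_star A B (f : A -> B) a : linear f -> cpf f -> f (star a) = star (f a).
Proof.
move=> fl fp; have [x [y [xS yS ->]]] := re_im a.
rewrite starD starZ xS yS !(linfD _ _ fl) !(linfZ _ _ fl) starD starZ.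
by rewrite !(cpf_sa fl fp).
Qed.


Lemma Pcone1 A : Pcone (1 : A).
Proof. by have := @Pcone_cst R A 1 ler01; rewrite scale1r. Qed.

(** The kernel at the two points [1] and [a], with coefficients [- b] and [1], is the form required
    by [Pcone_CS]. *)
Lemma cpf_CS A B (f : A -> B) a : linear f -> cpf f ->
  nrm (f a) ^+ 2 <= nrm (f 1) * nrm (f (star a * a)).
Proof.
move=> fl fp; apply: Pcone_CS; first exact/cpf_pos/Pcone1.
move=> b; have := fp 'I_2 (fun i => if i == ord0 then 1 else a) (fun i => if i == ord0 then - b else 1).
rewrite !big_ord_recl !big_ord0 /= !star1 !mul1r !mulr1 starN !(cpf_star _ fl fp) !addr0.
by congr Pcone; nc.
Qed.

Lemma cp_le_sq A B (f : A -> B) a : linear f -> cpf f -> nrm (f 1) <= 1 ->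
  nrm (f (star a * a)) <= nrm a ^+ 2.
Proof.
move=> fl fp f1.
have P1 : Pcone (f (star a * a)) by apply: cpf_pos => //; exact: Pcone_star_mul.
have P2 : Pcone ((nrm a ^+ 2) *^ f 1 - f (star a * a)).
  rewrite -linfZ// -linfB//; apply: cpf_pos => //; apply: Pcone_sub_nrm.
    by rewrite starM starK.
  by rewrite nrm_starM.
apply: le_trans (Pcone_lenrm P1 P2) _; rewrite nrmZr ger0_norm ?sqr_ge0//.
by have := sqr_ge0 (nrm a); nra.
Qed.

Lemma cp_contractive A B (f : A -> B) : linear f -> cpf f -> nrm (f 1) <= 1 ->
  forall a, nrm (f a) <= nrm a.
Proof.
move=> fl fp f1 a; apply: ler_sq; first exact: nrm_ge0.
apply: le_trans (cpf_CS a fl fp) _; rewrite -[_ ^+ 2]mul1r.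
by apply: ler_pM => //; rewrite ?nrm_ge0//; exact: cp_le_sq.
Qed.

Lemma contractiveP A B (f : A -> B) : contractive f <-> forall a, nrm (f a) <= nrm a.
Proof. by split=> h a; have := h a; rewrite !nrmE lecR. Qed.

Lemma cpcI A B (f : A -> B) : linear f -> cpf f -> nrm (f 1) <= 1 -> cpc f.
Proof.
by move=> fl fp f1; split; [exact/cpP|exact/contractiveP/cp_contractive].
Qed.

(** The unit is left out on purpose: the amplified representation [ampl] maps 1 to a proper
    projection. *)
Lemma mult_star_cpf A B (f : A -> B) :
  (forall x y, f (x * y) = f x * f y) -> (forall x, f (star x) = star (f x)) -> cpf f.
Proof.
move=> fM fS J a b.
rewrite (_ : \sum_i _ = star (\sum_j f (a j) * b j) * (\sum_j f (a j) * b j)).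
  exact: Pcone_star_mul.
rewrite star_sum mulr_suml; apply: eq_bigr => i _; rewrite mulr_sumr.
by apply: eq_bigr => j _; rewrite fM fS starM !mulrA.
Qed.

Lemma star_hom_cpf A B (f : A -> B) : star_hom f -> cpf f.
Proof. by move=> [_ [_ fM] fS]; exact: mult_star_cpf. Qed.

Lemma star_hom_nrm A B (f : A -> B) a : star_hom f -> nrm (f a) <= nrm a.
Proof.
move=> fh; have fp := star_hom_cpf fh; have [fl [f1 _] _] := fh.
by apply: cp_contractive => //; rewrite f1 nrm1_le.
Qed.

End CP.

(** * The crossed product *)

Section DiagShift.
Variables (R : realType) (I : choiceType) (A : cstarType R).
Implicit Types (x y : hm I A).

Lemma ips_le_ip x (S : seq I) : uniq S -> nrm (ips S x x) <= nrm (ip x x).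
Proof.
move=> uS; apply/ler_addgt0Pr => d d0; have [T hT] := @ipP _ _ _ x x d d0.
have uST : uniq (undup (S ++ T)) by exact: undup_uniq.
have h : nrm (ips (undup (S ++ T)) x x - ip x x) <= d.
  by apply: hT => // j jT; rewrite mem_undup mem_cat jT orbT.
have : nrm (ips S x x) <= nrm (ips (undup (S ++ T)) x x).
  apply: Pcone_lenrm; first exact: ips_ge0.
  rewrite {1}/ips (sum_filter _ uST uS); last first.
    by move=> j jS; rewrite mem_undup mem_cat jS.
  rewrite addrAC subrr add0r; exact: ips_ge0.
by have := nrm_tri (ips (undup (S ++ T)) x x) (ip x x) 0; rewrite !subr0; lra.
Qed.

Lemma ips_diag (c : I -> A) (C : R) (x : I -> A) (S : seq I) : (forall i, nrm (c i) <= C) ->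
  nrm (ips S (fun i => c i * x i) (fun i => c i * x i)) <= C ^+ 2 * nrm (ips S x x).
Proof.
move=> cC.
have -> : C ^+ 2 * nrm (ips S x x) = nrm ((C ^+ 2) *^ ips S x x).
  by rewrite nrmZr ger0_norm ?sqr_ge0.
apply: Pcone_lenrm; first exact: ips_ge0.
rewrite /ips scaler_sumr -sumrB; apply: Pcone_sum => i _.
have -> : (C ^+ 2) *^ (star (x i) * x i) - star (c i * x i) * (c i * x i) =
  star (x i) * (sca (C ^+ 2) - star (c i) * c i) * x i by rewrite starM; nc.
apply/Pcone_conj/Pcone_sub_nrm; first by rewrite starM starK.
by rewrite nrm_starM; have := cC i; have := nrm_ge0 (c i); nra.
Qed.

Lemma l2_diag (c : I -> A) (C : R) (x : I -> A) : (forall i, nrm (c i) <= C) ->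
  l2 x -> l2 (fun i => c i * x i).
Proof. by move=> cC; apply: (@l2_dom _ _ _ _ _ (C ^+ 2)) => S; exact: ips_diag. Qed.

Lemma adjble_diag (c : I -> A) (C : R) (cC : forall i, nrm (c i) <= C) :
  adjble (fun x => mkhm (l2_diag cC (hmP x))).
Proof.
have cC' i : nrm (star (c i)) <= C by rewrite nrm_star.
exists (fun x => mkhm (l2_diag cC' (hmP x))); split=> [x y|].
  apply: ip_unique.
  have := @ipP _ _ _ x (mkhm (l2_diag cC' (hmP y))).
  congr netlim; apply/funext => S; apply: eq_bigr => i _.
  by rewrite /= starM mulrA.
exists `|C| => x; apply: ler_sq; first by rewrite mulr_ge0// hn_ge0.
rewrite exprMn !hn_sq real_normK ?num_real//; apply: (netlim_le (@ipP _ _ _ _ _)) => S uS.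
apply: le_trans (ips_diag _ _ cC) _; rewrite ler_wpM2l ?sqr_ge0//.
exact: ips_le_ip.
Qed.

Definition diagop (c : I -> A) (C : R) (cC : forall i, nrm (c i) <= C) : bopc I A :=
  mkop (adjble_diag cC).

Lemma ev_diagop (c : I -> A) (C : R) (cC : forall i, nrm (c i) <= C) x i :
  ev (diagop cC) x i = c i * x i.
Proof. by []. Qed.

Lemma star_eq (S T : bopc I A) : (forall x y, ip (ev S x) y = ip x (ev T y)) -> star S = T.
Proof. by move=> h; apply: bopc_ext => y; apply: ip_ext => x; rewrite -ev_star h. Qed.

Lemma star_diagop (c d : I -> A) (C D : R) (cC : forall i, nrm (c i) <= C)
  (dD : forall i, nrm (d i) <= D) : (forall i, d i = star (c i)) ->
  star (diagop cC) = diagop dD.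
Proof.
move=> dc; apply: star_eq => x y; apply: ip_unique.
have := @ipP _ _ _ x (ev (diagop dD) y).
congr netlim; apply/funext => S; apply: eq_bigr => i _.
by rewrite !ev_diagop dc starM mulrA.
Qed.

Variables (s t : I -> I) (st : cancel s t) (ts : cancel t s).

Lemma ips_shift (x y : I -> A) (S : seq I) :
  ips S (fun i => x (t i)) y = ips (map t S) x (fun i => y (s i)).
Proof. by rewrite /ips big_map; apply: eq_bigr => i _; rewrite ts. Qed.

Lemma ips_shift2 (x : I -> A) (S : seq I) :
  ips S (fun i => x (t i)) (fun i => x (t i)) = ips (map t S) x x.
Proof. by rewrite ips_shift; apply: eq_bigr => i _; rewrite st. Qed.

Lemma l2_shift (x : I -> A) : l2 x -> l2 (fun i => x (t i)).
Proof.
move=> xl e /xl[T hT]; exists (map s T) => S uS /allP ST.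
rewrite ips_shift2; apply: hT; first by rewrite map_inj_uniq//; exact: can_inj ts.
apply/allP => _ /mapP[i iS ->]; apply: contra (ST i iS) => tT.
by apply/mapP; exists (t i) => //; rewrite ts.
Qed.

Definition shiftf x : hm I A := mkhm (l2_shift (hmP x)).

Lemma ip_shift x (y z : hm I A) : (forall i, z i = y (s i)) -> ip (shiftf x) y = ip x z.
Proof.
move=> zy; apply: ip_unique => e e0; have [T hT] := @ipP _ _ _ x z e e0.
exists (map s T) => S uS TS.
have -> : ips S (shiftf x) y = ips (map t S) x z.
  by rewrite [LHS]ips_shift; apply: eq_bigr => i _; rewrite zy.
apply: hT; first by rewrite map_inj_uniq//; exact: can_inj ts.
move=> i iT; apply/mapP; exists (s i); last by rewrite st.
by apply: TS; apply: map_f.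
Qed.

End DiagShift.

Section Shift.
Variables (R : realType) (I : choiceType) (A : cstarType R).
Variables (s t : I -> I) (st : cancel s t) (ts : cancel t s).

Lemma adjble_shift : adjble (@shiftf R I A s t st ts).
Proof.
exists (@shiftf R I A t s ts st); split=> [x y|]; first exact: ip_shift.
exists 1 => x; rewrite mul1r; apply: ler_sq; first exact: hn_ge0.
rewrite !hn_sq (@ip_shift _ _ _ _ _ _ _ x _ x)// => i.
by rewrite /= st.
Qed.

Definition shiftop : bopc I A := mkop adjble_shift.

End Shift.

Section Regular.
Variables (R : realType) (A : cstarType R) (alpha beta : A -> A).
Hypotheses (alphaH : star_hom alpha) (ab : cancel alpha beta) (ba : cancel beta alpha).

Lemma star_hom_inv : star_hom beta.
Proof.
have [al [a1 aM] aS] := alphaH; have inj := can_inj ab.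
split.
- by move=> c x y; apply: inj; rewrite al !ba.
- by split=> [|x y]; apply: inj; rewrite ?aM !ba.
- by move=> x; apply: inj; rewrite aS !ba.
Qed.

Lemma star_hom_id : star_hom (id : A -> A).
Proof. by split. Qed.

Lemma star_hom_iter (f : A -> A) n : star_hom f -> star_hom (iter n f).
Proof.
move=> fH; have [fl [f1 fM] fS] := fH; elim: n => [|n [IHl [IH1 IHM] IHS]]; first exact: star_hom_id.
split=> /=.
- by move=> c x y; rewrite !iterS IHl fl.
- by split=> [|x y]; rewrite !iterS ?IH1 ?IHM ?f1 ?fM.
- by move=> a; rewrite IHS fS.
Qed.

(* [powz k] is [beta^k]; the regular representation lets [a] act by [powz k a] in
   degree [k] and [u] by the shift. *)
Definition powz (k : int) : A -> A :=
  match k with Posz n => iter n beta | Negz n => iter n.+1 alpha end.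

Lemma powz_hom k : star_hom (powz k).
Proof. by case: k => n; apply: star_hom_iter => //; exact: star_hom_inv. Qed.

Lemma powz_alpha k a : powz (k - 1) a = powz k (alpha a).
Proof.
case: k => n.
  case: n => [|n]; first by [].
  have -> : Posz n.+1 - 1 = Posz n by rewrite -addn1 PoszD addrK.
  by rewrite /powz iterSr ab.
rewrite (_ : Negz n - 1 = Negz n.+1); last by rewrite !NegzE -[n.+2]addn1 PoszD opprD.
by rewrite /powz -iterSr.
Qed.

Lemma powz_nrm a k : nrm (powz k a) <= nrm a.
Proof. exact/star_hom_nrm/powz_hom. Qed.

Definition reg_pi (a : A) : bopc int A := diagop (powz_nrm a).

Lemma addK1 : cancel (fun k : int => k + 1) (fun k => k - 1). Proof. by move=> k; rewrite addrK. Qed.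
Lemma subK1 : cancel (fun k : int => k - 1) (fun k => k + 1). Proof. by move=> k; rewrite subrK. Qed.

Definition reg_u : bopc int A := shiftop A addK1 subK1.

Lemma ev_pi a x k : ev (reg_pi a) x k = powz k a * x k. Proof. by []. Qed.
Lemma ev_u x k : ev reg_u x k = x (k - 1). Proof. by []. Qed.

Lemma star_u : star reg_u = shiftop A subK1 addK1.
Proof. by apply: star_eq => x y; exact: ip_shift. Qed.

Lemma ev_us x k : ev (star reg_u) x k = x (k + 1). Proof. by rewrite star_u. Qed.

(** Conjugation by the shift turns [powz k] into [powz (k - 1)], and [beta^(k - 1) = beta^k alpha];
    this is why degree [k] carries [beta^k]. *)
Lemma reg_covariant : covariant alpha reg_pi reg_u.
Proof.
split.
- split.
  + move=> c a b; apply: bopc_ext => x; apply: hm_ext => k.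
    have [l _ _] := powz_hom k.
    by rewrite evD evZ hmDE hmZE !ev_pi l mulrDl scAl.
  + split.
      apply: bopc_ext => x; apply: hm_ext => k; rewrite ev_pi ev1.
      by have [_ [-> _] _] := powz_hom k; rewrite mul1r.
    move=> a b; apply: bopc_ext => x; apply: hm_ext => k; rewrite evM !ev_pi.
    by have [_ [_ ->] _] := powz_hom k; rewrite mulrA.
  + move=> a; apply/esym/star_diagop => k.
    by have [_ _ ->] := powz_hom k.
- by apply: bopc_ext => x; apply: hm_ext => k; rewrite evM ev_us ev_u addrK ev1.
- by apply: bopc_ext => x; apply: hm_ext => k; rewrite evM ev_u ev_us subrK ev1.
- move=> a; apply: bopc_ext => x; apply: hm_ext => k.
  by rewrite ev_pi !evM ev_u ev_pi ev_us subrK powz_alpha.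
Qed.

Lemma ev_u_delta n b : ev (reg_u ^+ n) (hdelta 0 b) = hdelta (Posz n) b.
Proof.
elim: n => [|n IH]; first by rewrite expr0 ev1.
rewrite exprS evM IH; apply: hm_ext => k; rewrite ev_u !hdeltaE.
by rewrite subr_eq -PoszD addn1.
Qed.

Lemma ev_pi_delta a n b : ev (reg_pi a) (hdelta (Posz n) b) = hdelta (Posz n) (iter n beta a * b).
Proof.
apply: hm_ext => k; rewrite ev_pi !hdeltaE; case: eqP => [->//|_].
by rewrite mulr0.
Qed.

End Regular.

Section Expectation.
Variables (R : realType).

Lemma entry_cpf (B A : cstarType R) (I : choiceType) (rho : B -> bopc I A) (i : I) :
  star_hom rho -> linear (fun b => ent (rho b) i i) /\ cpf (fun b => ent (rho b) i i).
Proof.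
move=> [rl [r1 rM] rS]; split=> [c x y|J b c].
  by rewrite rl entD entZ.
pose X := \sum_j ev (rho (b j)) (hdelta i (c j)).
rewrite (_ : \sum_j _ = ip X X); first exact: ip_ge0.
rewrite /X ip_suml; apply: eq_bigr => j _; rewrite ip_sumr; apply: eq_bigr => k _.
by rewrite ev_star -rS -evM -rM ip_delta [hdelta i (c k)]hdelta_mulr evxMr hm_mulrE mulrA.
Qed.

(** [E] is the entry at [(0, 0)] of the morphism to the regular representation. There [u^r] moves
    degree 0 to degree [r], where [a] acts by [beta^r a], and distinct degrees are orthogonal. *)
Lemma crossed_expectation (A : cstarType R) (alpha : A -> A) (B : cstarType R)
    (iota : A -> B) (u : B) : star_automorphism alpha -> crossed_product alpha iota u ->
  exists (beta : A -> A) (E : B -> A),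
  [/\ star_hom beta, cancel alpha beta /\ cancel beta alpha, linear E, cpf E /\ E 1 = 1
    & forall p r a, E (star (u ^+ p) * iota a * u ^+ r) = if p == r then iter p beta a else 0].
Proof.
move=> [aH [beta ab ba]] [cov univ].
have [rho [[rH rpi ru] _]] := univ _ _ _ (reg_covariant aH ab ba).
have [El Ep] := @entry_cpf _ _ _ rho 0 rH; have [rl [r1 rM] rS] := rH.
exists beta, (fun b => ent (rho b) 0 0); split=> //.
- exact: star_hom_inv aH ab ba.
- by split=> //; rewrite r1 entE ev1 ip_delta hdeltaE star1 mulr1.
- have rX p : rho (u ^+ p) = reg_u A ^+ p.
    by elim: p => [|p IH]; rewrite ?expr0 ?r1// !exprS rM ru IH.
  move=> p r a; rewrite !rM rS !rX rpi entE !evM -ev_star !ev_u_delta.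
  rewrite ev_pi_delta ip_delta star1 mul1r hdeltaE mulr1 eqz_nat.
  by case: eqP => [->|].
Qed.

End Expectation.

Record cstar_sub (R : realType) (B : cstarType R) := CstarSub {
  cs_pred :> B -> Prop ;
  cs1 : cs_pred 1 ;
  csD : forall x y, cs_pred x -> cs_pred y -> cs_pred (x + y) ;
  csZ : forall (c : R[i]) x, cs_pred x -> cs_pred (c *: x) ;
  csM : forall x y, cs_pred x -> cs_pred y -> cs_pred (x * y) ;
  cs_star : forall x, cs_pred x -> cs_pred (star x) ;
  cs_closed : forall (x : nat -> B) l, climit x l -> (forall n, cs_pred (x n)) -> cs_pred l
}.

Section Subalgebra.
Variables (R : realType) (B : cstarType R) (S : cstar_sub B).

Definition sub_sort : Type := {x : B | `[< S x >]}.
Implicit Types x y z : sub_sort.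

Definition subv x : B := sval x.
Lemma subP x : S (subv x). Proof. by case: x => x /= /asboolP. Qed.
Definition mksub (x : B) (h : S x) : sub_sort := exist _ x (asboolT h).
Lemma sub_ext x y : subv x = subv y -> x = y. Proof. exact: val_inj. Qed.

HB.instance Definition _ := gen_eqMixin sub_sort.
HB.instance Definition _ := gen_choiceMixin sub_sort.

Lemma cs0 : S 0. Proof. by rewrite -(scale0r (1 : B)); apply: csZ; exact: cs1. Qed.

Definition sub_add x y : sub_sort := mksub (csD (subP x) (subP y)).
Definition sub_scale (c : R[i]) x : sub_sort := mksub (csZ c (subP x)).
Definition sub_zero : sub_sort := mksub cs0.
Definition sub_one : sub_sort := mksub (cs1 S).
Definition sub_opp x : sub_sort := sub_scale (-1) x.
Definition sub_mul x y : sub_sort := mksub (csM (subP x) (subP y)).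
Definition sub_star x : sub_sort := mksub (cs_star (subP x)).
Definition sub_nr x : R := nrm (subv x).

Let addA : associative sub_add.
Proof. by move=> x y z; apply: sub_ext; exact: addrA. Qed.
Let addC : commutative sub_add.
Proof. by move=> x y; apply: sub_ext; exact: addrC. Qed.
Let add0 : left_id sub_zero sub_add.
Proof. by move=> x; apply: sub_ext; exact: add0r. Qed.
Let addN : left_inverse sub_zero sub_opp sub_add.
Proof. by move=> x; apply: sub_ext; rewrite /= scaleN1r addNr. Qed.

HB.instance Definition _ := GRing.isZmodule.Build sub_sort addA addC add0 addN.

Let scaleA (a b : R[i]) x : sub_scale a (sub_scale b x) = sub_scale (a * b) x.
Proof. by apply: sub_ext; exact: scalerA. Qed.
Let scale1 : left_id 1 sub_scale.
Proof. by move=> x; apply: sub_ext; exact: scale1r. Qed.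
Let scaleDr : right_distributive sub_scale +%R.
Proof. by move=> c x y; apply: sub_ext; exact: scalerDr. Qed.
Let scaleDl x : {morph sub_scale^~ x : a b / a + b}.
Proof. by move=> a b; apply: sub_ext; exact: scalerDl. Qed.

HB.instance Definition _ :=
  GRing.Zmodule_isLmodule.Build R[i] sub_sort scaleA scale1 scaleDr scaleDl.

Let mulA : associative sub_mul.
Proof. by move=> x y z; apply: sub_ext; exact: mulrA. Qed.
Let mul1 : left_id sub_one sub_mul.
Proof. by move=> x; apply: sub_ext; exact: mul1r. Qed.
Let mulr1' : right_id sub_one sub_mul.
Proof. by move=> x; apply: sub_ext; exact: mulr1. Qed.
Let mulDl : left_distributive sub_mul +%R.
Proof. by move=> x y z; apply: sub_ext; exact: mulrDl. Qed.
Let mulDr : right_distributive sub_mul +%R.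
Proof. by move=> x y z; apply: sub_ext; exact: mulrDr. Qed.
Let mscaleAl (c : R[i]) x y : c *: sub_mul x y = sub_mul (c *: x) y.
Proof. by apply: sub_ext; exact: cscaleAl. Qed.
Let mscaleAr (c : R[i]) x y : c *: sub_mul x y = sub_mul x (c *: y).
Proof. by apply: sub_ext; exact: cscaleAr. Qed.
Let mstarK : involutive sub_star.
Proof. by move=> x; apply: sub_ext; exact: starK. Qed.
Let mstarD x y : sub_star (x + y) = sub_star x + sub_star y.
Proof. by apply: sub_ext; exact: starD. Qed.
Let mstarZ (c : R[i]) x : sub_star (c *: x) = Num.conj c *: sub_star x.
Proof. by apply: sub_ext; exact: starZ. Qed.
Let mstarM x y : sub_star (sub_mul x y) = sub_mul (sub_star y) (sub_star x).
Proof. by apply: sub_ext; exact: starM. Qed.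
Let nD x y : sub_nr (x + y) <= sub_nr x + sub_nr y.
Proof. exact: nrmD. Qed.
Let nZ (c : R[i]) x : sub_nr (c *: x) = complex.Re `|c| * sub_nr x.
Proof. exact: nrmZ. Qed.
Let n0 x : sub_nr x = 0 -> x = 0.
Proof. by move=> h; apply: sub_ext; exact: nrm_eq0. Qed.
Let nM x y : sub_nr (sub_mul x y) <= sub_nr x * sub_nr y.
Proof. exact: nrmM. Qed.
Let nS x : sub_nr (sub_mul (sub_star x) x) = sub_nr x ^+ 2.
Proof. exact: nrm_starM. Qed.

Lemma subvB x y : subv (x - y) = subv x - subv y.
Proof. by rewrite [LHS]/= scaleN1r. Qed.

Let ncomplete (u : nat -> sub_sort) :
  (forall e : R, 0 < e -> exists N, forall m n, (N <= m)%N -> (N <= n)%N ->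
     sub_nr (u m - u n) < e) ->
  exists l, forall e : R, 0 < e -> exists N, forall n, (N <= n)%N -> sub_nr (u n - l) < e.
Proof.
move=> uc; have [e e0|l ul] := @climit_cauchy _ _ (fun n => subv (u n)).
  have [N hN] := uc e e0; exists N => m n Nm Nn.
  by rewrite -subvB; exact: hN.
exists (mksub (cs_closed ul (fun n => subP (u n)))) => e e0.
have [N hN] := ul e e0; exists N => n Nn.
by rewrite /sub_nr subvB; exact: hN.
Qed.

Definition sub_data : cstar_data R := @CstarData R sub_sort sub_mul sub_one sub_star sub_nr
  mulA mul1 mulr1' mulDl mulDr mscaleAl mscaleAr mstarK mstarD mstarZ mstarM
  nD nZ n0 nM nS ncomplete.

Definition subalg : cstarType R := cstar_of_data sub_data.

Definition sub_incl (x : subalg) : B := subv (x : sub_sort).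
Definition sub_in (x : B) (h : S x) : subalg := mksub h.

Lemma sub_inclP (x : subalg) : S (sub_incl x). Proof. exact: subP. Qed.
Lemma sub_incl_inj (x y : subalg) : sub_incl x = sub_incl y -> x = y.
Proof. exact: sub_ext. Qed.

End Subalgebra.

Section Covariant.
Variables (R : realType) (A B : cstarType R) (alpha : A -> A) (iota : A -> B) (u : B).
Hypothesis cov : covariant alpha iota u.

Let uu : star u * u = 1. Proof. by case: cov. Qed.
Let uu' : u * star u = 1. Proof. by case: cov. Qed.

Lemma u_nrm p : nrm (u ^+ p) <= 1.
Proof.
elim: p => [|p IH]; first by rewrite expr0 nrm1_le.
rewrite exprS -[1]mulr1; apply: nrmM_le => //.
have := nrm_starM u; rewrite uu => h; have := nrm1_le B; rewrite h.
by have := nrm_ge0 u; nra.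
Qed.

Lemma iota_nrm a : nrm (iota a) <= nrm a.
Proof. by have [iH _ _ _] := cov; exact: star_hom_nrm. Qed.

Lemma iotaM x y : iota (x * y) = iota x * iota y.
Proof. by have [[_ [_ +] _] _ _ _] := cov; apply. Qed.

Lemma iotaS x : iota (star x) = star (iota x).
Proof. by have [[_ _ +] _ _ _] := cov; apply. Qed.

Lemma iotal : linear iota.
Proof. by have [[]] := cov. Qed.

Lemma starX_mulX n : star (u ^+ n) * u ^+ n = 1.
Proof.
elim: n => [|n IH]; first by rewrite expr0 star1 mulr1.
by rewrite exprS starM mulrA -(mulrA _ (star u)) uu mulr1 IH.
Qed.

Lemma mulX_starX n : u ^+ n * star (u ^+ n) = 1.
Proof.
elim: n => [|n IH]; first by rewrite expr0 star1 mulr1.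
by rewrite exprSr starM mulrA -(mulrA _ u) uu' mulr1 IH.
Qed.

Lemma starX_X p q : (p <= q)%N -> star (u ^+ p) * u ^+ q = u ^+ (q - p).
Proof. by move=> pq; rewrite -{1}(subnKC pq) exprD mulrA starX_mulX mul1r. Qed.

Lemma covX n a : u ^+ n * iota a = iota (iter n alpha a) * u ^+ n.
Proof.
have [_ _ _ ua] := cov; elim: n => [|n IH]; first by rewrite expr0 mulr1 mul1r.
rewrite exprS -mulrA IH mulrA iterS ua -!mulrA; congr (_ * (_ * _)).
by rewrite mulrA uu mul1r.
Qed.

Lemma covXs n a : iota a * star (u ^+ n) = star (u ^+ n) * iota (iter n alpha a).
Proof.
rewrite -[LHS]mul1r -(starX_mulX n) -!mulrA; congr (_ * _).
by rewrite mulrA covX -mulrA mulX_starX mulr1.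
Qed.

End Covariant.

(** * Density of the monomials in the crossed product *)

Section Density.
Variables (R : realType) (A B : cstarType R) (alpha : A -> A) (iota : A -> B) (u : B).
Hypothesis cp : crossed_product alpha iota u.

Let iH : star_hom iota. Proof. by have [[]] := cp. Qed.
Let uu : star u * u = 1. Proof. by have [[]] := cp. Qed.
Let uu' : u * star u = 1. Proof. by have [[]] := cp. Qed.
Let cov a : iota (alpha a) = u * iota a * star u. Proof. by have [[]] := cp. Qed.
Let covr : covariant alpha iota u. Proof. by case: cp. Qed.

(** Two natural exponents, for a monomial of degree [j - i], avoid negative powers of [u], and the
    adjoint just swaps them. *)
Definition mono (t : (nat * A) * nat) : B := star (u ^+ t.1.1) * iota t.1.2 * u ^+ t.2.

Definition monosum (s : seq ((nat * A) * nat)) : B := \sum_(t <- s) mono t.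

Definition is_poly (b : B) := exists s, b = monosum s.

Lemma poly_mono t : is_poly (mono t).
Proof. by exists [:: t]; rewrite /monosum big_seq1. Qed.

Lemma polyD x y : is_poly x -> is_poly y -> is_poly (x + y).
Proof. by move=> [s ->] [t ->]; exists (s ++ t); rewrite /monosum big_cat. Qed.

Lemma poly0 : is_poly 0. Proof. by exists [::]; rewrite /monosum big_nil. Qed.

Lemma poly_sum (K : Type) (s : seq K) (F : K -> B) :
  (forall k, is_poly (F k)) -> is_poly (\sum_(k <- s) F k).
Proof. by move=> h; apply: big_ind => //; [exact: poly0|exact: polyD]. Qed.

(** The inner product [u^j u^-k] leaves a power of [u] or of its adjoint, according to the sign of
    [j - k]; covariance moves it outwards across [A]. *)
Lemma mono_mul s t : is_poly (mono s * mono t).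
Proof.
case: s => [[i a] j]; case: t => [[k b] l]; rewrite /mono /=.
have [iD _ _] := iH; have [_ [_ iM] _] := iH.
have [jk|/ltnW jk] := leqP k j.
  exists [:: ((i, a * iter (j - k) alpha b), (j - k + l)%N)].
  rewrite /monosum big_seq1 /mono /= iM exprD -{1}(subnK jk) exprD !mulrA.
  congr (_ * _); rewrite -!mulrA; congr (_ * (_ * _)).
  by rewrite (mulrA (u ^+ k)) (mulX_starX covr) mul1r (covX covr).
exists [:: ((i + (k - j))%N, iter (k - j) alpha a * b, l)].
rewrite /monosum big_seq1 /mono /= iM addnC exprD starM -{1}(subnK jk) exprD starM !mulrA.
congr (_ * _ * _); rewrite -!mulrA; congr (_ * _).
by rewrite (mulrA (u ^+ j)) (mulX_starX covr) mul1r (covXs covr).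
Qed.

Lemma polyM x y : is_poly x -> is_poly y -> is_poly (x * y).
Proof.
move=> [s ->] [t ->]; rewrite /monosum mulr_suml; apply: poly_sum => m.
by rewrite mulr_sumr; apply: poly_sum => m'; exact: mono_mul.
Qed.

Lemma mono_star t : star (mono t) = mono (t.2, star t.1.2, t.1.1).
Proof. by have [_ _ iS] := iH; rewrite /mono /= !starM starK iS mulrA. Qed.

Lemma poly_star x : is_poly x -> is_poly (star x).
Proof.
move=> [s ->]; rewrite /monosum star_sum; apply: poly_sum => m.
by rewrite mono_star; exact: poly_mono.
Qed.

Lemma polyZ (c : R[i]) x : is_poly x -> is_poly (c *: x).
Proof.
move=> [s ->]; rewrite /monosum scaler_sumr; apply: poly_sum => m.
have [iL _ _] := iH.
suff -> : c *: mono m = mono (m.1.1, c *: m.1.2, m.2) by exact: poly_mono.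
by rewrite /mono /= (linfZ _ _ iL) scAr scAl.
Qed.

Definition poly_cl (b : B) := forall e : R, 0 < e -> exists2 p, is_poly p & nrm (b - p) < e.

Lemma poly_clP b : poly_cl b <-> exists2 x : nat -> B, (forall n, is_poly (x n)) & climit x b.
Proof.
split=> [h|[x xp xb] e /xb[N hN]]; last first.
  by exists (x N) => //; rewrite nrmBC; exact: hN.
have v_gt0 (n : nat) : 0 < n.+1%:R^-1 :> R by rewrite invr_gt0.
pose x n := projT1 (cid2 (h _ (v_gt0 n))).
have xP n : is_poly (x n) /\ nrm (b - x n) < n.+1%:R^-1 by rewrite /x; case: cid2.
exists x => [n|e e0]; first by have [] := xP n.
have := archi_boundP (ltW (divr_gt0 (@ltr01 R) e0)); rewrite div1r.
set N := Num.bound _ => hN; exists N => n Nn; have [_] := xP n; rewrite nrmBC => /lt_trans; apply.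
rewrite -[e]invrK ltf_pV2 ?posrE ?invr_gt0//.
by apply: lt_le_trans hN _; rewrite ler_nat (leq_trans Nn).
Qed.

Lemma poly_cl_poly b : is_poly b -> poly_cl b.
Proof. by move=> bp e e0; exists b; rewrite // subrr nrm0. Qed.

Lemma iota_poly a : is_poly (iota a).
Proof. by exists [:: ((0%N, a), 0%N)]; rewrite /monosum big_seq1 /mono /= !expr0 star1 mul1r mulr1. Qed.

Lemma u_poly : is_poly u.
Proof.
exists [:: ((0%N, 1), 1%N)]; rewrite /monosum big_seq1 /mono /= expr0 star1 expr1.
by have [_ [-> _] _] := iH; rewrite !mul1r.
Qed.

Definition poly_sub : cstar_sub B.
Proof.
apply: (@CstarSub R B poly_cl).
- by apply: poly_cl_poly; have [_ [<- _] _] := iH; exact: iota_poly.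
- move=> x y /poly_clP[s sp sx] /poly_clP[t tp ty]; apply/poly_clP.
  by exists (fun n => s n + t n) => [n|]; [exact: polyD|exact: climitD].
- move=> c x /poly_clP[s sp sx]; apply/poly_clP.
  exists (fun n => c *: s n) => [n|]; first exact: polyZ.
  apply: (@climit_lip _ _ _ ( *:%R c) (complex.Re `|c|)) sx => y z.
  by rewrite -scalerBr nrmZ.
- move=> x y /poly_clP[s sp sx] /poly_clP[t tp ty]; apply/poly_clP.
  by exists (fun n => s n * t n) => [n|]; [exact: polyM|exact: climitM].
- move=> x /poly_clP[s sp sx]; apply/poly_clP.
  by exists (fun n => star (s n)) => [n|]; [exact: poly_star|exact: climit_star].
- move=> x l xl xp e e0; have e2 : 0 < e / 2 by lra.
  have [N hN] := xl _ e2; have [p pp xNp] := xp N _ e2; exists p => //.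
  have := nrm_tri l (x N) p; rewrite (nrmBC l (x N)).
  by have := hN N (leqnn N); lra.
Defined.

(* The closed span of the monomials is a C*-algebra generated by a covariant pair, so
   by universality its inclusion into [B] has a section, hence is onto. *)
Lemma crossed_dense b : poly_cl b.
Proof.
have [cov0 univ] := cp.
pose D := subalg poly_sub.
pose pi (a : A) : D := sub_in (S := poly_sub) (poly_cl_poly (iota_poly a)).
pose v : D := sub_in (S := poly_sub) (poly_cl_poly u_poly).
have [iL [i1 iM] iS] := iH.
have pv : covariant alpha pi v.
  split; [split|..].
  - by move=> c x y; apply: sub_incl_inj; exact: iL.
  - by split=> [|x y]; apply: sub_incl_inj; [exact: i1|exact: iM].
  - by move=> a; apply: sub_incl_inj; exact: iS.
  - by apply: sub_incl_inj; exact: uu.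
  - by apply: sub_incl_inj; exact: uu'.
  - by move=> a; apply: sub_incl_inj; exact: cov.
have [f [[fH fpi fv] _]] := univ D pi v pv.
have [fL [f1 fM] fS] := fH.
have [g [_ guniq]] := univ B iota u cov0.
have E1 : g = id by apply: guniq; split=> //; split.
have E2 : g = (fun b => sub_incl (f b)).
  apply: guniq; split=> [|a|]; last by rewrite fv.
    split.
    - by move=> c x y; rewrite fL.
    - by split=> [|x y]; rewrite ?f1 ?fM.
    - by move=> a; rewrite fS.
  by rewrite fpi.
have -> : b = sub_incl (f b) by rewrite -[LHS]/(id b) -E1 E2.
exact: (sub_inclP (S := poly_sub)).
Qed.

End Density.

(** * Finite-dimensional C*-algebras *)

Section Spectral.
Variables (R : realType) (E : cstarType R).

(** The C*-identity handles exponents that are powers of 2, and [n <= 2^n]. *)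
Lemma sa_nilp (a : E) n : star a = a -> a ^+ n = 0 -> a = 0.
Proof.
have pow2 k (b : E) : star b = b -> b ^+ (2 ^ k) = 0 -> b = 0.
  elim: k b => [|k IH] b bS; first by rewrite expn0 expr1.
  rewrite expnS exprM => /IH-/(_ _); rewrite starX bS => /(_ erefl).
  rewrite expr2 => b2; apply: nrm_eq0; apply/eqP.
  by rewrite -sqrf_eq0 -nrm_sa// b2 nrm0.
move=> aS an; apply: (pow2 n) => //.
by rewrite -(subnK (ltnW (ltn_expl n (isT : 1 < 2)%N))) exprD an mulr0.
Qed.

Lemma sq0_normal (y : E) : star y * y = y * star y -> y * y = 0 -> y = 0.
Proof.
move=> yn y2; have h0 : star y * y = 0.
  apply: (@sa_nilp _ 2); first by rewrite starM starK.
  by rewrite expr2 {2}yn !mulrA -(mulrA _ y y) y2 mulr0 mul0r.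
have := nrm_starM y; rewrite h0 nrm0 => /esym/eqP; rewrite sqrf_eq0 => /eqP.
exact: nrm_eq0.
Qed.

(** [star y] commutes with the self-adjoint [x], hence with everything in the bicommutant of [x]. *)
Lemma normal_commutant (x y : E) : star x = x -> commutant x y -> star y * y = y * star y.
Proof.
move=> xS xy; have yx : y * x = x * y by apply/esym; exact: xy.
by apply: xy; rewrite -[in LHS]xS -starM -yx starM xS.
Qed.

Definition is_proj (p : E) := star p = p /\ p * p = p.

(** By normality [p - p^* p] has zero C*-square, so [p = p^* p] is self-adjoint. *)
Lemma normal_idem (p : E) : star p * p = p * star p -> p * p = p -> is_proj p.
Proof.
move=> pn pp; split=> //; set a := star p in pn *.
have aa : a * a = a by rewrite /a -starM pp.
have z0 : star (p - a * p) * (p - a * p) = 0.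
  rewrite starB starM -/a (_ : star a = p) ?starK// !mulrBl !mulrBr.
  rewrite (mulrA a a p) aa -(mulrA a p p) pp (mulrA (a * p) a p) -(mulrA a p a) -pn.
  by rewrite (mulrA a a p) aa -(mulrA a p p) pp !subrr.
have : p - a * p = 0.
  have := nrm_starM (p - a * p); rewrite z0 nrm0 => /esym/eqP.
  by rewrite sqrf_eq0 => /eqP/nrm_eq0.
move/eqP; rewrite subr_eq0 => /eqP pE.
by rewrite /a [in LHS]pE starM -/a (_ : star a = p) ?starK// -pE.
Qed.

Lemma proj_pos (p : E) : is_proj p -> Pcone p /\ Pcone (1 - p).
Proof.
move=> [pS pp]; split; first by rewrite -pp; exact: PconeS.
have -> : 1 - p = (1 - p) * (1 - p).
  by rewrite mulrBl mul1r mulrBr mulr1 pp subrr subr0.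
by apply: PconeS; rewrite starB star1 pS.
Qed.

Variable (x : E).

Definition pr (s : seq R[i]) : E := foldr (fun mu y => (x - mu *: (1 : E)) * y) 1 s.

Lemma pr_commutant s : commutant x (pr s).
Proof.
elim: s => [|mu s IH] /=; first exact: commutant1.
exact/commutantM/IH/commutantB/commutantZ/commutant1/commutant_id.
Qed.

Lemma lin_comm mu y : commutant x y -> (x - mu *: (1 : E)) * y = y * (x - mu *: (1 : E)).
Proof. by move=> xy; apply: xy; rewrite mulrBl mulrBr scAl scAr mulr1 mul1r. Qed.

Lemma pr_rem mu s : mu \in s -> pr s = (x - mu *: (1 : E)) * pr (rem mu s).
Proof.
elim: s => //= nu s IH; rewrite inE; case: eqVneq => [->//|ne] /= ms.
rewrite (IH ms) !mulrA; congr (_ * _).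
by apply: lin_comm; exact/commutantB/commutantZ/commutant1/commutant_id.
Qed.

Lemma pr_rem' mu s : mu \in s -> pr s = pr (rem mu s) * (x - mu *: (1 : E)).
Proof. by move=> /pr_rem ->; apply: lin_comm; exact: pr_commutant. Qed.

(** Partial fractions of 1. To add a root [mu], each old term is rewritten with
    [mu - nu = (x - nu) - (x - mu)], which is invertible as the roots are distinct. *)
Lemma pr_fractions s : uniq s -> s != [::] ->
  exists c : R[i] -> R[i], \sum_(mu <- s) c mu *: pr (rem mu s) = 1.
Proof.
elim: s => // mu s IH /= /andP[ms us] _.
have [->|sn] := eqVneq s [::].
  by exists (fun=> 1); rewrite big_seq1 /= eqxx scale1r.
have [c cE] := IH us sn.
exists (fun nu => if nu == mu then \sum_(la <- s) c la / (mu - la) else - (c nu / (mu - nu))).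
rewrite big_cons /= !eqxx.
transitivity (\sum_(nu <- s) c nu *: pr (rem nu s)) => //.
rewrite scaler_suml -big_split /= big_seq [RHS]big_seq.
apply: eq_bigr => nu ns.
have nm : nu == mu = false by apply: contraNF ms => /eqP <-.
have mn : mu == nu = false by rewrite eq_sym.
rewrite nm mn /= (pr_rem ns).
have d0 : mu - nu != 0 by rewrite subr_eq0 mn.
have -> : c nu *: pr (rem nu s) = (c nu / (mu - nu)) *: ((mu - nu) *: pr (rem nu s)).
  by rewrite scalerA mulfVK.
by nc.
Qed.

Hypothesis xS : star x = x.
Hypothesis n10 : (1 : E) != 0.

(* A repeated root in a product of minimal length would give a normal element of square 0. *)
Lemma pr_uniq s : pr s = 0 -> exists2 t, uniq t & pr t = 0.
Proof.
move=> s0; pose P n := `[< exists2 t, size t = n & pr t = 0 >].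
have exP : exists n, P n by exists (size s); apply/asboolP; exists s.
case: (ex_minnP exP) => n /asboolP[t tn t0] tmin; exists t => //.
apply: contraT => nu.
have [mu [mt mr]] : exists mu, mu \in t /\ mu \in rem mu t.
  elim: t nu {tn t0 tmin} => //= mu t IH; rewrite negb_and negbK => /orP[mt|/IH[la [lt lr]]].
    by exists mu; rewrite inE eqxx /= mt.
  exists la; rewrite inE lt orbT; split=> //.
  by case: eqP => // _; rewrite inE lr orbT.
have y0 : pr (rem mu t) = 0.
  apply: sq0_normal; first by apply: (normal_commutant xS); exact: pr_commutant.
  by rewrite {1}(pr_rem' mr) -mulrA -(pr_rem mt) t0 mulr0.
have : (n <= size (rem mu t))%N by apply: tmin; apply/asboolP; exists (rem mu t).
rewrite size_rem// tn; case: t mt tn {t0 tmin nu mr y0} => //= nu t _ <-.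
by rewrite ltnn.
Qed.

(** The terms of [pr_fractions] sum to 1, and distinct ones multiply to 0 because the product
    contains [pr t]. So they are idempotents in the bicommutant of [x], hence normal, hence
    projections. *)
Lemma proj_dec s : pr s = 0 -> exists (t : seq R[i]) (p : R[i] -> E),
  (forall mu, mu \in t -> is_proj (p mu)) /\ x = \sum_(mu <- t) mu *: p mu.
Proof.
move=> /pr_uniq[t ut t0].
have tn : t != [::].
  by apply: contraNneq n10 => tE; move: t0; rewrite tE /= => ->.
have [c cE] := pr_fractions ut tn.
pose p mu := c mu *: pr (rem mu t).
have xp mu : mu \in t -> x * p mu = mu *: p mu.
  move=> mt; apply/eqP; rewrite -subr_eq0; apply/eqP.
  rewrite (_ : _ - _ = c mu *: ((x - mu *: (1 : E)) * pr (rem mu t))); last by rewrite /p; nc.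
  by rewrite -(pr_rem mt) t0 scaler0.
exists t, p; split; last first.
  rewrite -[LHS]mulr1 -cE mulr_sumr big_seq [RHS]big_seq.
  by apply: eq_bigr => mu mt; exact: xp.
move=> mu mt; apply: normal_idem.
  by apply: (normal_commutant xS); apply: commutantZ; exact: pr_commutant.
transitivity (p mu * 1); last by rewrite mulr1.
rewrite -cE mulr_sumr (bigD1_seq mu)//= big_seq_cond big1 ?addr0// => nu /andP[nt nm].
have mr : mu \in rem nu t by rewrite mem_rem_uniq// inE eq_sym nm.
by rewrite /p scAl scAr (pr_rem mr) mulrA -(pr_rem' mt) t0 mul0r !scaler0.
Qed.

End Spectral.

(** * The regular trace of a finite-dimensional C*-algebra *)

Section FinDim.
Variables (R : realType) (E : cstarType R).
Local Notation C := R[i].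

Lemma fd_basis : finite_dimensional E -> exists N (e : 'I_N -> E),
  (forall x, exists c : 'I_N -> C, x = \sum_i c i *: e i) /\
  (forall c : 'I_N -> C, \sum_i c i *: e i = 0 -> forall i, c i = 0).
Proof.
move=> [n0 [e0 h0]].
pose P n := `[< exists e : 'I_n -> E, forall x, exists c : 'I_n -> C, x = \sum_i c i *: e i >].
have exP : exists n, P n by exists n0; apply/asboolP; exists e0.
case: (ex_minnP exP) => N /asboolP[e he] Nmin; exists N, e; split=> // c c0 i.
apply/eqP/negPn/negP => ci0.
case: N e he Nmin c c0 i ci0 => [e ? ? ? ? []//|N e he Nmin c c0 i ci0].
suff /Nmin : P N by rewrite ltnn.
apply/asboolP; exists (fun j => e (lift i j)) => x; have [d ->] := he x.
exists (fun j => d (lift i j) - d i / c i * c (lift i j)).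
rewrite (bigD1_ord i)//=; under [RHS]eq_bigr do rewrite scalerBl.
rewrite sumrB addrC; congr (_ + _).
have -> : d i *: e i = (d i / c i) *: (c i *: e i) by rewrite scalerA mulfVK.
move: c0; rewrite (bigD1_ord i)//= => /eqP; rewrite addr_eq0 => /eqP ->.
by rewrite scalerN scaler_sumr; congr (- _); apply: eq_bigr => j _; rewrite scalerA.
Qed.

(** A nonempty basis, so that square matrices form a nontrivial ring; [casimir] treats the zero
    algebra apart. *)
Variables (N : nat) (e : 'I_N.+1 -> E).
Hypothesis span : forall x, exists c : 'I_N.+1 -> C, x = \sum_i c i *: e i.
Hypothesis indep : forall c : 'I_N.+1 -> C, \sum_i c i *: e i = 0 -> forall i, c i = 0.

Definition co (x : E) : 'rV[C]_N.+1 := \row_i (projT1 (cid (span x)) i).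
Definition vec (v : 'rV[C]_N.+1) : E := \sum_i v 0 i *: e i.

Lemma coK x : vec (co x) = x.
Proof. by rewrite /vec /co; case: cid => c /= ->; apply: eq_bigr => i _; rewrite mxE. Qed.

Lemma vecD v w : vec (v + w) = vec v + vec w.
Proof. by rewrite /vec -big_split; apply: eq_bigr => i _; rewrite mxE scalerDl. Qed.

Lemma vecZ c v : vec (c *: v) = c *: vec v.
Proof. by rewrite /vec scaler_sumr; apply: eq_bigr => i _; rewrite mxE scalerA. Qed.

Lemma vec0 : vec 0 = 0.
Proof. by rewrite -(scale0r 0) vecZ !scale0r. Qed.

Lemma vec_inj v w : vec v = vec w -> v = w.
Proof.
move=> vw; have : vec (v - w) = 0 by rewrite -scaleN1r vecD vecZ scaleN1r vw subrr.
move=> /indep h; apply/rowP => i; have := h i; rewrite !mxE => /eqP.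
by rewrite subr_eq0 => /eqP.
Qed.

(** Right multiplication acting on row vectors, which makes [rmx] multiplicative with no
    reversal. *)
Definition rmx (x : E) : 'M[C]_N.+1 := \matrix_i co (e i * x).

Lemma vec_rmx v x : vec (v *m rmx x) = vec v * x.
Proof.
rewrite {2}/vec mulr_suml mulmx_sum_row.
elim/big_rec2: _ => [|i y z _ h]; first exact: vec0.
by rewrite vecD vecZ rowK coK h scAl.
Qed.

Lemma mx_ext (M M' : 'M[C]_N.+1) : (forall v, vec (v *m M) = vec (v *m M')) -> M = M'.
Proof. by move=> h; apply/row_matrixP => i; rewrite !rowE; exact: vec_inj. Qed.

Lemma rmxM x y : rmx (x * y) = rmx x *m rmx y.
Proof. by apply: mx_ext => v; rewrite mulmxA !vec_rmx mulrA. Qed.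

Lemma rmxD x y : rmx (x + y) = rmx x + rmx y.
Proof. by apply: mx_ext => v; rewrite mulmxDr vecD !vec_rmx mulrDr. Qed.

Lemma rmxZ c x : rmx (c *: x) = c *: rmx x.
Proof. by apply: mx_ext => v; rewrite -scalemxAr vecZ !vec_rmx scAr. Qed.

Lemma rmx1 : rmx 1 = 1%:M.
Proof. by apply: mx_ext => v; rewrite vec_rmx mulmx1 mulr1. Qed.

Lemma rmxX x n : rmx (x ^+ n) = rmx x ^+ n.
Proof. by elim: n => [|n IH]; rewrite ?expr0 ?rmx1// !exprS rmxM IH. Qed.

Lemma rmx_eq0 x : rmx x = 0 -> x = 0.
Proof. by move=> x0; rewrite -[x]mul1r -(coK 1) -vec_rmx x0 mulmx0 vec0. Qed.

Lemma fd_n10 : (1 : E) != 0.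
Proof.
apply/eqP => E0; have e0 : e ord0 = 0 by rewrite -[e _]mul1r E0 mul0r.
have := @indep (fun i => (i == ord0)%:R).
rewrite (bigD1 ord0)//= e0 scaler0 big1 => [|i /negbTE ->]; last by rewrite scale0r.
by rewrite addr0 => /(_ erefl ord0)/eqP; rewrite eqxx oner_eq0.
Qed.

(** Cayley-Hamilton for [rmx x], the characteristic polynomial being split over [R[i]]. *)
Lemma fd_annihilated (x : E) : exists s : seq C, pr x s = 0.
Proof.
have [s sE] := closed_field_poly_normal (char_poly (rmx x)).
exists s; apply: rmx_eq0; have := Cayley_Hamilton (rmx x).
rewrite sE (monicP (char_poly_monic _)) scale1r rmorph_prod /= => <-.
elim: s {sE} => [|mu s IH]; first by rewrite big_nil /= rmx1.
rewrite big_cons -IH /= rmxM; congr (_ * _).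
  rewrite rmorphB /= horner_mx_X horner_mx_C -(scaleN1r (mu *: _)).
  by rewrite rmxD !rmxZ rmx1 scale_scalar_mx mulr1 scaleN1r.
Qed.

Lemma proj_span x : exists (s : seq (C * E)),
  (forall t, t \in s -> is_proj t.2) /\ x = \sum_(t <- s) t.1 *: t.2.
Proof.
have sa y : star y = y -> exists (s : seq (C * E)),
  (forall t, t \in s -> is_proj t.2) /\ y = \sum_(t <- s) t.1 *: t.2.
  move=> yS; have [r r0] := fd_annihilated y.
  have [t [p [pp yE]]] := proj_dec yS fd_n10 r0.
  exists [seq (mu, p mu) | mu <- t]; split=> [_ /mapP[mu mt ->]|]; first exact: pp.
  by rewrite big_map.
have [y [z [yS zS ->]]] := re_im x.
have [s [sp sE]] := sa y yS; have [t [tp tE]] := sa z zS.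
exists (s ++ [seq (imi * m.1, m.2) | m <- t]); split.
  by move=> m; rewrite mem_cat => /orP[/sp//|/mapP[m' /tp ? ->]].
rewrite big_cat big_map /= -sE tE scaler_sumr; congr (_ + _).
by apply: eq_bigr => m _; rewrite scalerA.
Qed.

Definition tr x : C := \tr (rmx x).

Lemma trD x y : tr (x + y) = tr x + tr y. Proof. by rewrite /tr rmxD mxtraceD. Qed.
Lemma trZ c x : tr (c *: x) = c * tr x. Proof. by rewrite /tr rmxZ mxtraceZ. Qed.
Lemma trM x y : tr (x * y) = tr (y * x). Proof. by rewrite /tr !rmxM mxtrace_mulC. Qed.
Lemma tr0 : tr 0 = 0. Proof. by rewrite -(scale0r 0) trZ mul0r. Qed.
Lemma trB x y : tr (x - y) = tr x - tr y.
Proof. by rewrite -scaleN1r trD trZ mulN1r. Qed.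
Lemma tr_sum (K : Type) (s : seq K) (F : K -> E) :
  tr (\sum_(k <- s) F k) = \sum_(k <- s) tr (F k).
Proof. by apply: (big_morph _ trD); exact: tr0. Qed.

Lemma scale_pos_ge0 (z : C) (w : E) : Pcone w -> w != 0 -> Pcone (z *: w) -> 0 <= z.
Proof.
move=> Pw wn Pz.
have zr : z - conjc z = 0.
  apply/eqP; apply: contraNT wn => zn.
  have : (z - conjc z) *: w = 0.
    by have := Pcone_sa Pz; rewrite starZ (Pcone_sa Pw) scalerBl => ->; rewrite subrr.
  by move=> /(congr1 (fun a => (z - conjc z)^-1 *: a)); rewrite scalerA mulVf// scale1r scaler0 => ->.
have zE : z = (complex.Re z)%:C.
  case: z zr {Pz} => a b /eqP; rewrite eq_complex /= => /andP[_ /eqP].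
  by rewrite opprK => b2; congr Complex; lra.
rewrite zE ler0c leNgt; apply/negP => t0; case/eqP: wn.
apply: Pcone_anti => //.
have -> : - w = ((- complex.Re z)^-1) *^ (z *: w).
  rewrite zE scalerA -rmorphM/= invrN mulNr mulVf ?lt_eqF//.
  by rewrite rmorphN rmorph1 scaleN1r.
by apply: PconeZ => //; rewrite invr_ge0; lra.
Qed.

(** An eigenvector [y] with [y a = z y] gives [y a y^* = z y y^*], both sides positive, so every
    eigenvalue is nonnegative. If they sum to 0 they all vanish, and [a] is nilpotent. *)
Lemma tr_star_mul b : 0 <= tr (star b * b) /\ (tr (star b * b) = 0 -> b = 0).
Proof.
set a := star b * b.
have [r rE] := closed_field_poly_normal (char_poly (rmx a)).
rewrite (monicP (char_poly_monic _)) scale1r in rE.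
have rs : size r = N.+1.
  by have := size_char_poly (rmx a); rewrite rE size_prod_XsubC => -[].
have trE : tr a = \sum_(z <- r) z.
  have := char_poly_trace (rmx a) (ltn0Sn N); rewrite rE.
  have := @coefPn_prod_XsubC _ r; rewrite rs => /(_ isT) -> /eqP.
  by rewrite eqr_opp => /eqP.
have r0 z : z \in r -> 0 <= z.
  move=> zr; have : root (char_poly (rmx a)) z by rewrite rE root_prod_XsubC.
  rewrite -eigenvalue_root_char => /eigenvalueP[v vz vn].
  have yz : vec v * a = z *: vec v by rewrite -vec_rmx vz vecZ.
  set y := vec v in yz.
  have yn : y != 0.
    by apply: contraNneq vn => y0; apply/eqP/vec_inj; rewrite -/y y0 vec0.
  apply: (@scale_pos_ge0 z (y * star y)).
  - by rewrite -{1}(starK y); exact: Pcone_star_mul.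
  - apply: contraNneq yn => yy.
    have := nrm_starM (star y); rewrite starK yy nrm0 => /esym/eqP; rewrite sqrf_eq0 nrm_star.
    by move=> /eqP/nrm_eq0 ->.
  - rewrite -scAl -yz /a.
    have -> : y * (star b * b) * star y = star (b * star y) * (b * star y).
      by rewrite starM starK !mulrA.
    exact: Pcone_star_mul.
split.
  rewrite trE big_seq; apply: sumr_ge0; exact: r0.
rewrite trE => /eqP.
rewrite big_seq psumr_eq0// => /allP h.
have rz z : z \in r -> z = 0 by move=> zr; have := h z zr; rewrite zr => /eqP.
have aN : a ^+ N.+1 = 0.
  apply: rmx_eq0; have := Cayley_Hamilton (rmx a); rewrite rE.
  have pX (q : seq C) : (forall z, z \in q -> z = 0) ->
      \prod_(z <- q) ('X - z%:P) = 'X ^+ size q :> {poly C}.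
    elim: q => [|z q IH] qz; first by rewrite big_nil expr0.
    have qz' w : w \in q -> w = 0 by move=> wq; apply: qz; rewrite inE wq orbT.
    rewrite big_cons (IH qz').
    by rewrite (qz z (mem_head _ _)) subr0 -exprS.
  by rewrite pX// rs rmorphXn /= horner_mx_X -rmxX.
have a0 : a = 0 by apply: sa_nilp aN; rewrite /a starM starK.
have := nrm_starM b; rewrite -/a a0 nrm0 => /esym/eqP; rewrite sqrf_eq0 => /eqP.
exact: nrm_eq0.
Qed.


Lemma tr_real a : star a = a -> conjc (tr a) = tr a.
Proof.
have pos b : Pcone b -> conjc (tr b) = tr b.
  move=> /Pcone_sqrt_raw[s [sS <- _]]; have [+ _] := tr_star_mul s; rewrite sS.
  move=> /ger0_Im; case: (tr _) => c d /= ->; by rewrite oppr0.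
move=> aS; have -> : a = sca (nrm a) - (sca (nrm a) - a) by nc.
rewrite trB rmorphB /= !pos//; first exact: Pcone_sub_nrm.
exact/Pcone_cst/nrm_ge0.
Qed.

Lemma tr_star a : tr (star a) = conjc (tr a).
Proof.
have [x [y [xS yS ->]]] := re_im a.
rewrite starD starZ xS yS !trD !trZ rmorphD rmorphM /= !tr_real//.
Qed.

Lemma tr_star_mulP x : exists2 t : R, 0 <= t & tr (star x * x) = t%:C.
Proof.
have [h _] := tr_star_mul x; exists (complex.Re (tr (star x * x))).
  by move: h; rewrite lecE /= => /andP[].
by move: (ger0_Im h); case: (tr _) => a b /= ->.
Qed.

Lemma orthonormal_indep k (f : 'I_k -> E) (v : 'I_k -> C) :
  (forall i j, tr (star (f i) * f j) = (i == j)%:R) ->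
  \sum_i v i *: f i = 0 -> forall i, v i = 0.
Proof.
move=> fo v0 i; have := tr0; rewrite -(mulr0 (star (f i))) -v0 mulr_sumr tr_sum.
rewrite (bigD1 i)//= scAr trZ fo eqxx mulr1 big1 ?addr0// => j ji.
by rewrite scAr trZ fo eq_sym (negbTE ji) mulr0.
Qed.

(** An orthonormal family of maximal size, bounded by the dimension: a nonzero remainder [z], once
    normalized, would extend it. *)
Lemma onb_ex : exists k (f : 'I_k -> E),
  (forall i j, tr (star (f i) * f j) = (i == j)%:R) /\
  (forall y, y = \sum_i tr (star (f i) * y) *: f i).
Proof.
pose P k := `[< exists f : 'I_k -> E, forall i j, tr (star (f i) * f j) = (i == j)%:R >].
have exP : exists k, P k.
  by exists 0%N; apply/asboolP; exists (fun=> 0) => -[].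
have Pb k : P k -> (k <= N.+1)%N.
  move=> /asboolP[f fo]; pose M : 'M[C]_(k, N.+1) := \matrix_i co (f i).
  have : row_free M.
    rewrite -kermx_eq0; apply/eqP/row_matrixP => i; rewrite row0.
    set v := row i _; have vM : v *m M = 0 by rewrite -row_mul mulmx_ker row0.
    apply/rowP => j; rewrite [RHS]mxE; apply: (@orthonormal_indep k f (fun j => v 0 j) fo).
    rewrite -[RHS]vec0 -vM mulmx_sum_row.
    elim/big_rec2: _ => [|l y z _ ->]; first by rewrite vec0.
    by rewrite vecD vecZ rowK coK.
  by move=> /eqP <-; exact: rank_leq_col.
case: (ex_maxnP exP Pb) => k /asboolP[f fo] kmax; exists k, f; split=> // y.
apply/eqP; rewrite -subr_eq0; apply/eqP; set z := y - _.
have zf i : tr (star (f i) * z) = 0.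
  rewrite /z mulrBr trB mulr_sumr tr_sum (bigD1 i)//= scAr trZ fo eqxx mulr1 big1.
    by rewrite addr0 subrr.
  by move=> j ji; rewrite scAr trZ fo eq_sym (negbTE ji) mulr0.
have fz i : tr (star z * f i) = 0.
  by rewrite -[f i]starK -starM tr_star zf rmorph0.
have [t t0 tE] := tr_star_mulP z.
have [t1|tn] := eqVneq t 0; first by have [_] := tr_star_mul z; apply; rewrite tE t1.
have tp : 0 < t by rewrite lt_neqAle eq_sym tn.
have sn : Num.sqrt t != 0 by rewrite gt_eqF// sqrtr_gt0.
pose z' : E := ((Num.sqrt t)^-1) *^ z.
suff : P k.+1 by move=> /kmax; rewrite ltnn.
apply/asboolP; exists (fun i => if unlift ord0 i is Some j then f j else z') => i j.
case: unliftP => [i'|] ->; case: unliftP => [j'|] ->.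
- by rewrite fo (inj_eq lift_inj).
- by rewrite /z' scAr trZ zf mulr0 eq_sym (negbTE (neq_lift _ _)).
- by rewrite /z' starZr scAl trZ fz mulr0 (negbTE (neq_lift _ _)).
- rewrite eqxx /z' starZr scAl scAr scalerA trZ tE -!rmorphM /=.
  have -> : (Num.sqrt t)^-1 * (Num.sqrt t)^-1 * t = 1; last by [].
  by rewrite -{3}(sqr_sqrtr t0); field.
Qed.

(** [U] and [D] hold the coordinates of [f] in [e] and of [e] in [f]. As [U D = 1], the trace of
    [rmx y = D M U] is that of [M]. *)
Lemma trace_onb k (f : 'I_k -> E) y :
  (forall i j, tr (star (f i) * f j) = (i == j)%:R) ->
  (forall y, y = \sum_i tr (star (f i) * y) *: f i) ->
  tr y = \sum_i tr (star (f i) * (f i * y)).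
Proof.
move=> fo fE.
pose M : 'M[C]_k := \matrix_(i, j) tr (star (f j) * (f i * y)).
pose U : 'M[C]_(k, N.+1) := \matrix_i co (f i).
pose D : 'M[C]_(N.+1, k) := \matrix_(i, j) tr (star (f j) * e i).
have vU (v : 'rV_k) : vec (v *m U) = \sum_i v 0 i *: f i.
  rewrite mulmx_sum_row; elim/big_rec2: _ => [|l a b _ <-]; first by rewrite vec0.
  by rewrite vecD vecZ rowK coK.
have UD : U *m D = 1%:M.
  apply/matrixP => i j; rewrite !mxE eq_sym -fo -{1}(coK (f i)) /vec.
  rewrite mulr_sumr tr_sum; apply: eq_bigr => l _.
  by rewrite !mxE scAr trZ.
have RE : rmx y = D *m M *m U.
  apply/row_matrixP => i; apply: vec_inj; rewrite !row_mul vU rowK coK.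
  rewrite [in LHS](fE (e i)) mulr_suml.
  transitivity (\sum_l \sum_j (D i l * M l j) *: f j).
    apply: eq_bigr => l _; rewrite scAl {1}(fE (f l * y)) scaler_sumr.
    by apply: eq_bigr => j _; rewrite scalerA !mxE.
  rewrite exchange_big; apply: eq_bigr => j _; rewrite -scaler_suml; congr (_ *: _).
  by rewrite mxE; apply: eq_bigr => l _; rewrite !mxE.
rewrite {1}/tr RE -mulmxA mxtrace_mulC -mulmxA UD mulmx1 /mxtrace.
by apply: eq_bigr => i _; rewrite mxE.
Qed.

(* With [c := \sum_j (f j)^* f j], [trace_onb] says [tr y = tr (c * y)] for all [y]. *)
Lemma casimir_onb : exists k (f : 'I_k -> E),
  (forall i j, tr (star (f i) * f j) = (i == j)%:R) /\
  (forall y, y = \sum_i tr (f i * y) *: star (f i)) /\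
  \sum_j star (f j) * f j = 1.
Proof.
have [k [f [fo fE]]] := onb_ex; exists k, f; split=> //; split=> [y|].
  rewrite -{1}[y]starK {1}(fE (star y)) star_sum; apply: eq_bigr => i _.
  by rewrite starZ -starM tr_star conjcK trM.
apply/eqP; rewrite -subr_eq0; apply/eqP; set c := _ - 1.
have h y : tr (c * y) = 0.
  rewrite /c mulrBl mul1r trB mulr_suml tr_sum (trace_onb y fo fE).
  by apply/eqP; rewrite subr_eq0; apply/eqP/eq_bigr => i _; rewrite mulrA.
have [_] := tr_star_mul c; apply; rewrite trM; exact: h.
Qed.

End FinDim.

(** With [e_j = (f_j)^*], the entries [X x i j = tr (e_i^* x e_j)] are those of the left regular
    representation in an orthonormal basis; the trace property keeps this basis orthonormal after
    taking adjoints. *)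
Lemma casimir (R : realType) (E : cstarType R) : finite_dimensional E ->
  exists k (e : 'I_k -> E) (X : E -> 'I_k -> 'I_k -> R[i]),
  [/\ forall x j, x * e j = \sum_i X x i j *: e i,
      forall x i j, X (star x) i j = conjc (X x j i),
      forall i j c x y, X (c *: x + y) i j = c * X x i j + X y i j,
      (forall x y i j, X (x * y) i j = \sum_l X x i l * X y l j) /\
      (forall i j, X 1 i j = (i == j)%:R)
    & \sum_j e j * star (e j) = 1].
Proof.
move=> /fd_basis[[|N] [e [span indep]]].
  have E0 (x : E) : x = 0 by have [c ->] := span x; rewrite big_ord0.
  exists 0%N, (fun=> 0), (fun _ _ _ => 0); split.
  - by move=> x [].
  - by move=> x [].
  - by case.
  - by split=> [x y []|[]].
  - by rewrite big_ord0 [RHS]E0.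
have [k [f [fo [fE f1]]]] := casimir_onb span indep.
exists k, (fun j => star (f j)), (fun x i j => tr span (f i * (x * star (f j)))); split.
- by move=> x j; rewrite {1}(fE (x * _)).
- by move=> x i j; rewrite -(tr_star span indep) !starM !starK mulrA.
- by move=> i j c x y; rewrite mulrDl mulrDr (trD span indep) scAl scAr (trZ span indep).
- split=> [x y i j|i j].
    rewrite -(mulrA x y) {1}(fE (y * _)) !mulr_sumr (tr_sum span indep); apply: eq_bigr => l _.
    by rewrite !scAr (trZ span indep) mulrC.
  by rewrite mul1r (trM span indep) fo eq_sym.
- by under eq_bigr do rewrite starK.
Qed.

(** * Order zero maps *)

Section OrderZero.
Variables (R : realType) (E A : cstarType R) (phi : E -> A).
Hypotheses (Efd : finite_dimensional E) (phil : linear phi) (phip : cpf phi).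
Hypotheses (phi0 : order_zero phi) (phi1 : nrm (phi 1) <= 1).

(* With [h = phi 1], [phi p * phi (1 - p) = 0] says that [phi p] commutes with [h] and
   [phi p ^+ 2 = h * phi p]. So the form [(a_i, b_i) |-> \sum_ij b_i^* phi (a_i^* a_j) b_j]
   vanishes at [(1, - phi p), (p, h)], which is then orthogonal to [(y, 1)]. *)
Lemma oz_proj (p y : E) : is_proj p -> phi p * phi y = phi 1 * phi (p * y).
Proof.
move=> pp; have [pS pp2] := pp; have [Pp Pq] := proj_pos pp.
have ps x : phi (star x) = star (phi x) by exact: cpf_star.
set h := phi 1; set P : A := phi p.
have hS : star h = h by rewrite /h -ps star1.
have PS : star P = P by rewrite /P -ps pS.
have Ph : P * h = P * P.
  have : phi p * phi (1 - p) = 0.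
    by apply: phi0; [exact/positiveP|exact/positiveP|rewrite mulrBr mulr1 pp2 subrr].
  by rewrite linfB// mulrBr => /eqP; rewrite subr_eq0 => /eqP.
have hP : h * P = P * P by have := congr1 (@star R A) Ph; rewrite !starM PS hS.
have Q0 : P * h * P - P * P * h - h * P * P + h * P * h = 0.
  have PPh : P * P * h = P * P * P by rewrite -mulrA Ph mulrA.
  by rewrite Ph PPh hP PPh; nc.
apply/eqP; rewrite -subr_eq0; apply/eqP/nrm_eq0/eqP.
rewrite -sqrf_eq0; apply/eqP/le_anti; rewrite sqr_ge0 andbT.
rewrite (_ : 0 = nrm (0 : A) * nrm (phi (star y * y))); last by rewrite nrm0 mul0r.
apply: Pcone_CS => [|b]; first exact: Pcone0.
pose a (i : 'I_3) := if i == 0 :> nat then 1 else if i == 1%N :> nat then p else y.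
pose c (i : 'I_3) := if i == 0 :> nat then - (P * b) else if i == 1%N :> nat then h * b else 1.
have spy : phi (star y * p) = star (phi (p * y)) by rewrite -ps starM pS.
have := phip a c.
rewrite !big_ord_recl !big_ord0 /a /c /= !addr0 !star1 !mul1r !mulr1 pS pp2 -/h -/P.
rewrite spy (ps y) !starN !starM hS PS.
set Y := phi (star y * y); set py := phi (p * y).
set fy := phi y.
have -> : Y - star b * (P * fy - h * py) - star (P * fy - h * py) * b + star b * 0 * b =
  star b * (P * h * P - P * P * h - h * P * P + h * P * h) * b +
  (Y - star b * (P * fy - h * py) - (star fy * P - star py * h) * b).
  by rewrite Q0 starB !starM hS PS; nc.
by move=> H; congr Pcone: H; nc.
Qed.

(** Both sides are linear in [x], and by [proj_span] the projections span. *)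
Lemma oz_mul x y : phi x * phi y = phi 1 * phi (x * y).
Proof.
have [N [e [span indep]]] := fd_basis Efd.
case: N e span indep => [|N] e span indep.
  have E0 (z : E) : z = 0 by have [c ->] := span z; rewrite big_ord0.
  by rewrite (E0 x) (E0 (0 * y)) linf0// mulr0 mul0r.
have [s [sp ->]] := proj_span span indep x.
elim: s sp => [|t s IH] sp; first by rewrite big_nil mul0r linf0// mul0r mulr0.
rewrite big_cons mulrDl scAl !(linfD _ _ phil) !(linfZ _ _ phil) mulrDl mulrDr scAl scAr oz_proj ?IH//.
  by move=> z zs; apply: sp; rewrite inE zs orbT.
by apply: sp; rewrite inE eqxx.
Qed.

(** With [h = phi 1], [v = (h + eta^2)^-1] and [r_j = v^(1/2) phi (e_j)], [oz_mul] gives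
    [r_i^* r_j = v h phi (e_i^* e_j)], and both sides of the intertwining relation equal
    [v h phi (e_i^* x e_j)]. By the Casimir identity the double sum is [v h phi x], close to
    [phi x]. *)
Lemma order_zero_rows (eta : R) : 0 < eta ->
  exists k (X : E -> 'I_k -> 'I_k -> R[i]) (r : 'I_k -> A),
  [/\ forall x i j, X (star x) i j = conjc (X x j i),
      forall i j c x y, X (c *: x + y) i j = c * X x i j + X y i j,
      (forall x y i j, X (x * y) i j = \sum_l X x i l * X y l j) /\
      (forall i j, X 1 i j = (i == j)%:R),
      forall x i j, \sum_l X x i l *: (star (r l) * r j) = \sum_l X x l j *: (star (r i) * r l)
    & (forall x, nrm (\sum_i \sum_j X x i j *: (r i * star (r j)) - phi x) <= eta * nrm x) /\
      nrm (\sum_j r j * star (r j)) <= 1].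
Proof.
move=> eta0; have [k [e [X [Xe XS Xl [XM X1] e1]]]] := casimir Efd.
have ps x : phi (star x) = star (phi x) by exact: cpf_star.
set h := phi 1; have Ph : Pcone h by exact/cpf_pos/Pcone1.
have d0 : 0 < eta ^+ 2 by rewrite exprn_gt0.
have [v [Pv vh hv hvc]] := Pcone_inv Ph d0.
have [Ps ss sc] := csqrtP Pv; set s := csqrt v in Ps ss sc.
have hphi x : phi x * h = h * phi x by rewrite oz_mul mulr1.
have vphi x : phi x * v = v * phi x by apply: hvc; exact: hphi.
have sphi x : phi x * s = s * phi x by apply: sc; exact: vphi.
have vhc : h * v = v * h by apply: hvc.
have hs : h * s = s * h by exact: sphi.
have K1 : v * h = 1 - (eta ^+ 2) *^ v by move: vh; rewrite mulrDr => <-; nc.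
have PK : Pcone (v * h) by exact: PconeM.
have Kn : nrm (v * h) <= 1.
  apply: Pcone_le_nrm => //; rewrite K1 (_ : _ - _ = (eta ^+ 2) *^ v); last by nc.
  by apply: PconeZ => //; exact: ltW.
have Vn : nrm ((eta ^+ 2) *^ v) <= 1.
  apply: Pcone_le_nrm => //; first by apply: PconeZ => //; exact: ltW.
  by rewrite (_ : _ - _ = v * h)// K1 scale1r.
pose r j := s * phi (e j).
have rr i j : star (r i) * r j = v * h * phi (star (e i) * e j).
  rewrite /r starM (Pcone_sa Ps) -ps -(mulrA v) -oz_mul -ss.
  by rewrite sphi -!mulrA; congr (_ * _); rewrite !mulrA sphi.
have rx x : \sum_i \sum_j X x i j *: (r i * star (r j)) = v * h * phi x.
  rewrite exchange_big /=; transitivity (\sum_j s * phi (x * e j) * (phi (star (e j)) * s)).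
    apply: eq_bigr => j _; rewrite Xe linf_sum// mulr_sumr mulr_suml; apply: eq_bigr => i _.
    by rewrite /r starM (Pcone_sa Ps) -ps linfZ// scAr scAl.
  transitivity (\sum_j v * h * phi (x * e j * star (e j))).
    apply: eq_bigr => j _.
    by rewrite sphi -(mulrA v) -oz_mul -ss !mulrA -(mulrA s _ s) sphi !mulrA.
  rewrite -mulr_sumr -linf_sum//; congr (_ * phi _).
  by rewrite -[RHS]mulr1 -e1 mulr_sumr; apply: eq_bigr => j _; rewrite mulrA.
exists k, X, r; split=> //.
  move=> x i j; transitivity (v * h * phi (star (e i) * x * e j)).
    transitivity (v * h * phi (\sum_l X x i l *: (star (e l) * e j))).
      by rewrite linf_sum// mulr_sumr; apply: eq_bigr => l _; rewrite rr linfZ// scAr.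
    congr (_ * phi _); rewrite -{2}[x]starK -starM (Xe (star x)) star_sum mulr_suml.
    by apply: eq_bigr => l _; rewrite starZ XS conjcK scAl.
  rewrite -(mulrA _ x) Xe mulr_sumr linf_sum// mulr_sumr; apply: eq_bigr => l _.
  by rewrite rr scAr linfZ// scAr.
split=> [x|].
  (* The square of the error is [eta^2] times [(eta^2 v) (v h) phi (x^* x)], where the first two
     factors have norm at most 1. Hence [eta^2] in the resolvent for an error [eta]. *)
  rewrite rx K1 (_ : _ - _ = - ((eta ^+ 2) *^ v * phi x)); last by nc.
  rewrite nrmN; apply: ler_sq; first by rewrite mulr_ge0// ?nrm_ge0// ltW.
  rewrite -nrm_starM starM starZr (Pcone_sa Pv) -ps.
  have -> : phi (star x) * ((eta ^+ 2) *^ v) * ((eta ^+ 2) *^ v * phi x) =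
     (eta ^+ 2) *^ (((eta ^+ 2) *^ v) * ((v * h) * phi (star x * x))).
    rewrite -(mulrA v) -oz_mul !(mulrA v) -vphi.
    by rewrite !(scAl, scAr) !scalerA !mulrA vphi; nc.
  rewrite nrmZr ger0_norm ?sqr_ge0// exprMn ler_wpM2l ?sqr_ge0//.
  apply: le_trans (nrmM _ _) _; rewrite -[leRHS]mul1r.
  apply: ler_pM => //; rewrite ?nrm_ge0//.
  apply: le_trans (nrmM _ _) _; rewrite -[leRHS]mul1r.
  by apply: ler_pM => //; rewrite ?nrm_ge0//; exact: cp_le_sq.
have -> : \sum_j r j * star (r j) = v * h * phi 1.
  rewrite -rx; apply: eq_bigr => i _; rewrite (bigD1 i)//= big1 ?addr0 ?X1 ?eqxx ?scale1r//.
  by move=> j ji; rewrite X1 eq_sym (negbTE ji) scale0r.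
by apply: le_trans (nrmM _ _) _; rewrite -[leRHS]mul1r; apply: ler_pM; rewrite ?nrm_ge0.
Qed.

End OrderZero.

(** * Compressed representations, row operators and amplifications *)

Section Dilation.
Variables (R : realType) (J : finType).
Implicit Types E B : cstarType R.

Lemma mult_star_nrm E B (f : E -> B) : linear f ->
  (forall x y, f (x * y) = f x * f y) -> (forall x, f (star x) = star (f x)) ->
  forall x, nrm (f x) <= nrm x.
Proof.
move=> fl fM fS; apply: cp_contractive => //; first exact: mult_star_cpf.
have fS1 : star (f 1) = f 1 by rewrite -fS star1.
have := nrm_sa fS1; rewrite -fM mulr1 expr2 => h.
have := nrm_ge0 (f 1); nra.
Qed.

Lemma ent_sum B (K : Type) (s : seq K) (F : K -> bopc J B) i j :
  ent (\sum_(k <- s) F k) i j = \sum_(k <- s) ent (F k) i j.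
Proof.
apply: (big_morph (fun T => ent T i j)) => [S T|]; first exact: entD.
by rewrite -(scale0r (0 : bopc J B)) entZ scale0r.
Qed.

Variables (E B : cstarType R) (rho : E -> bopc J B) (z : bopc J B) (i0 : J).
Hypotheses (rl : linear rho) (rM : forall x y, rho (x * y) = rho x * rho y).
Hypothesis rS : forall x, rho (star x) = star (rho x).

Definition dilate (y : E) : B := ent (z * rho y * star z) i0 i0.

Lemma dilate_linear : linear dilate.
Proof. by move=> c x y; rewrite /dilate rl mulrDr mulrDl scAr scAl entD entZ. Qed.

Lemma dilate_cpf : cpf dilate.
Proof.
move=> J' a b; pose X := \sum_j ev (rho (a j) * star z) (hdelta i0 (b j)).
rewrite (_ : \sum_j _ = ip X X); first exact: ip_ge0.
rewrite /X ip_suml; apply: eq_bigr => j _; rewrite ip_sumr; apply: eq_bigr => k _.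
rewrite ev_star -evM starM starK -rS !mulrA -(mulrA z) -rM ip_delta.
by rewrite [hdelta i0 (b k)]hdelta_mulr evxMr hm_mulrE mulrA.
Qed.

Lemma dilate_nrm y : nrm z <= 1 -> nrm (dilate y) <= nrm y.
Proof.
move=> z1; apply: le_trans (ent_nrm _ _ _) _.
rewrite -[leRHS]mulr1 -[X in X * 1]mul1r; apply: nrmM_le; last by rewrite nrm_star.
by apply: nrmM_le => //; exact: mult_star_nrm.
Qed.

(** As [z] has a single nonzero row, the product of two entries is the entry of the product;
    commuting [z^* z] past [rho x] brings [rho x] and [rho y] together, and their product is
    [rho 0]. *)
Lemma dilate_order_zero : (forall y, rho y * (star z * z) = star z * z * rho y) ->
  (forall i j, i != i0 -> ent z i j = 0) -> order_zero dilate.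
Proof.
move=> zc zr x y _ _ xy.
transitivity (ent (z * rho x * star z * (z * rho y * star z)) i0 i0).
  rewrite entM (bigD1 i0)// big1 => [|k ki]; first by rewrite /= addr0.
  rewrite -(mulrA z (rho y)) [ent (z * (_ * _)) k i0]entM big1 ?mulr0// => l _.
  by rewrite zr// mul0r.
have -> : z * rho x * star z * (z * rho y * star z) =
    z * (star z * z) * (rho x * rho y) * star z.
  transitivity (z * (rho x * (star z * z)) * rho y * star z); first by rewrite !mulrA.
  by rewrite zc !mulrA.
rewrite -rM xy linf0// mulr0 mul0r.
by rewrite -(scale0r (0 : bopc J B)) entZ scale0r.
Qed.

End Dilation.

Lemma sum_option (V : nmodType) (T : finType) (F : option T -> V) :
  \sum_a F a = F None + \sum_t F (Some t).
Proof.
rewrite (bigD1 None)//=; congr (_ + _).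
rewrite (reindex_omap Some id) => [|[]//].
by apply: eq_bigl => t; rewrite eqxx.
Qed.

Section RowOp.
Variables (R : realType) (T : finType) (B : cstarType R).

(** A row stored in a square matrix, because [polar_perturb] works inside one algebra. *)
Definition rowop (w : option T -> B) : bopc (option T) B :=
  mxop (fun a b => if a is None then w b else 0).

Lemma ent_rowop w a b : ent (rowop w) a b = if a is None then w b else 0.
Proof. exact: ent_mxop. Qed.

Lemma rowop_gram w a b : ent (star (rowop w) * rowop w) a b = star (w a) * w b.
Proof.
rewrite entM sum_option big1 => [|t _]; first by rewrite addr0 ent_star !ent_rowop.
by rewrite [ent (rowop w) _ _]ent_rowop mulr0.
Qed.

Lemma rowop_conj w (X : bopc (option T) B) :
  ent (rowop w * X * star (rowop w)) None None =
  \sum_a \sum_b w a * ent X a b * star (w b).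
Proof.
rewrite entM exchange_big; apply: eq_bigr => b _ /=.
rewrite entM ent_star ent_rowop mulr_suml; apply: eq_bigr => a _.
by rewrite ent_rowop.
Qed.

Lemma rowop_nrm w : nrm (rowop w) ^+ 2 <= nrm (\sum_a w a * star (w a)).
Proof.
rewrite -nrm_star -nrm_starM starK; apply: le_trans (nrm_mx_le _) _.
have h a b : ent (rowop w * star (rowop w)) a b =
    if (a, b) is (None, None) then \sum_a w a * star (w a) else 0.
  rewrite entM; case: a => [s|].
    by rewrite big1// => t _; rewrite ent_rowop mul0r.
  case: b => [s|]; last by apply: eq_bigr => t _; rewrite ent_star !ent_rowop.
  by rewrite big1// => t _; rewrite ent_star [ent _ (Some s) _]ent_rowop star0 mulr0.
rewrite sum_option [X in _ + X]big1 => [|t _].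
  rewrite addr0 sum_option h [X in _ + X]big1 ?addr0// => t _.
  by rewrite h nrm0.
by rewrite big1// => b _; rewrite h nrm0.
Qed.

End RowOp.

Section Amplify.
Variables (R : realType) (E B : cstarType R) (q k : nat) (X : E -> 'I_k -> 'I_k -> R[i]).
Hypothesis XS : forall x i j, X (star x) i j = conjc (X x j i).
Hypothesis Xl : forall i j c x y, X (c *: x + y) i j = c * X x i j + X y i j.
Hypothesis XM : forall x y i j, X (x * y) i j = \sum_l X x i l * X y l j.

(* The index [None] leaves room for the single nonzero row of the operators [rowop w]. *)
Definition ampl (Y : bopc 'I_q E) : bopc (option ('I_q * 'I_k)%type) B :=
  mxop (fun a b => match a, b with
    Some s, Some t => X (ent Y s.1 t.1) s.2 t.2 *: (1 : B) | _, _ => 0 end).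

Lemma ent_ampl Y a b : ent (ampl Y) a b = match a, b with
    Some s, Some t => X (ent Y s.1 t.1) s.2 t.2 *: (1 : B) | _, _ => 0 end.
Proof. exact: ent_mxop. Qed.

Lemma ampl_linear : linear ampl.
Proof.
move=> c Y Z; apply: ent_ext => a b; rewrite entD entZ !ent_ampl.
case: a => [s|]; last by rewrite scaler0 addr0.
case: b => [t|]; last by rewrite scaler0 addr0.
by rewrite entD entZ Xl scalerDl scalerA.
Qed.

Lemma ampl_star Y : ampl (star Y) = star (ampl Y).
Proof.
apply: ent_ext => a b; rewrite ent_star !ent_ampl.
case: a b => [s|] [t|]; rewrite ?star0//.
by rewrite ent_star XS starZ star1.
Qed.

Lemma amplM Y Z : ampl (Y * Z) = ampl Y * ampl Z.
Proof.
have Xsum (F : 'I_q -> E) i j : X (\sum_p F p) i j = \sum_p X (F p) i j.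
  apply: (big_morph (fun x => X x i j)) => [x y|].
    by rewrite -[x + y](congr1 (fun a => a + y) (scale1r x)) Xl mul1r.
  by have := Xl i j (-1) 0 0; rewrite scaler0 addr0 mulN1r addNr.
apply: ent_ext => a b; rewrite entM sum_option.
rewrite (_ : ent (ampl Y) a None = 0) ?mul0r ?add0r; last by rewrite ent_ampl; case: a.
case: a => [[p i]|]; last by rewrite ent_ampl big1// => t _; rewrite ent_ampl mul0r.
case: b => [[p' j]|]; last first.
  by rewrite ent_ampl big1// => t _; rewrite [W in _ * W]ent_ampl mulr0.
rewrite ent_ampl entM Xsum scaler_suml /=.
under eq_bigr do rewrite XM scaler_suml.
rewrite pair_bigA /=; apply: eq_bigr => -[l m] _ /=.
by rewrite !ent_ampl scAl scAr mulr1 scalerA.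
Qed.

End Amplify.

(** Replacing [s] by its root in one factor takes the square root of the bound, by [nrm_mul_sqrt].
    There are two factors, hence [e ^+ 4]. *)
Lemma csqrt_orth (R : realType) (A : cstarType R) (f : A -> A) (s : A) (e : R) :
  star_hom f -> Pcone s -> nrm s <= 1 -> 0 <= e -> nrm (s * f s) <= e ^+ 4 ->
  nrm (csqrt s * f (csqrt s)) <= e.
Proof.
move=> fH Ps s1 e0 h; have [Pg gg _] := csqrtP Ps; have g1 := csqrt_nrm1 Ps s1.
set g := csqrt s in Pg gg g1 *; have [_ [_ fM] fS] := fH.
have fgS : star (f g) = f g by rewrite -fS (Pcone_sa Pg).
have fgg : f g * f g = f s by rewrite -fM gg.
have fs1 : nrm (f s) <= 1 by apply: le_trans (star_hom_nrm _ fH) s1.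
have fsS : star (f s) = f s by rewrite -fS (Pcone_sa Ps).
have h1 : nrm (f s * g) <= e ^+ 2.
  apply: ler_sq; first exact: sqr_ge0.
  rewrite (nrm_mul_sqrt _ (Pcone_sa Pg) gg) fsS -exprM -[leRHS]mulr1.
  apply: nrmM_le => //; rewrite -nrm_star starM fsS (Pcone_sa Ps); exact: h.
apply: ler_sq => //; rewrite (nrm_mul_sqrt _ fgS fgg) (Pcone_sa Pg) -[leRHS]mul1r -mulrA.
exact: nrmM_le.
Qed.

Lemma double_sum_le (R : realType) (T : finType) (F : T -> T -> R) (d : R) : (0 < #|T|)%N ->
  (forall a b, F a b <= d / #|T|%:R / #|T|%:R) -> \sum_a \sum_b F a b <= d.
Proof.
move=> T0 h; have N0 : 0 < #|T|%:R :> R by rewrite ltr0n.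
apply: (@le_trans _ _ (\sum_(a : T) \sum_(b : T) d / #|T|%:R / #|T|%:R)).
  by apply: ler_sum => a _; apply: ler_sum.
rewrite !sumr_const -mulrnA -[d / _ / _ *+ _]mulr_natr natrM le_eqVlt; apply/orP; left; apply/eqP.
by field; rewrite gt_eqF.
Qed.

(** * The row attached to a tower, and its Gram matrix *)

Section Tower.
Variables (R : realType) (A B : cstarType R) (alpha : A -> A) (iota : A -> B) (u : B).
Hypotheses (alphaH : star_hom alpha) (cov : covariant alpha iota u).

Variables (k : nat) (r : 'I_k -> A) (s : A) (q : nat).
Hypotheses (Ps : Pcone s) (s1 : nrm s <= 1).
Local Notation g := (csqrt s).

(* For a tower [s, alpha s, ..], the Gram matrix of the row [tow] is close to [tgram], which
   commutes with the image of [ampl]; [polar_perturb] then makes the row exactly compatible. *)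
Definition tow (t : option ('I_q * 'I_k)) : B :=
  if t is Some t then u ^+ t.1 * iota (g * r t.2) else 0.

Definition tgram : bopc (option ('I_q * 'I_k)%type) B :=
  mxop (fun a b => match a, b with Some a, Some b =>
    if a.1 == b.1 then iota (g * (star (r a.2) * r b.2) * g) else 0 | _, _ => 0 end).

Lemma gS : star g = g. Proof. by have [/Pcone_sa] := csqrtP Ps. Qed.
Lemma gg : g * g = s. Proof. by have [] := csqrtP Ps. Qed.
Lemma g1 : nrm g <= 1. Proof. exact: csqrt_nrm1. Qed.

(** [tgram] is the sum over the levels [p] of the Gram matrices of the rows [iota (r_j g)] supported
    on level [p]. *)
Lemma tgram_pos : Pcone tgram.
Proof.
pose w p (t : option ('I_q * 'I_k)) : B :=
  if t is Some t then if p == t.1 then iota (r t.2 * g) else 0 else 0.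
have -> : tgram = \sum_p star (rowop (w p)) * rowop (w p).
  apply: ent_ext => a b; rewrite ent_sum ent_mxop.
  under eq_bigr do rewrite rowop_gram.
  case: a => [[p i]|]; last by rewrite big1// => p _; rewrite star0 mul0r.
  case: b => [[p' j]|]; last by rewrite big1// => l _; rewrite mulr0.
  rewrite (bigD1 p)// big1 => [|l /negbTE lp]; last by rewrite /= lp star0 mul0r.
  rewrite /= eqxx addr0; case: eqP => _; last by rewrite mulr0.
  by rewrite -(iotaS cov) -(iotaM cov) starM gS !mulrA.
by apply: Pcone_sum => p _; exact: Pcone_star_mul.
Qed.

(** The row times its adjoint is the sum of the [alpha^p (g S g)] with [S = \sum_j r_j r_j^*], and
    [S <= 1] bounds it by the sum of the [alpha^p s]. *)
Lemma tow_nrm : nrm (\sum_j r j * star (r j)) <= 1 ->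
  nrm (\sum_(p < q) iter p alpha s) <= 1 -> nrm (rowop tow) <= 1.
Proof.
move=> r1 S1; apply: ler_sq => //; apply: le_trans (rowop_nrm _) _.
rewrite expr1n sum_option /= mul0r add0r.
have itH p := star_hom_iter p alphaH.
have tE (p : 'I_q) : \sum_j tow (Some (p, j)) * star (tow (Some (p, j))) =
    iota (iter p alpha (g * (\sum_j r j * star (r j)) * g)).
  rewrite -[RHS]mulr1 -(mulX_starX cov p) mulrA -(covX cov) mulr_sumr mulr_suml (linf_sum _ _ _ (iotal cov)).
  rewrite mulr_sumr mulr_suml; apply: eq_bigr => j _ /=.
  by rewrite starM -(iotaS cov) starM gS !(iotaM cov) !mulrA.
have -> : \sum_t tow (Some t) * star (tow (Some t)) =
    iota (\sum_(p < q) iter p alpha (g * (\sum_j r j * star (r j)) * g)).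
  rewrite (linf_sum _ _ _ (iotal cov)); under [RHS]eq_bigr do rewrite -tE.
  by rewrite pair_bigA; apply: eq_bigr => -[].
apply: le_trans (iota_nrm cov _) _; apply: le_trans S1.
set S := \sum_j _ in r1 *.
have PS : Pcone S by apply: Pcone_sum => j _; rewrite -{1}[r j]starK; exact: Pcone_star_mul.
have Pit p a : Pcone a -> Pcone (iter p alpha a).
  by apply: cpf_pos; exact: star_hom_cpf.
apply: Pcone_lenrm.
  by apply: Pcone_sum => p _; apply: Pit; rewrite -{1}gS; exact: Pcone_conj.
rewrite -sumrB; apply: Pcone_sum => p _.
rewrite -linfB; last by case: (itH p).
apply: Pit; rewrite -{1}gg -{1}(mulr1 g) -{1 3}gS; apply: Pcone_conj_le.
by have := Pcone_sub_nrm (Pcone_sa PS) r1; rewrite scale1r.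
Qed.

Lemma tow_off (e C : R) i j p p' : (forall j, nrm (r j) <= C) ->
  (forall n, (0 < n < q)%N -> nrm (g * iter n alpha g) <= e) -> (p < p' < q)%N ->
  nrm (star (u ^+ p * iota (g * r i)) * (u ^+ p' * iota (g * r j))) <= C * C * e.
Proof.
move=> rC orth /andP[pp pq].
have -> : star (u ^+ p * iota (g * r i)) * (u ^+ p' * iota (g * r j)) =
    iota (star (r i)) * iota (g * iter (p' - p) alpha g) * u ^+ (p' - p) * iota (r j).
  rewrite starM -(iotaS cov) starM gS mulrA -(mulrA _ (star (u ^+ p))) (starX_X cov); last exact: ltnW.
  by rewrite !(iotaM cov) -!mulrA (mulrA (u ^+ _)) (covX cov) !mulrA.
have C0 : 0 <= C by apply: le_trans (rC i); exact: nrm_ge0.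
rewrite (_ : C * C * e = C * e * 1 * C); last by ring.
apply: nrmM_le; last exact: le_trans (iota_nrm cov _) _.
apply: nrmM_le; last exact: (u_nrm cov).
apply: nrmM_le; first by apply: le_trans (iota_nrm cov _) _; rewrite nrm_star.
apply: le_trans (iota_nrm cov _) (orth _ _).
by rewrite subn_gt0 pp /= (leq_ltn_trans (leq_subr _ _)).
Qed.

(** On one level, moving both factors [g] outwards costs two commutators, [2 C e]; across levels
    [tow_off] leaves the product of [g] and a translate of it, [C C e]. *)
Lemma tow_gram_close (e C : R) : 0 <= e -> 0 <= C -> (forall j, nrm (r j) <= C) ->
  (forall n, (0 < n < q)%N -> nrm (g * iter n alpha g) <= e) ->
  (forall j, nrm (g * r j - r j * g) <= e) ->
  forall a b, nrm (star (tow a) * tow b - ent tgram a b) <= 2 * C * e + C * C * e.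
Proof.
move=> e0 C0 rC orth comm a b.
have Ce : 0 <= C * e by exact: mulr_ge0.
have CCe : 0 <= C * C * e by rewrite -mulrA mulr_ge0.
have D0 : 0 <= 2 * C * e + C * C * e by nra.
rewrite ent_mxop.
case: a => [[p i]|]; last by rewrite star0 mul0r subrr nrm0.
case: b => [[p' j]|]; last by rewrite mulr0 subrr nrm0.
rewrite /tow /=; case: (eqVneq p p') => [<-|pp].
  have -> : star (u ^+ p * iota (g * r i)) * (u ^+ p * iota (g * r j)) =
      iota (star (r i) * g * (g * r j)).
    rewrite starM -(iotaS cov) starM gS mulrA -(mulrA _ (star (u ^+ p))) (starX_X cov)//.
    by rewrite subnn expr0 mulr1 -(iotaM cov).
  rewrite -(linfB _ _ (iotal cov)); apply: le_trans (iota_nrm cov _) _.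
  have -> : star (r i) * g * (g * r j) - g * (star (r i) * r j) * g =
    star (r i) * g * (g * r j - r j * g) + star (g * r i - r i * g) * (r j * g).
    by rewrite starB !starM gS; nc.
  apply: le_trans (nrmD _ _) _.
  have h1 : nrm (star (r i) * g * (g * r j - r j * g)) <= C * 1 * e.
    by apply: nrmM_le => //; apply: nrmM_le; [rewrite nrm_star|exact: g1].
  have h2 : nrm (star (g * r i - r i * g) * (r j * g)) <= e * (C * 1).
    by apply: nrmM_le; [rewrite nrm_star|apply: nrmM_le; [|exact: g1]].
  lra.
rewrite subr0.
suff : nrm (star (u ^+ p * iota (g * r i)) * (u ^+ p' * iota (g * r j))) <= C * C * e by lra.
have [lt|lt|/val_inj pe] := ltngtP p p'; last by rewrite pe eqxx in pp.
  by apply: tow_off => //; rewrite lt ltn_ord.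
by rewrite -nrm_star starM starK; apply: tow_off => //; rewrite lt ltn_ord.
Qed.

Variables (E : cstarType R) (X : E -> 'I_k -> 'I_k -> R[i]).
Hypothesis Xc : forall x i j,
  \sum_l X x i l *: (star (r l) * r j) = \sum_l X x l j *: (star (r i) * r l).

(** [tgram] repeats a single block along the diagonal, and by [Xc] this block commutes with the
    scalar matrices [X x]. *)
Lemma ampl_tgram (Y : bopc 'I_q E) : ampl B X Y * tgram = tgram * ampl B X Y.
Proof.
apply: ent_ext => a b; rewrite !entM !sum_option !ent_ampl !ent_mxop.
case: a => [[p i]|]; last first.
  rewrite !mul0r !add0r !big1// => t _.
    by rewrite ent_mxop mul0r.
  by rewrite ent_ampl mul0r.
case: b => [[p' j]|]; last first.
  rewrite !mulr0 !add0r !big1// => t _.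
    by rewrite ent_ampl mulr0.
  by rewrite [ent tgram _ _]ent_mxop mulr0.
rewrite !mul0r !add0r.
have fl : linear (fun x : A => iota (g * x * g)).
  by move=> c x y; rewrite mulrDr mulrDl scAr scAl (iotal cov).
transitivity (\sum_l X (ent Y p p') i l *: iota (g * (star (r l) * r j) * g)).
  transitivity (\sum_p'' \sum_l (X (ent Y p p'') i l *: (1 : B)) *
      (if p'' == p' then iota (g * (star (r l) * r j) * g) else 0)).
    by rewrite pair_bigA; apply: eq_bigr => -[p'' l] _; rewrite ent_ampl ent_mxop.
  rewrite (bigD1 p')//= [W in _ + W]big1 ?addr0 => [|p'' /negbTE pp]; last first.
    by rewrite big1// => l _; rewrite pp mulr0.
  by apply: eq_bigr => l _; rewrite eqxx scAl mul1r.
transitivity (\sum_l X (ent Y p p') l j *: iota (g * (star (r i) * r l) * g)); last first.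
  transitivity (\sum_p'' \sum_l (if p == p'' then iota (g * (star (r i) * r l) * g) else 0) *
      (X (ent Y p'' p') l j *: (1 : B))).
    rewrite (bigD1 p)//= [W in _ + W]big1 ?addr0 => [|p'' /negbTE pp]; last first.
      by rewrite big1// => l _; rewrite eq_sym pp mul0r.
    by apply: eq_bigr => l _; rewrite eqxx scAr mulr1.
  by rewrite pair_bigA; apply: eq_bigr => -[p'' l] _; rewrite ent_ampl ent_mxop.
have /(congr1 (fun x => iota (g * x * g))) := Xc (ent Y p p') i j.
rewrite !(linf_sum _ _ _ fl) => h.
transitivity (\sum_l iota (g * (X (ent Y p p') i l *: (star (r l) * r j)) * g)).
  by apply: eq_bigr => l _; rewrite (linfZ _ _ fl).
by rewrite h; apply: eq_bigr => l _; rewrite (linfZ _ _ fl).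
Qed.

Lemma tow_conj (Y : bopc 'I_q E) :
  ent (rowop tow * ampl B X Y * star (rowop tow)) None None =
  \sum_p \sum_p' u ^+ nat_of_ord p *
    iota (g * (\sum_i \sum_j X (ent Y p p') i j *: (r i * star (r j))) * g) *
    star (u ^+ nat_of_ord p').
Proof.
rewrite rowop_conj sum_option big1 => [|b _]; last by rewrite !mul0r.
rewrite add0r.
transitivity (\sum_p \sum_i \sum_p' \sum_j u ^+ nat_of_ord p * iota (g * r i) *
   (X (ent Y p p') i j *: (1 : B)) * star (u ^+ nat_of_ord p' * iota (g * r j))).
  rewrite [RHS]pair_bigA; apply: eq_bigr => -[p i] _ /=.
  rewrite sum_option star0 mulr0 add0r pair_bigA; apply: eq_bigr => -[p' j] _ /=.
  by rewrite ent_ampl.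
apply: eq_bigr => p _; rewrite exchange_big; apply: eq_bigr => p' _ /=.
have fl : linear (fun x : A => u ^+ nat_of_ord p * iota (g * x * g) * star (u ^+ nat_of_ord p')).
  by move=> c x y; rewrite mulrDr mulrDl scAr scAl (iotal cov) mulrDr mulrDl scAr scAl.
rewrite (linf_sum _ _ _ fl); apply: eq_bigr => i _; rewrite (linf_sum _ _ _ fl).
apply: eq_bigr => j _; rewrite (linfZ _ _ fl) scAr scAl mulr1; congr (_ *: _).
by rewrite starM -(iotaS cov) starM gS !(iotaM cov) !mulrA.
Qed.

End Tower.

Section OrderZeroTower.
Variables (R : realType) (A B : cstarType R) (alpha : A -> A) (iota : A -> B) (u : B).
Hypotheses (alphaH : star_hom alpha) (cov : covariant alpha iota u).
Variables (E : cstarType R) (phi : E -> A).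
Hypotheses (Efd : finite_dimensional E) (phil : linear phi) (phip : cpf phi).
Hypotheses (phi0 : order_zero phi) (phi1 : nrm (phi 1) <= 1).

(** [d] and [F] are fixed before [s], so that a tower of the required accuracy can be asked for
    afterwards. [F] holds the row entries, which [csqrt s] must almost commute with. *)
Lemma order_zero_tower (q : nat) (eta : R) : 0 < eta ->
  exists (d : R) (F : seq A), 0 < d /\ forall s : A, Pcone s -> nrm s <= 1 ->
    nrm (\sum_(p < q) iter p alpha s) <= 1 ->
    (forall n, (0 < n < q)%N -> nrm (s * iter n alpha s) <= d) ->
    (forall a, a \in F -> nrm (s * a - a * s) <= d) ->
    exists Phi : bopc 'I_q E -> B,
    [/\ linear Phi, cpf Phi, order_zero Phi, nrm (Phi 1) <= 1
      & forall Y, nrm (Phi Y - \sum_p \sum_p'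
          u ^+ nat_of_ord p * iota (csqrt s * phi (ent Y p p') * csqrt s) * star (u ^+ nat_of_ord p'))
        <= eta * nrm Y].
Proof.
(* [phi] enters at [q^2] entries, each with an error of order [eta / 2 / Q]; the added 1 keeps [Q]
   positive when [q = 0]. *)
move=> eta0; pose Q : R := q%:R * q%:R + 1.
have Q0 : 0 < Q by rewrite /Q; have : 0 <= q%:R :> R by []; nra.
have e10 : 0 < eta / 2 / Q by rewrite !divr_gt0.
have [k [X [r [XS Xl [XM _] Xc [XP r1]]]]] := order_zero_rows Efd phil phip phi0 phi1 e10.
have e20 : 0 < eta / 4 by rewrite divr_gt0.
have [dp dp0 polar] := polar_perturb e20.
pose N : R := #|{: option ('I_q * 'I_k)}|%:R.
have N0 : 0 < N by rewrite ltr0n card_option.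
pose C : R := 1 + \sum_j nrm (r j).
have C1 : 1 <= C by rewrite lerDl; apply: sumr_ge0 => j _; exact: nrm_ge0.
have rC j : nrm (r j) <= C.
  rewrite /C (bigD1 j)//= addrCA lerDl addr_ge0//.
  by apply: sumr_ge0 => i _; exact: nrm_ge0.
(* Makes the [N^2] entrywise errors of [tow_gram_close] add up to the tolerance [dp] of the polar
   perturbation. *)
pose e := dp / N / N / (2 * C + C * C).
have D0 : 0 < 2 * C + C * C by nra.
have e0 : 0 < e by rewrite !divr_gt0.
have C0 : 0 <= C by lra.
have [d1 d10 hd1] := csqrt_comm_unif e0 C0.
exists (Num.min d1 (e ^+ 4)), [seq r j | j <- enum 'I_k]; split.
  by rewrite lt_min d10 exprn_gt0.
move=> s Ps s1 S1 orth comm; set g := csqrt s.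
have close := @tow_gram_close _ _ _ _ _ _ cov _ r s q Ps s1 e C (ltW e0) C0 rC.
set x0 : bopc (option ('I_q * 'I_k)%type) B := rowop (tow iota u r s (q:=q)).
have x01 : nrm x0 <= 1 by exact: (tow_nrm alphaH cov).
have entB (S T : bopc (option ('I_q * 'I_k)%type) B) a b : ent (S - T) a b = ent S a b - ent T a b.
  by rewrite -scaleN1r entD entZ scaleN1r.
have [z [zx z1 zc zr]] : exists z, [/\ nrm (z - x0) <= eta / 4, nrm z <= 1,
    commutant (tgram iota r s q) (star z * z) & forall c, c * x0 = x0 -> c * z = z].
  apply: polar => //; first exact: (tgram_pos cov).
  apply: le_trans (nrm_mx_le _) _.
  have eE : 2 * C * e + C * C * e = dp / N / N by rewrite -mulrDl /e mulrC divfK ?gt_eqF.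
  apply: double_sum_le => [|a b]; first by rewrite card_option.
  rewrite -/N -eE entB rowop_gram; apply: close.
  - move=> n nq; apply: csqrt_orth => //; [exact: star_hom_iter|exact: ltW|].
    by apply: le_trans (orth n nq) _; rewrite ge_min lexx orbT.
  - move=> j; apply: hd1 => //; apply: le_trans (comm _ (map_f _ (mem_enum _ j))) _.
    by rewrite ge_min lexx.
(* The projection [c] onto the index [None] fixes [x0] from the left, hence also [z] by the last
   clause of [polar_perturb]: [z] is again a row. *)
have zr0 i j : i != None -> ent z i j = 0.
  move=> i0; pose c : bopc (option ('I_q * 'I_k)%type) B :=
    mxop (fun a b => if (a, b) is (None, None) then 1 else 0).
  have cE (W : bopc (option ('I_q * 'I_k)%type) B) a b : ent (c * W) a b = if a is None then ent W None b else 0.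
    rewrite entM sum_option [V in _ + V]big1 => [|t _].
      by rewrite addr0 ent_mxop; case: a => [t|]; rewrite ?mul0r ?mul1r.
    by rewrite ent_mxop; case: a => [t'|]; rewrite mul0r.
  have <- : c * z = z.
    by apply: zr; apply: ent_ext => a b; rewrite cE !ent_rowop; case: a.
  by rewrite cE; case: i i0.
have al := ampl_linear B (q := q) Xl; have aM := amplM B (q := q) Xl XM.
have aS := ampl_star B (q := q) XS.
exists (dilate (ampl B X (q := q)) z None); split.
- exact: dilate_linear.
- exact: dilate_cpf.
- apply: dilate_order_zero; [exact: al|exact: aM| |exact: zr0].
  by move=> Y; apply: zc; apply: (ampl_tgram cov).
- by apply: le_trans (dilate_nrm None al aM aS 1 z1) _; exact: nrm1_le.
move=> Y; set S := \sum_p _.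
set T := ent (x0 * ampl B X Y * star x0) None None.
have an : nrm (ampl B X Y) <= nrm Y by apply: mult_star_nrm.
have h1 : nrm (dilate (ampl B X (q := q)) z None Y - T) <= eta / 2 * nrm Y.
  rewrite /dilate /T -entB; apply: le_trans (ent_nrm _ _ _) _.
  have -> : z * ampl B X Y * star z - x0 * ampl B X Y * star x0 =
    (z - x0) * ampl B X Y * star z + x0 * ampl B X Y * star (z - x0) by rewrite starB; nc.
  apply: le_trans (nrmD _ _) _.
  have -> : eta / 2 * nrm Y = eta / 4 * nrm Y * 1 + 1 * nrm Y * (eta / 4) by field.
  by apply: lerD; apply: nrmM_le; rewrite ?nrm_star//; apply: nrmM_le.
have h2 : nrm (T - S) <= eta / 2 * nrm Y.
  rewrite /T /x0 (tow_conj cov r Ps X Y) -/g /S -sumrB; apply: le_trans (nrm_sum _ _ _) _.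
  have K0 : 0 <= eta / 2 / Q * nrm Y by rewrite mulr_ge0 ?nrm_ge0 ?ltW.
  apply: (@le_trans _ _ (\sum_(p < q) \sum_(p' < q) (eta / 2 / Q * nrm Y))); last first.
    rewrite !sumr_const card_ord -mulrnA -[_ * nrm Y *+ _]mulr_natl natrM.
    have -> : eta / 2 * nrm Y = Q * (eta / 2 / Q * nrm Y) by field; rewrite gt_eqF.
    by apply: ler_wpM2r => //; rewrite /Q lerDl.
  apply: ler_sum => p _; rewrite -sumrB; apply: le_trans (nrm_sum _ _ _) _.
  apply: ler_sum => p' _; rewrite -mulrBl -mulrBr -(linfB _ _ (iotal cov)) -mulrBl -mulrBr.
  have g1' : nrm g <= 1 by exact: g1.
  rewrite -[leRHS]mulr1; apply: nrmM_le; last by rewrite nrm_star; exact: (u_nrm cov).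
  rewrite -[leRHS]mul1r; apply: nrmM_le; first exact: (u_nrm cov).
  apply: le_trans (iota_nrm cov _) _.
  rewrite -[leRHS]mulr1; apply: nrmM_le => //.
  rewrite -[leRHS]mul1r; apply: nrmM_le => //.
  apply: le_trans (XP _) _; apply: ler_wpM2l; first exact: ltW.
  exact: ent_nrm.
have := nrm_tri (dilate (ampl B X (q := q)) z None Y) T S; lra.
Qed.

End OrderZeroTower.

Ltac nlia := repeat match goal with H : ?T |- _ =>
  lazymatch T with nat => fail | is_true (leq _ _) => fail | _ => clear H end end; lia.

(** * Rokhlin towers *)

Section Chain.
Variables (R : realType) (A : cstarType R) (alpha : A -> A).
Hypothesis alphaH : star_hom alpha.

Lemma star_homZ (f : A -> A) (t : R) x : star_hom f -> f (t *^ x) = t *^ f x.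
Proof. by move=> [fl _ _]; exact: linfZ. Qed.

(** An approximate chain becomes an exact orbit by keeping its first element and scaling it down.
    The factor [3 (h + 1)^2] is a common bound for all the errors. *)
Lemma chain_base (F : seq A) (h : nat) (g : nat -> A) (k : R) : (0 < h)%N -> 0 < k -> k <= 1 ->
  (forall q, (q < h)%N -> Pcone (g q)) ->
  (forall q, (q.+1 < h)%N -> nrm (alpha (g q) - g q.+1) <= k) ->
  (forall n, (0 < n < h)%N -> nrm (g 0 * g n) <= k) ->
  nrm (\sum_(q < h) g q) <= 1 + k ->
  (forall a, a \in F -> nrm (g 0 * a - a * g 0) <= k) ->
  exists s : A, [/\ Pcone s /\ nrm s <= 1, nrm (\sum_(q < h) iter q alpha s) <= 1,
    forall n, (0 < n < h)%N -> nrm (s * iter n alpha s) <= 3 * (h%:R + 1) ^+ 2 * k,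
    forall a, a \in F -> nrm (s * a - a * s) <= 3 * (h%:R + 1) ^+ 2 * k
  & forall q, (q < h)%N -> nrm (iter q alpha s - g q) <= 3 * (h%:R + 1) ^+ 2 * k].
Proof.
move=> h0 k0 k1 gP gA gO gs gF.
have itH p := star_hom_iter p alphaH.
have itn p x : nrm (iter p alpha x) <= nrm x by exact: star_hom_nrm.
pose H : R := h%:R; have H1 : 1 <= H by rewrite ler1n.
have close q : (q < h)%N -> nrm (iter q alpha (g 0) - g q) <= q%:R * k.
  elim: q => [|q IH] qh; first by rewrite subrr nrm0 mul0r.
  rewrite iterS; apply: le_trans (nrm_tri _ (alpha (g q)) _) _.
  rewrite -natr1 mulrDl mul1r; apply: lerD; last exact: gA.
  rewrite -(linfB (f := alpha)); last by case: alphaH.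
  by apply: le_trans (star_hom_nrm _ alphaH) _; apply: IH; exact: ltnW.
have closeH q : (q < h)%N -> nrm (iter q alpha (g 0) - g q) <= H * k.
  move=> qh; apply: le_trans (close q qh) _; apply: ler_wpM2r; first exact: ltW.
  by rewrite ler_nat ltnW.
have P0 := gP 0 h0.
have g0n : nrm (g 0) <= 1 + k.
  apply: le_trans gs; apply: Pcone_lenrm => //.
  rewrite -(prednK h0) big_ord_recl addrAC subrr add0r.
  apply: Pcone_sum => i _; apply: gP; rewrite /= /bump /= add1n.
  by have := ltn_ord i; rewrite -[X in (_ < X)%N -> _]/(h.-1) -ltnS prednK.
(* Each of the [H] iterates drifts from [g q] by at most [H k], so the orbit sum has norm at most
   [1 + k + H H k = 1 + mu]. *)
pose mu := (1 + H * H) * k; pose t := (1 + mu)^-1.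
have HH : 0 <= H * H by nra.
have mu0 : 0 <= mu by rewrite /mu; nra.
have M0 : 0 < 1 + mu by lra.
have t0 : 0 < t by rewrite invr_gt0.
have t1 : t * (1 + mu) = 1 by rewrite mulVf// gt_eqF.
have tle : t <= 1 by nra.
have tmu : 1 - t <= mu by nra.
have ta : `|t| = t by rewrite ger0_norm// ltW.
have Hk : 0 <= H * k by nra.
have K1 : (1 + H * 2) * k <= 3 * (H + 1) ^+ 2 * k by apply: ler_wpM2r; [exact: ltW|nra].
exists (t *^ g 0); split.
- split; first by apply: PconeZ => //; exact: ltW.
  rewrite nrmZr ta -t1; apply: ler_wpM2l; first exact: ltW.
  apply: le_trans g0n _; rewrite lerD2l /mu; nra.
- under eq_bigr do rewrite star_homZ//.
  rewrite -scaler_sumr nrmZr ta -t1; apply: ler_wpM2l; first exact: ltW.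
  have : nrm (\sum_(q < h) iter q alpha (g 0) - \sum_(q < h) g q) <= H * H * k.
    rewrite -sumrB; apply: le_trans (nrm_sum _ _ _) _.
    apply: (@le_trans _ _ (\sum_(q < h) H * k)).
      by apply: ler_sum => q _; exact: closeH.
    by rewrite sumr_const card_ord -[_ *+ h]mulr_natl mulrA.
  have := nrmD (\sum_(q < h) iter q alpha (g 0) - \sum_(q < h) g q) (\sum_(q < h) g q).
  rewrite subrK /mu; lra.
- move=> n nh; rewrite star_homZ// scAl scAr !nrmZr ta.
  have h1 : nrm (g 0 * iter n alpha (g 0)) <= (1 + H * 2) * k.
    rewrite -[iter n alpha (g 0)](subrK (g n)) mulrDr; apply: le_trans (nrmD _ _) _.
    have h2 := gO n nh; have /andP[_ nh'] := nh.
    have h3 : nrm (g 0 * (iter n alpha (g 0) - g n)) <= (1 + k) * (H * k).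
      by apply: nrmM_le => //; exact: closeH.
    have : (1 + k) * (H * k) <= 2 * (H * k) by apply: ler_wpM2r => //; lra.
    lra.
  apply: le_trans K1; apply: le_trans h1.
  have := nrm_ge0 (g 0 * iter n alpha (g 0)); set y := nrm _ => y0.
  have : t * y <= y by nra.
  have : 0 <= t * y by rewrite mulr_ge0// ltW.
  nra.
- move=> a aF; rewrite scAl scAr -scalerBr nrmZr ta.
  apply: le_trans K1; apply: le_trans (_ : 1 * k <= _); last by apply: ler_wpM2r; [exact: ltW|lra].
  by apply: ler_pM; rewrite ?nrm_ge0 ?gF// ltW.
- move=> q qh; rewrite star_homZ//.
  have -> : t *^ iter q alpha (g 0) - g q =
     (iter q alpha (g 0) - g q) - (1 - t) *^ iter q alpha (g 0) by nc.
  apply: le_trans (nrmB _ _) _; rewrite nrmZr.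
  have -> : `|1 - t| = 1 - t by rewrite ger0_norm// subr_ge0.
  have h1 := closeH q qh.
  have h2 : (1 - t) * nrm (iter q alpha (g 0)) <= mu * 2.
    apply: ler_pM; rewrite ?nrm_ge0 ?subr_ge0//.
    by apply: le_trans (itn _ _) _; lra.
  have : (H + 2 * (1 + H * H)) * k <= 3 * (H + 1) ^+ 2 * k by apply: ler_wpM2r; [exact: ltW|nra].
  rewrite /mu in h2; lra.
Qed.

(** The peak is at [m] for height [2m], and at both [m] and [m + 1] for height [2m + 1]. Truncated
    subtraction gives 0 from [h] on. *)
Definition tent (m h q : nat) : R := Num.min 1 (Num.min (q%:R / m%:R) ((h - q)%:R / m%:R)).

Lemma tent_up m h q : (0 < m)%N -> (q <= m)%N -> (m <= h - q)%N -> tent m h q = q%:R / m%:R.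
Proof.
move=> m0 qm mh; have M0 : 0 < m%:R :> R by rewrite ltr0n.
rewrite /tent (@min_l _ _ (q%:R / m%:R)); last first.
  by rewrite ler_pM2r ?invr_gt0// ler_nat (leq_trans qm).
by rewrite min_r// ler_pdivrMr// mul1r ler_nat.
Qed.

Lemma tent_down m h q : (0 < m)%N -> (m <= q)%N -> (h - q <= m)%N -> tent m h q = (h - q)%:R / m%:R.
Proof.
move=> m0 qm mh; have M0 : 0 < m%:R :> R by rewrite ltr0n.
have hq : (h - q)%:R / m%:R <= q%:R / m%:R :> R.
  by rewrite ler_pM2r ?invr_gt0// ler_nat (leq_trans mh).
rewrite /tent [in Num.min (q%:R / _) _]min_r// min_r//.
by rewrite ler_pdivrMr// mul1r ler_nat.
Qed.

Lemma tent_ge0 m h q : 0 <= tent m h q.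
Proof. by rewrite /tent !le_min ler01 !divr_ge0. Qed.

Lemma tent_le1 m h q : tent m h q <= 1.
Proof. by rewrite /tent ge_min lexx. Qed.

Lemma tent_lip m h p q K : (0 < m)%N -> (p <= q + K)%N -> (q <= p + K)%N ->
  tent m h p <= tent m h q + K%:R / m%:R.
Proof.
move=> m0 pq qp; have M0 : 0 < m%:R^-1 :> R by rewrite invr_gt0 ltr0n.
have K0 : 0 <= K%:R / m%:R :> R by rewrite divr_ge0.
rewrite -lerBlDr /tent !le_min; apply/and3P; split.
- by rewrite lerBlDr; apply: le_trans (_ : 1 <= _); [rewrite ge_min lexx|lra].
- rewrite lerBlDr -mulrDl; apply: le_trans (_ : p%:R / m%:R <= _); first by rewrite !ge_min lexx orbT.
  by rewrite ler_pM2r// -natrD ler_nat.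
- rewrite lerBlDr -mulrDl; apply: le_trans (_ : (h - p)%:R / m%:R <= _); first by rewrite !ge_min lexx !orbT.
  rewrite ler_pM2r// -natrD ler_nat; lia.
Qed.

Lemma tent_edge m h q K : (0 < m)%N -> (q <= K)%N || (h - q <= K)%N ->
  tent m h q <= K%:R / m%:R.
Proof.
move=> m0 qK; have M0 : 0 < m%:R^-1 :> R by rewrite invr_gt0 ltr0n.
by rewrite /tent !ge_min !ler_pM2r// !ler_nat qK orbT.
Qed.

Definition height (m c : nat) : nat := if c == 1%N then (m + m).+1 else (m + m)%N.

Lemma height_gt0 m c : (0 < m)%N -> (0 < height m c)%N.
Proof. by rewrite /height; case: ifP => // _; rewrite addn_gt0 => ->. Qed.

(* The third chain runs through the upper half of both towers at once, and then through
   their lower half; weighted by [tent], the three chains add up to the two towers. *)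
Definition chain (m : nat) (f : 'I_2 -> nat -> A) (c q : nat) : A :=
  if c == 0%N then f ord0 q else if c == 1%N then f ord_max q
  else if (q < m)%N then f ord0 (m + q)%N + f ord_max (m.+1 + q)%N
  else f ord0 (q - m)%N + f ord_max (q - m)%N.

Lemma sum_ord_cast (V : nmodType) (n n' : nat) (F : nat -> V) : n = n' ->
  \sum_(j < n) F j = \sum_(j < n') F j.
Proof. by move->. Qed.

Lemma sum_halves (V : nmodType) m (F : nat -> V) :
  \sum_(j < m + m) F j = \sum_(j < m) (F j + F (m + j)%N).
Proof. by rewrite big_split_ord big_split. Qed.

Lemma sum_halvesS (V : nmodType) m (F : nat -> V) :
  \sum_(j < (m + m).+1) F j = F m + \sum_(j < m) (F j + F (m.+1 + j)%N).
Proof.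
rewrite (@sum_ord_cast V _ (m + m.+1)); last by rewrite addnS.
rewrite big_split_ord (big_ord_recl m) /= addn0 addrCA; congr (_ + _).
rewrite big_split; congr (_ + _); apply: eq_bigr => j _.
by rewrite /= /bump /= add1n addnS addSn.
Qed.

Lemma tower_sum m (f : 'I_2 -> nat -> A) :
  \sum_(r < 2) \sum_(j < m + m + r) f r j =
  \sum_(j < m + m) f ord0 j + \sum_(j < (m + m).+1) f ord_max j.
Proof.
rewrite big_ord_recl big_ord1 (_ : lift ord0 ord0 = ord_max); last exact/val_inj.
congr (_ + _); first by apply: sum_ord_cast; rewrite addn0.
by apply: sum_ord_cast; rewrite addn1.
Qed.

Lemma chain_sum2 m (f : 'I_2 -> nat -> A) (w : nat -> R) :
  \sum_(q < m + m) w q *^ chain m f 2 q =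
  \sum_(q < m) (w q *^ (f ord0 (m + q)%N + f ord_max (m.+1 + q)%N)
     + w (m + q)%N *^ (f ord0 q + f ord_max q)).
Proof.
rewrite (sum_halves m (fun q => w q *^ chain m f 2 q)); apply: eq_bigr => q _; congr (_ *^ _ + _ *^ _).
  by rewrite /chain /= ltn_ord.
by rewrite /chain /= ltnNge leq_addr /= addKn.
Qed.

(** An element of the lower half, at level [q], has weight [q / m] in its tower and [1 - q / m] in
    the third chain; in the upper half these are exchanged. The middle of the long tower lies off
    the third chain and has weight 1. *)
Lemma chain_partition m (f : 'I_2 -> nat -> A) : (0 < m)%N ->
  \sum_(c < 3) \sum_(q < height m c) tent m (height m c) q *^ chain m f c q =
  \sum_(r < 2) \sum_(j < m + m + r) f r j.
Proof.
move=> m0; rewrite tower_sum (big_ord_recl 2) (big_ord_recl 1) (big_ord_recl 0) big_ord0 addr0 /height /=.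
rewrite (chain_sum2 m f) (sum_halves m (f ord0)) (sum_halvesS m (f ord_max)).
rewrite (sum_halves m (fun q => tent m (m + m) q *^ chain m f 0 q)).
rewrite (sum_halvesS m (fun q => tent m (m + m).+1 q *^ chain m f 1 q)).
rewrite /chain /=.
have -> : tent m (m + m).+1 m = 1.
  by rewrite tent_up// ?divff ?pnatr_eq0 -?lt0n//; lia.
rewrite scale1r -(addrA (f ord_max m)) [LHS]addrCA [RHS]addrCA; congr (_ + _).
rewrite -!big_split; apply: eq_bigr => q _ /=; have qm := ltn_ord q.
have M0 : m%:R != 0 :> R by rewrite pnatr_eq0 -lt0n.
rewrite (tent_up m0 (h := m + m) (ltnW qm)); last by lia.
rewrite (tent_up m0 (h := (m + m).+1) (ltnW qm)); last by lia.
rewrite (tent_down (h := m + m) (q := m + q) m0) ?leq_addr//; last by lia.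
rewrite (tent_down (h := (m + m).+1) (q := m.+1 + q) m0); [|by lia|by lia].
have -> : ((m + m) - (m + q) = m - q)%N by lia.
have -> : ((m + m).+1 - (m.+1 + q) = m - q)%N by lia.
have -> : (m - q)%:R / m%:R = 1 - q%:R / m%:R :> R.
  by rewrite natrB ?mulrBl ?divff// ltnW.
by move: (q%:R / m%:R) => x; nc.
Qed.


(** The third chain is made of sums of two tower elements, whose products have four terms: hence
    [4 * k]. *)
Lemma tower_chain (F : seq A) (m d : nat) (k : R) (f : 'I_d.+1 -> 'I_2 -> nat -> A) :
  (0 < m)%N -> 0 < k -> k <= 1 / 4 ->
  (forall l (r : 'I_2) j, (j < m + m + r)%N -> positive (f l r j)) ->
  [/\ forall l (q r : 'I_2) i j, (i < m + m + q)%N -> (j < m + m + r)%N ->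
        (q, i) <> (r, j) -> `|f l q i * f l r j| < k%:C,
      `|(\sum_(l < d.+1) \sum_(r < 2) \sum_(j < m + m + r) f l r j) - 1| < k%:C,
      forall l (r : 'I_2) j, (j.+1 < m + m + r)%N -> `|alpha (f l r j) - f l r j.+1| < k%:C,
      forall l, `|alpha (f l ord0 (m + m).-1 + f l ord_max (m + m)%N)
                  - (f l ord0 0%N + f l ord_max 0%N)| < k%:C
    & forall l (r : 'I_2) j a, (j < m + m + r)%N -> a \in F ->
        `|f l r j * a - a * f l r j| < k%:C] ->
  forall l (c : 'I_3), exists s : A, [/\ Pcone s /\ nrm s <= 1,
    nrm (\sum_(q < height m c) iter q alpha s) <= 1,
    forall n, (0 < n < height m c)%N ->
      nrm (s * iter n alpha s) <= 3 * ((height m c)%:R + 1) ^+ 2 * (4 * k),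
    forall a, a \in F -> nrm (s * a - a * s) <= 3 * ((height m c)%:R + 1) ^+ 2 * (4 * k)
  & forall q, (q < height m c)%N ->
      nrm (iter q alpha s - chain m (f l) c q) <= 3 * ((height m c)%:R + 1) ^+ 2 * (4 * k)].
Proof.
move=> m0 k0 k14 fP [f1 f2 f3 f4 f5].
have k1 : 4 * k <= 1 by lra.
have mm0 : (0 < m + m)%N by rewrite addn_gt0 m0.
have lt_nrm (x : A) : `|x| < k%:C -> nrm x <= k by rewrite nrmE ltcR => /ltW.
have fP0 l j : (j < m + m)%N -> Pcone (f l ord0 j).
  by move=> jm; apply/positiveP/fP; rewrite addn0.
have fP1 l j : (j < (m + m).+1)%N -> Pcone (f l ord_max j).
  by move=> jm; apply/positiveP/fP; rewrite addn1.
move=> l c.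
apply: chain_base; [exact: height_gt0|lra|exact: k1|..].
- move=> q; case: c => [[|[|[|//]]] ci]; rewrite /height /chain /=.
  + exact: fP0.
  + exact: fP1.
  + move=> qh; case: ltnP => qm; apply: PconeD; [apply: fP0|apply: fP1|apply: fP0|apply: fP1]; nlia.
- have aD x y : alpha (x + y) = alpha x + alpha y by case: alphaH => al _ _; exact: linfD.
  have st0 j : (j.+1 < m + m)%N -> nrm (alpha (f l ord0 j) - f l ord0 j.+1) <= k.
    by move=> jm; apply/lt_nrm/f3; rewrite addn0.
  have st1 j : (j.+1 < (m + m).+1)%N -> nrm (alpha (f l ord_max j) - f l ord_max j.+1) <= k.
    by move=> jm; apply/lt_nrm/f3; rewrite addn1.
  have st i j : (i.+1 < m + m)%N -> (j.+1 < (m + m).+1)%N ->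
      nrm (alpha (f l ord0 i + f l ord_max j) - (f l ord0 i.+1 + f l ord_max j.+1)) <= 4 * k.
    move=> im jm; rewrite aD opprD addrACA; apply: le_trans (nrmD _ _) _.
    by have := st0 i im; have := st1 j jm; lra.
  move=> q; case: c => [[|[|[|//]]] ci]; rewrite /height /chain /=.
  + by move=> qh; apply: le_trans (st0 q qh) _; lra.
  + by move=> qh; apply: le_trans (st1 q qh) _; lra.
  + move=> qh; have [q1|q1] := ltnP q.+1 m.
      rewrite ltnW// !addnS; apply: st; nlia.
    have [qm|qm] := ltnP q m; last by rewrite subSn//; apply: st; nlia.
    (* Now [q = m - 1], and the third chain passes from the two tops to the two bottoms. [alpha]
       relates only their sums, so the chain must carry both towers at once. *)
    have -> : (q.+1 - m = 0)%N by nlia.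
    have -> : (m + q = (m + m).-1)%N by nlia.
    have -> : (m.+1 + q = m + m)%N by nlia.
    by apply: le_trans (lt_nrm _ (f4 l)) _; lra.
- have o00 i j : (i < m + m)%N -> (j < m + m)%N -> i <> j -> nrm (f l ord0 i * f l ord0 j) <= k.
    by move=> im jm ij; apply/lt_nrm/f1; rewrite ?addn0//; case.
  have o01 i j : (i < m + m)%N -> (j < (m + m).+1)%N -> nrm (f l ord0 i * f l ord_max j) <= k.
    by move=> im jm; apply/lt_nrm/f1; rewrite ?addn0 ?addn1//; case.
  have o10 i j : (i < (m + m).+1)%N -> (j < m + m)%N -> nrm (f l ord_max i * f l ord0 j) <= k.
    by move=> im jm; apply/lt_nrm/f1; rewrite ?addn0 ?addn1//; case.
  have o11 i j : (i < (m + m).+1)%N -> (j < (m + m).+1)%N -> i <> j ->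
      nrm (f l ord_max i * f l ord_max j) <= k.
    by move=> im jm ij; apply/lt_nrm/f1; rewrite ?addn1//; case.
  have o4 i j i' j' : (i < m + m)%N -> (j < (m + m).+1)%N -> (i' < m + m)%N ->
      (j' < (m + m).+1)%N -> i <> i' -> j <> j' ->
      nrm ((f l ord0 i + f l ord_max j) * (f l ord0 i' + f l ord_max j')) <= 4 * k.
    move=> im jm im' jm' ii jj; rewrite mulrDl !mulrDr.
    have := nrmD (f l ord0 i * f l ord0 i' + f l ord0 i * f l ord_max j')
      (f l ord_max j * f l ord0 i' + f l ord_max j * f l ord_max j').
    have := nrmD (f l ord0 i * f l ord0 i') (f l ord0 i * f l ord_max j').
    have := nrmD (f l ord_max j * f l ord0 i') (f l ord_max j * f l ord_max j').
    have := o00 _ _ im im' ii; have := o01 _ _ im jm'; have := o10 _ _ jm im'.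
    have := o11 _ _ jm jm' jj; lra.
  move=> n; case: c => [[|[|[|//]]] ci]; rewrite /height /chain /=.
  + move=> /andP[n0 nh]; apply: le_trans (o00 0%N n _ _ _) _; nlia || lra.
  + move=> /andP[n0 nh]; apply: le_trans (o11 0%N n _ _ _) _; nlia || lra.
  + by move=> /andP[n0 nh]; rewrite m0 !addn0; case: ltnP => nm; apply: o4; nlia.
- apply: (@le_trans _ _ (1 + k)); last lra.
  have := nrmD ((\sum_(l < d.+1) \sum_(r < 2) \sum_(j < m + m + r) f l r j) - 1) 1.
  rewrite subrK => h; have := lt_nrm _ f2; have := nrm1_le A.
  (* A chain uses each tower element at most once, so its sum is dominated by that of all the
     towers. *)
  suff : nrm (\sum_(q < height m c) chain m (f l) c q) <=
    nrm (\sum_(l < d.+1) \sum_(r < 2) \sum_(j < m + m + r) f l r j) by lra.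
  have PT l' : Pcone (\sum_(r < 2) \sum_(j < m + m + r) f l' r j).
    rewrite tower_sum; apply: PconeD; apply: Pcone_sum => j _; [exact: fP0|exact: fP1].
  apply: Pcone_lenrm.
    apply: Pcone_sum => q _; move: q; case: c => [[|[|[|//]]] ci]; rewrite /height /chain /= => q.
    + exact: fP0.
    + exact: fP1.
    + by have qh := ltn_ord q; case: ltnP => qm; apply: PconeD; [apply: fP0|apply: fP1|apply: fP0|apply: fP1]; nlia.
  rewrite (bigD1 l)//= addrAC; apply: PconeD; last by apply: Pcone_sum.
  rewrite tower_sum; case: c => [[|[|[|//]]] ci]; rewrite /height /=.
  + rewrite addrAC subrr add0r; apply: Pcone_sum => j _; exact: fP1.
  + rewrite addrK; apply: Pcone_sum => j _; exact: fP0.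
  + have -> : \sum_(q < m + m) chain m (f l) 2 q =
        \sum_(q < m + m) f l ord0 q + \sum_(q < m) (f l ord_max q + f l ord_max (m.+1 + q)%N).
      rewrite (sum_halves m (chain m (f l) 2)) (sum_halves m (f l ord0)) -big_split.
      apply: eq_bigr => q _; rewrite /chain /= ltn_ord ltnNge leq_addr /= addKn; nc.
    rewrite (sum_halvesS m (f l ord_max)) opprD addrACA subrr add0r addrK.
    by apply: fP1; nlia.
- have c0 j : (j < m + m)%N -> forall a, a \in F -> nrm (f l ord0 j * a - a * f l ord0 j) <= k.
    by move=> jm a aF; apply/lt_nrm/f5 => //; rewrite addn0.
  have c1 j : (j < (m + m).+1)%N -> forall a, a \in F -> nrm (f l ord_max j * a - a * f l ord_max j) <= k.
    by move=> jm a aF; apply/lt_nrm/f5 => //; rewrite addn1.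
  move=> a aF; case: c => [[|[|[|//]]] ci]; rewrite /chain /=.
  + by apply: le_trans (c0 0%N _ a aF) _ => //; lra.
  + by apply: le_trans (c1 0%N _ a aF) _ => //; lra.
  + rewrite m0 !addn0 mulrDl mulrDr opprD addrACA; apply: le_trans (nrmD _ _) _.
    have mm : (m < m + m)%N by nlia. have mm1 : (m.+1 < (m + m).+1)%N by nlia.
    by have := c0 m mm a aF; have := c1 m.+1 mm1 a aF; lra.
Qed.

Variable d : nat.
Hypothesis towers : rokhlin_towers alpha d.

Lemma rokhlin_chains (F : seq A) (m : nat) (e : R) : (0 < m)%N -> 0 < e ->
  exists s : 'I_d.+1 -> 'I_3 -> A,
  [/\ forall (l : 'I_d.+1) (c : 'I_3), Pcone (s l c) /\ nrm (s l c) <= 1,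
      forall (l : 'I_d.+1) (c : 'I_3), nrm (\sum_(p < height m c) iter p alpha (s l c)) <= 1,
      forall (l : 'I_d.+1) (c : 'I_3) n, (0 < n < height m c)%N -> nrm (s l c * iter n alpha (s l c)) <= e,
      forall l c a, a \in F -> nrm (s l c * a - a * s l c) <= e
    & nrm (\sum_(l < d.+1) \sum_(c < 3) \sum_(p < height m c)
        tent m (height m c) p *^ iter p alpha (s l c) - 1) <= e].
Proof.
move=> m0 e0.
(* [H] bounds the heights, [K] is the constant of [chain_base], and [Z - 1] bounds the number of
   terms of the weighted sum, each off by at most [K * (4 * k)]. *)
pose H : R := (m + m).+1%:R; pose K := 3 * (H + 1) ^+ 2; pose Z : R := 1 + d.+1%:R * (3 * H).
have H1 : 1 <= H by rewrite ler1n.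
have K1 : 1 <= K by rewrite /K; nra.
have dd : 0 <= d.+1%:R :> R by [].
have Z1 : 1 <= Z by rewrite lerDl mulr_ge0//; lra.
have KZ : 1 <= K * Z by nra.
have W0 : 0 < 8 * (K * Z) by lra.
pose k := Num.min (1 / 4) (e / (8 * (K * Z))).
have k0 : 0 < k by rewrite lt_min divr_gt0//= divr_gt0.
have k14 : k <= 1 / 4 by rewrite ge_min lexx.
have k1 : 4 * k <= 1 by lra.
have ke : k * (8 * (K * Z)) <= e.
  by rewrite -ler_pdivlMr// ge_min lexx orbT.
have Kk : K * (4 * k) * (2 * Z) <= e by apply: le_trans ke; lra.
have Kk0 : 0 <= K * (4 * k) by rewrite mulr_ge0//; lra.
have Ke : K * (4 * k) <= e by apply: le_trans Kk; nra.
have kKk : 2 * k <= K * (4 * k) by nra.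
have mm0 : (0 < m + m)%N by rewrite addn_gt0 m0.
have kC : 0 < k%:C by rewrite ltcR.
have [f [fP fk]] := towers F mm0 kC.
have chain_ex l (c : 'I_3) : exists s : A, [/\ Pcone s /\ nrm s <= 1,
    nrm (\sum_(q < height m c) iter q alpha s) <= 1,
    forall n, (0 < n < height m c)%N -> nrm (s * iter n alpha s) <= K * (4 * k),
    forall a, a \in F -> nrm (s * a - a * s) <= K * (4 * k)
  & forall q, (q < height m c)%N -> nrm (iter q alpha s - chain m (f l) c q) <= K * (4 * k)].
  have Hh : (height m c)%:R <= H.
    by rewrite /H ler_nat /height; case: ifP.
  have hK : 3 * ((height m c)%:R + 1) ^+ 2 * (4 * k) <= K * (4 * k).
    apply: ler_wpM2r; first lra.
    have : 1 <= (height m c)%:R :> R by rewrite ler1n height_gt0.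
    by rewrite /K; nra.
  have [s [h1 h2 h3 h4 h5]] := tower_chain m0 k0 k14 fP fk l c.
  exists s; split=> //.
  - by move=> n nh; apply: le_trans hK; exact: h3.
  - by move=> a aF; apply: le_trans hK; exact: h4.
  - by move=> q qh; apply: le_trans hK; exact: h5.
pose s (l : 'I_d.+1) (c : 'I_3) := projT1 (cid (chain_ex l c)).
have sP (l : 'I_d.+1) (c : 'I_3) : [/\ Pcone (s l c) /\ nrm (s l c) <= 1,
    nrm (\sum_(q < height m c) iter q alpha (s l c)) <= 1,
    forall n, (0 < n < height m c)%N -> nrm (s l c * iter n alpha (s l c)) <= K * (4 * k),
    forall a, a \in F -> nrm (s l c * a - a * s l c) <= K * (4 * k)
  & forall q, (q < height m c)%N -> nrm (iter q alpha (s l c) - chain m (f l) c q) <= K * (4 * k)].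
  by rewrite /s; case: cid.
exists s; split.
- by move=> l c; case: (sP l c).
- by move=> l c; case: (sP l c).
- by move=> l c n nh; apply: le_trans Ke; case: (sP l c) => _ _ + _ _; apply.
- by move=> l c a aF; apply: le_trans Ke; case: (sP l c) => _ _ _ + _; apply.
set T := \sum_l _.
pose G := \sum_(l < d.+1) \sum_(c < 3) \sum_(q < height m c) tent m (height m c) q *^ chain m (f l) c q.
have GE : G = \sum_(l < d.+1) \sum_(r < 2) \sum_(j < m + m + r) f l r j.
  by apply: eq_bigr => l _; exact: chain_partition.
have h1 : nrm (G - 1) <= k by rewrite GE -lecR -nrmE ltW//; case: fk.
have h2 : nrm (T - G) <= d.+1%:R * (3 * H) * (K * (4 * k)).
  rewrite /T /G -sumrB; apply: le_trans (nrm_sum _ _ _) _.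
  apply: (@le_trans _ _ (\sum_(l < d.+1) 3 * H * (K * (4 * k)))); last first.
    by rewrite sumr_const card_ord -[_ *+ _]mulr_natl mulrA.
  apply: ler_sum => l _; rewrite -sumrB; apply: le_trans (nrm_sum _ _ _) _.
  apply: (@le_trans _ _ (\sum_(c < 3) H * (K * (4 * k)))); last first.
    by rewrite sumr_const card_ord -[_ *+ _]mulr_natl mulrA.
  apply: ler_sum => c _; rewrite -sumrB; apply: le_trans (nrm_sum _ _ _) _.
  apply: (@le_trans _ _ (\sum_(q < height m c) K * (4 * k))); last first.
    rewrite sumr_const card_ord -[_ *+ _]mulr_natl; apply: ler_wpM2r => //.
    by rewrite /H ler_nat /height; case: ifP.
  apply: ler_sum => q _; rewrite -scalerBr nrmZr ger0_norm ?tent_ge0// -[leRHS]mul1r.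
  apply: ler_pM; rewrite ?tent_ge0 ?tent_le1 ?nrm_ge0//.
  by case: (sP l c) => _ _ _ _; apply.
have := nrm_tri T G 1; rewrite /Z in Kk; lra.
Qed.

End Chain.

(** * Approximation of the crossed product *)

Section DirectSumFacts.
Variables (R : realType) (I : finType) (F : I -> cstarType R).

Lemma dsum_nrm_ub (x : dsum F) i : nrm (x i) <= nrm x.
Proof. by rewrite -lecR -!nrmE; exact: (nnmax_ub (fun j => `|x j|%:nng)). Qed.

Lemma dsum_nrm_le (x : dsum F) (c : R) : 0 <= c -> (forall i, nrm (x i) <= c) -> nrm x <= c.
Proof.
move=> c0 h; rewrite -lecR -nrmE; apply: (nnmax_le (g := fun j => `|x j|%:nng)) => [|i].
  by rewrite ler0c.
by rewrite /= nrmE lecR.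
Qed.

Lemma dsum_Pcone (x : dsum F) : (forall i, Pcone (x i)) -> Pcone x.
Proof.
move=> h; have h' i : exists b : F i, x i = star b * b by apply/positiveP.
apply/positiveP; exists ((fun i => projT1 (cid (h' i))) : dsum F).
by apply: functional_extensionality_dep => i; rewrite [LHS](projT2 (cid (h' i))).
Qed.

Lemma dsum_sumE (K : Type) (s : seq K) (G : K -> dsum F) i :
  (\sum_(k <- s) G k : dsum F) i = \sum_(k <- s) G k i.
Proof. by apply: (big_morph (fun x : dsum F => x i)). Qed.

Lemma dsum_dec (x : dsum F) : x = \sum_i @dsum_inj R I F i (x i).
Proof.
apply: functional_extensionality_dep => j; rewrite dsum_sumE (bigD1 j)//= big1 => [|i ij].
  by rewrite /dsum_inj dfwithin addr0.
by rewrite /dsum_inj dfwithout.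
Qed.

End DirectSumFacts.

Section Composition.
Variable R : realType.
Implicit Types A B D E : cstarType R.

Lemma cp_comp A B D (f : A -> B) (g : B -> D) : linear f -> cpf f -> linear g -> cpf g ->
  linear (g \o f) /\ cpf (g \o f).
Proof.
move=> fl fp gl gp; have /cpP[_ fP] : linear f /\ cpf f by [].
have /cpP[_ gP] : linear g /\ cpf g by [].
apply/cpP; split=> [c x y|n x /fP/gP]; first by rewrite /= fl gl.
by rewrite -map_mx_comp.
Qed.

Lemma fd_of_finType E (T : finType) (e : T -> E) :
  (forall x, exists c : T -> R[i], x = \sum_t c t *: e t) -> finite_dimensional E.
Proof.
move=> h; exists #|T|, (fun i => e (enum_val i)) => x; have [c ->] := h x.
by exists (fun i => c (enum_val i)); exact: (sum_enum (fun t => c t *: e t)).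
Qed.

Lemma fd_mx E h : finite_dimensional E -> finite_dimensional (bopc 'I_h E).
Proof.
move=> [N [e he]].
apply: (@fd_of_finType _ ('I_h * 'I_h * 'I_N)%type
  (fun t => mxop (fun p q => if (p, q) == t.1 then e t.2 else 0))) => X.
pose c p q := projT1 (cid (he (ent X p q))).
have cE p q : ent X p q = \sum_i c p q i *: e i by rewrite /c; case: cid.
exists (fun t => c t.1.1 t.1.2 t.2); apply: ent_ext => p q.
rewrite ent_sum -(pair_bigA _ (fun t i => ent (c t.1 t.2 i *: mxop (fun p q => if (p, q) == t then e i else 0)) p q)) /=.
rewrite (bigD1 (p, q))//= [W in _ + W]big1 ?addr0 => [|t /negbTE tn]; last first.
  by rewrite big1// => i _; rewrite entZ ent_mxop eq_sym tn scaler0.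
by rewrite cE; apply: eq_bigr => i _; rewrite entZ ent_mxop eqxx.
Qed.

Section Compress.
Variables (B E : cstarType R) (f : B -> E) (h : nat) (w : 'I_h -> B).
Hypotheses (fl : linear f) (fp : cpf f).

Definition compress (x : B) : bopc 'I_h E := mxop (fun p q => f (star (w p) * x * w q)).

Lemma compress_linear : linear compress.
Proof.
move=> c x y; apply: ent_ext => p q; rewrite entD entZ !ent_mxop.
by rewrite mulrDr mulrDl scAr scAl fl.
Qed.

(** The kernel of [f] indexed by pairs [(j, p)], at the points [a_j w_p] and with the entries of the
    vectors [b_j c] as coefficients. *)
Lemma compress_cpf : cpf compress.
Proof.
move=> J a b; apply: Pcone_mx => c.
pose d (t : J * 'I_h) : E := \sum_p ent (b t.1) t.2 p * c p.
pose y (t : J * 'I_h) : B := a t.1 * w t.2.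
have := fp y d; congr Pcone.
transitivity (\sum_p \sum_q \sum_(s : J * 'I_h) \sum_(t : J * 'I_h)
  star (c p) * (star (ent (b s.1) s.2 p) * f (star (y s) * y t) * ent (b t.1) t.2 q) * c q).
  under [RHS]eq_bigr do rewrite exchange_big.
  rewrite [RHS]exchange_big; apply: eq_bigr => s _.
  under [RHS]eq_bigr do rewrite exchange_big.
  rewrite [RHS]exchange_big; apply: eq_bigr => t _.
  rewrite /d star_sum !mulr_suml; apply: eq_bigr => p _; rewrite mulr_sumr.
  by apply: eq_bigr => q _; rewrite starM !mulrA.
apply: eq_bigr => p _; apply: eq_bigr => q _.
under eq_bigr do rewrite -mulr_suml -mulr_sumr.
rewrite -mulr_suml -mulr_sumr; congr (_ * _ * _).
rewrite ent_sum; under [RHS]eq_bigr do rewrite ent_sum.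
transitivity (\sum_j \sum_p' \sum_k \sum_q' star (ent (b j) p' p) *
   f (star (w p') * (star (a j) * a k) * w q') * ent (b k) q' q).
  rewrite [RHS]pair_bigA; apply: eq_bigr => -[j p'] _ /=; rewrite [RHS]pair_bigA.
  by apply: eq_bigr => -[k q'] _ /=; rewrite /y /= starM !mulrA.
apply: eq_bigr => j _; rewrite exchange_big; apply: eq_bigr => k _.
rewrite entM exchange_big; apply: eq_bigr => q' _; rewrite entM mulr_suml.
by apply: eq_bigr => p' _; rewrite ent_star ent_mxop.
Qed.

(** [compress 1] is diagonal, so its norm is read off the entries. For weighted powers of [u] the
    hypothesis holds because monomials of nonzero degree have zero expectation. *)
Lemma compress_nrm1 (c : 'I_h -> E) :
  (forall p q, f (star (w p) * w q) = if p == q then c p else 0) ->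
  (forall p, nrm (c p) <= 1) -> nrm (compress 1) <= 1.
Proof.
move=> fw c1.
have cP p : Pcone (c p).
  by have := fw p p; rewrite eqxx => <-; apply: cpf_pos => //; exact: Pcone_star_mul.
have eE p q : ent (compress 1) p q = if p == q then c p else 0.
  by rewrite ent_mxop mulr1 fw.
apply: Pcone_le_nrm => //.
  by apply: cpf_pos; [exact: compress_cpf|exact: Pcone1].
apply: Pcone_mx => v.
rewrite (_ : \sum_i _ = \sum_i star (v i) * (sca 1 - c i) * v i).
  by apply: Pcone_sum => i _; apply: Pcone_conj; apply: Pcone_sub_nrm => //; exact: Pcone_sa.
apply: eq_bigr => p _; rewrite (bigD1 p)//= big1 ?addr0 => [|q /negbTE qp].
  by rewrite !scale1r -[- compress 1]scaleN1r entD entZ ent1 eE eqxx scaleN1r.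
rewrite !scale1r -[- compress 1]scaleN1r entD entZ ent1 eE eq_sym qp.
by rewrite scaler0 addr0 mulr0 mul0r.
Qed.

End Compress.

(** Shifting the coefficients into [[0, 2 D]] makes the order applicable: [2 D] for the shifted sum
    and [D] for undoing the shift. *)
Lemma real_comb_nrm A (T : finType) (c : T -> R) (x : T -> A) (D : R) :
  (forall t, Pcone (x t)) -> (forall t, `|c t| <= D) -> 0 <= D ->
  nrm (\sum_t c t *^ x t) <= 3 * D * nrm (\sum_t x t).
Proof.
move=> xP cD D0.
have -> : \sum_t c t *^ x t = \sum_t (c t + D) *^ x t - D *^ \sum_t x t.
  by rewrite scaler_sumr -sumrB; apply: eq_bigr => t _; nc.
apply: le_trans (nrmB _ _) _; rewrite nrmZr ger0_norm//.
have : nrm (\sum_t (c t + D) *^ x t) <= nrm ((2 * D) *^ \sum_t x t).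
  apply: Pcone_lenrm.
    by apply: Pcone_sum => t _; apply: PconeZ => //; have := cD t; rewrite ler_norml; lra.
  rewrite scaler_sumr -sumrB; apply: Pcone_sum => t _.
  rewrite (_ : _ - _ = (D - c t) *^ x t); last by nc.
  by apply: PconeZ => //; have := cD t; rewrite ler_norml; lra.
rewrite nrmZr ger0_norm; last by rewrite mulr_ge0.
lra.
Qed.

End Composition.

(** * Contribution of one chain *)

Section Cell.
Variables (R : realType) (A B : cstarType R) (alpha beta : A -> A) (iota : A -> B) (u : B).
Variable (Ex : B -> A).
Hypotheses (alphaH : star_hom alpha) (cp : crossed_product alpha iota u).
Hypotheses (ba : cancel beta alpha) (Exl : linear Ex).
Hypothesis ExE : forall p r a,
  Ex (star (u ^+ p) * iota a * u ^+ r) = if p == r then iter p beta a else 0.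
Variables (I : finType) (E : I -> cstarType R).
Variables (psi : forall i, A -> E i) (phi : forall i, E i -> A).
Hypotheses (psil : forall i, linear (psi i)) (phil : forall i, linear (@phi i)).
Variables (h : nat) (t : nat -> R) (s : A).
Hypotheses (t0 : forall q, 0 <= t q) (t1 : forall q, t q <= 1).
Hypotheses (Ps : Pcone s) (s1 : nrm s <= 1).
Hypothesis S1 : nrm (\sum_(q < h) iter q alpha s) <= 1.
Local Notation g := (csqrt s).

Let cov : covariant alpha iota u. Proof. by case: cp. Qed.

(** The roots make the diagonal weights equal to [t p]; off the diagonal a geometric mean appears,
    which [geo_mean] compares with [t q]. *)
Definition wt (p : 'I_h) : B := Num.sqrt (t p) *^ u ^+ nat_of_ord p.

Lemma wt_mono (p q : 'I_h) i a j : Ex (star (wt p) * mono iota u ((i, a), j) * wt q) =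
  if (i + p == j + q)%N then (Num.sqrt (t p) * Num.sqrt (t q)) *^ iter (i + p) beta a else 0.
Proof.
have -> : star (wt p) * mono iota u ((i, a), j) * wt q =
   (Num.sqrt (t p) * Num.sqrt (t q)) *^ (star (u ^+ (i + p)) * iota a * u ^+ (j + q)).
  rewrite /wt /mono /= starZr !exprD starM.
  by rewrite !(scAl, scAr) scalerA -rmorphM /= !mulrA; congr (_%:C *: _).
by rewrite (linfZ _ _ Exl) ExE; case: eqP => // _; rewrite scaler0.
Qed.

(** With [a] and [b] the roots of [x] and [y], [b |a - b| <= |a - b| (a + b) = |x - y|]. *)
Lemma geo_mean (x y D : R) : 0 <= x -> 0 <= y -> x <= y + D -> y <= x + D ->
  `|Num.sqrt x * Num.sqrt y - y| <= D.
Proof.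
move=> x0 y0 xy yx; rewrite -{2}(sqr_sqrtr y0) expr2 -mulrBl normrM.
have a0 := sqrtr_ge0 x; have b0 := sqrtr_ge0 y.
have := sqr_sqrtr x0; have := sqr_sqrtr y0.
move: (Num.sqrt x) (Num.sqrt y) a0 b0 => a b a0 b0 yE xE.
rewrite (ger0_norm b0) -yE -xE in xy yx *.
apply: (@le_trans _ _ (`|a - b| * (a + b))).
  by rewrite ler_wpM2l// lerDr.
rewrite -[X in _ * X]ger0_norm ?addr_ge0// -normrM -subr_sqr ler_norml; lra.
Qed.

(** At most one [p] satisfies [i + p = j + q]. It is within [K] of [q], so the weights are close; if
    it falls outside the chain, [q] is within [K] of an end, where the weight is small. *)
Lemma shift_coef (i j q K : nat) (D : R) : (i + j <= K)%N -> 0 <= D -> (q < h)%N ->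
  (forall p q', (p <= q' + K)%N -> (q' <= p + K)%N -> t p <= t q' + D) ->
  (forall q', (q' <= K)%N || (h - q' <= K)%N -> t q' <= D) ->
  `|\sum_(p < h) (if (i + p == j + q)%N then Num.sqrt (t p) * Num.sqrt (t q) else 0) - t q| <= D.
Proof.
move=> ijK D0 qh lip edge.
have [pex|pn] := boolP ((i <= j + q)%N && (j + q - i < h)%N).
  have /andP[ip ph] := pex; pose p := Ordinal ph.
  rewrite (bigD1 p)//= subnKC// eqxx big1 ?addr0 => [|p' pp].
    by apply: geo_mean; rewrite ?t0//; apply: lip; lia.
  case: eqP => // pe; move: pp; rewrite -val_eqE /=; lia.
rewrite big1 => [|p _].
  by rewrite sub0r normrN ger0_norm// edge//; lia.
by case: eqP => // pe; have := ltn_ord p; lia.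
Qed.

(** As [u^p = u^-i u^(i + p)], covariance undoes [beta^(i + p)] on [a], and the surplus [u^q]
    carries [s] to [alpha^q s]. *)
Lemma cell_monomial (p q : 'I_h) i a j : (i + p = j + q)%N ->
  u ^+ nat_of_ord p * iota (iter (i + p) beta a * s) * star (u ^+ nat_of_ord q) =
  mono iota u ((i, a), j) * iota (iter q alpha s).
Proof.
move=> ipq.
have ab k x : iter k alpha (iter k beta x) = x.
  by elim: k x => // k IH x; rewrite iterSr [iter k.+1 beta x]iterS ba IH.
have uu := starX_mulX cov; have uu' := mulX_starX cov.
have -> : u ^+ nat_of_ord p = star (u ^+ i) * u ^+ (i + p) by rewrite exprD mulrA uu mul1r.
rewrite (iotaM cov) !mulrA -(mulrA (star _)) (covX cov) ab ipq exprD /mono /=.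
rewrite -!mulrA; congr (_ * (_ * (_ * _))).
by rewrite mulrA (covX cov) -mulrA uu' mulr1.
Qed.

Variable Phi : forall i, bopc 'I_h (E i) -> B.
Variables (K : nat) (D eta e1 e2 : R) (i0 j0 : nat) (a : A).
Hypotheses (ijK : (i0 + j0 <= K)%N) (D0 : 0 <= D) (eta0 : 0 <= eta) (e10 : 0 <= e1) (e20 : 0 <= e2).
Hypothesis lip : forall p q, (p <= q + K)%N -> (q <= p + K)%N -> t p <= t q + D.
Hypothesis edge : forall q, (q <= K)%N || (h - q <= K)%N -> t q <= D.
Hypothesis PhiE : forall i Y, nrm (Phi Y - \sum_p \sum_p' u ^+ nat_of_ord p *
  iota (g * phi (ent Y p p' : E i) * g) * star (u ^+ nat_of_ord p')) <= eta * nrm Y.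
Local Notation Psi i := (compress (psi i \o Ex) wt).
Hypothesis Psi_nrm : forall i x, nrm (Psi i x) <= nrm x.
Hypothesis approx : forall p : 'I_h,
  nrm (\sum_i phi (psi i (iter (i0 + p) beta a)) - iter (i0 + p) beta a) <= e1.
Hypothesis comm : forall p : 'I_h,
  nrm (g * iter (i0 + p) beta a - iter (i0 + p) beta a * g) <= e2.

Lemma mono_nrm i x j : nrm (mono iota u ((i, x), j)) <= nrm x.
Proof.
rewrite /mono /= -[leRHS]mulr1 -[X in X * 1]mul1r; apply: nrmM_le; last exact: (u_nrm cov).
by apply: nrmM_le; [rewrite nrm_star; exact: (u_nrm cov)|exact: (iota_nrm cov)].
Qed.

(** Three replacements, one for each error term: [Phi] by its explicit formula ([T2]); [phi] after
    [psi] by the identity, together with moving [g] to the right, at the [h^2] entries ([T3]); the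
    shifted weights by [t]. *)
Lemma cell_estimate : nrm (\sum_i Phi (Psi i (mono iota u ((i0, a), j0))) -
    mono iota u ((i0, a), j0) * iota (\sum_(q < h) t q *^ iter q alpha s)) <=
  #|I|%:R * eta * nrm a + h%:R * h%:R * (e1 + e2) + 3 * D * nrm a.
Proof.
set b := mono iota u _; have bn : nrm b <= nrm a by exact: mono_nrm.
pose V x := \sum_i phi (psi i x).
have Vl : linear V.
  move=> c x y; rewrite /V scaler_sumr -big_split; apply: eq_bigr => i _.
  by rewrite psil phil.
pose y (p q : 'I_h) := Ex (star (wt p) * b * wt q).
pose T2 := \sum_p \sum_q u ^+ nat_of_ord p * iota (g * V (y p q) * g) * star (u ^+ nat_of_ord q).
pose T3 := \sum_p \sum_q u ^+ nat_of_ord p * iota (y p q * s) * star (u ^+ nat_of_ord q).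
have h1 : nrm (\sum_i Phi (Psi i b) - T2) <= #|I|%:R * eta * nrm a.
  have -> : T2 = \sum_i \sum_p \sum_q u ^+ nat_of_ord p *
      iota (g * phi (ent (Psi i b) p q) * g) * star (u ^+ nat_of_ord q).
    rewrite [RHS]exchange_big; apply: eq_bigr => p _; rewrite [RHS]exchange_big.
    apply: eq_bigr => q _; rewrite /V mulr_sumr mulr_suml (linf_sum _ _ _ (iotal cov)).
    by rewrite mulr_sumr mulr_suml; apply: eq_bigr => i _; rewrite ent_mxop.
  rewrite -sumrB; apply: le_trans (nrm_sum _ _ _) _.
  apply: (@le_trans _ _ (\sum_(i : I) eta * nrm a)).
    apply: ler_sum => i _; apply: le_trans (PhiE _) _; apply: ler_wpM2l => //.
    exact: le_trans (Psi_nrm _ _) _.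
  by rewrite sumr_const -[_ *+ _]mulr_natl mulrA.
have gn : nrm g <= 1 by exact: csqrt_nrm1.
have gg' : g * g = s by case: (csqrtP Ps).
have h2 : nrm (T2 - T3) <= h%:R * h%:R * (e1 + e2).
  rewrite -sumrB; apply: le_trans (nrm_sum _ _ _) _.
  apply: (@le_trans _ _ (\sum_(p < h) \sum_(q < h) (e1 + e2))); last first.
    by rewrite !sumr_const card_ord -mulrnA -[_ *+ _]mulr_natl natrM.
  apply: ler_sum => p _; rewrite -sumrB; apply: le_trans (nrm_sum _ _ _) _.
  apply: ler_sum => q _; rewrite -mulrBl -mulrBr -(linfB _ _ (iotal cov)).
  rewrite -[leRHS]mulr1; apply: nrmM_le; last by rewrite nrm_star; exact: (u_nrm cov).
  rewrite -[leRHS]mul1r; apply: nrmM_le; first exact: (u_nrm cov).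
  apply: le_trans (iota_nrm cov _) _; rewrite /y wt_mono.
  case: eqP => _; last first.
    by rewrite (linf0 Vl) mulr0 !mul0r subrr nrm0 addr_ge0.
  set x := iter _ _ _; set c := Num.sqrt _ * _.
  have c01 : 0 <= c <= 1.
    have st r : 0 <= Num.sqrt (t r) <= 1.
      by rewrite sqrtr_ge0 /= -sqrtr1 ler_sqrt ?ltr01.
    by have /andP[? ?] := st p; have /andP[? ?] := st q; rewrite /c; nra.
  rewrite (linfZ _ _ Vl).
  rewrite -[X in _ - _ * X]gg'; set gs : A := g in gn *; set Vx : A := V x.
  have -> : gs * (c *^ Vx) * gs - c *^ x * (gs * gs) =
      c *^ (gs * (Vx - x) * gs + (gs * x - x * gs) * gs) by nc.
  rewrite nrmZr ger0_norm; last by case/andP: c01.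
  rewrite -[leRHS]mul1r; apply: ler_pM; rewrite ?nrm_ge0//; [by case/andP: c01|by case/andP: c01|].
  apply: le_trans (nrmD _ _) _; apply: lerD.
    rewrite -[leRHS]mulr1; apply: nrmM_le => //; rewrite -[leRHS]mul1r.
    by apply: nrmM_le => //; exact: approx.
  by rewrite -[leRHS]mulr1; apply: nrmM_le => //; exact: comm.
pose c q := \sum_(p < h) (if (i0 + p == j0 + q)%N then Num.sqrt (t p) * Num.sqrt (t q) else 0).
have h3 : T3 = b * iota (\sum_(q < h) c q *^ iter q alpha s).
  rewrite /T3 exchange_big (linf_sum _ _ _ (iotal cov)) mulr_sumr; apply: eq_bigr => q _ /=.
  rewrite (linfZ _ _ (iotal cov)) scAr /c rmorph_sum scaler_suml; apply: eq_bigr => p _ /=.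
  rewrite /y wt_mono; case: eqP => pq; last first.
    by rewrite mul0r (linf0 (iotal cov)) mulr0 mul0r scale0r.
  by rewrite scAl (linfZ _ _ (iotal cov)) scAr scAl (cell_monomial _ pq).
have h4 : nrm (T3 - b * iota (\sum_(q < h) t q *^ iter q alpha s)) <= 3 * D * nrm a.
  rewrite h3 -mulrBr -(linfB _ _ (iotal cov)) -sumrB mulrC; apply: nrmM_le => //.
  apply: le_trans (iota_nrm cov _) _.
  under eq_bigr do rewrite -scalerBl -rmorphB.
  have itP q : Pcone (iter q alpha s).
    by apply: cpf_pos => //; apply: star_hom_cpf; exact: star_hom_iter.
  apply: le_trans (real_comb_nrm (c := fun q : 'I_h => c q - t q) (D := D) _ _ D0) _ => //.
    by move=> q; apply: (shift_coef ijK).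
  by rewrite -[leRHS]mulr1; apply: ler_wpM2l => //; rewrite mulr_ge0.
have := nrm_tri (\sum_i Phi (Psi i b)) T2 (b * iota (\sum_(q < h) t q *^ iter q alpha s)).
have := nrm_tri T2 T3 (b * iota (\sum_(q < h) t q *^ iter q alpha s)).
lra.
Qed.

End Cell.

(** * Choice of the tolerances, and assembly of the summands *)

Section Approximation.
Variable R : realType.

Lemma fin_min (I : finType) (d : I -> R) : (forall i, 0 < d i) ->
  exists2 e : R, 0 < e & forall i, e <= d i.
Proof.
move=> d0; exists (\big[Num.min/1]_i d i) => [|i]; last exact: bigmin_le.
by elim/big_ind: _ => // x y x0 y0; rewrite lt_min x0.
Qed.

(** [nuclear_approx] taken apart into components, over any finite type, so that the summands can be
    indexed by color, chain and summand of [A]. Bounds at 1 stand for contractivity. *)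
Definition approx_by (B : cstarType R) (I : finType) (F : seq B) (e : R) : Prop :=
  exists (E : I -> cstarType R) (psi : forall i, B -> E i) (phi : forall i, E i -> B),
  [/\ forall i, finite_dimensional (E i),
      forall i, [/\ linear (psi i), cpf (psi i) & nrm (psi i 1) <= 1],
      forall i, [/\ linear (@phi i), cpf (@phi i), order_zero (@phi i) & nrm (phi i 1) <= 1]
    & forall b, b \in F -> nrm (\sum_i phi i (psi i b) - b) <= e].

Lemma nuclear_approx_by (A : cstarType R) (n : nat) : nuclear_approx A n ->
  forall (F : seq A) (e : R), 0 < e -> approx_by 'I_n.+1 F e.
Proof.
move=> nA F e e0; have eC : 0 < e%:C by rewrite ltcR.
have [E [psi [phi [Efd psic /cpP[phil phip] ap oz]]]] := nA F e%:C eC.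
have [/cpP[psil psip] /contractiveP psin] := psic.
have pr_lin i : linear (fun x : dsum E => x i) by [].
have pr_cpf i : cpf (fun x : dsum E => x i) by exact: mult_star_cpf.
exists E, (fun i b => psi b i), (fun i => phi \o @dsum_inj R _ E i); split=> //.
- move=> i; have [h1 h2] := cp_comp psil psip (pr_lin i) (pr_cpf i); split=> //.
  apply: le_trans (dsum_nrm_ub _ _) _; apply: le_trans (psin 1) _; exact: nrm1_le.
- move=> i; have [[/cpP[h1 h2] /contractiveP h3] h4] := oz i; split=> //.
  by apply: le_trans (h3 1) _; exact: nrm1_le.
- move=> b bF; have := ap b bF; rewrite nrmE ltcR => /ltW; congr (_ <= _).
  by rewrite /= -(linf_sum _ _ _ phil) -dsum_dec.
Qed.

Lemma approx_by_nuclear (B : cstarType R) (n : nat) (I : finType) : #|I| = n.+1 ->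
  (forall (F : seq B) (e : R), 0 < e -> approx_by I F e) -> nuclear_approx B n.
Proof.
move=> In ap F eps; rewrite ltcE /= => /andP[/eqP eps_re eps0].
have [|E [psi [phi [Efd psip phip h]]]] := ap F (complex.Re eps / 2); first by lra.
have In' : n.+1 = #|I| by [].
pose j (i : 'I_n.+1) : I := enum_val (cast_ord In' i).
have jb : bijective j.
  exists (fun x => cast_ord In (enum_rank x)) => x; rewrite /j.
    by rewrite enum_valK cast_ord_comp cast_ord_id.
  by rewrite cast_ord_comp cast_ord_id enum_rankK.
pose Psi b : dsum (fun i => E (j i)) := fun i => psi (j i) b.
pose Phi (x : dsum (fun i => E (j i))) : B := \sum_i phi (j i) (x i).
have PhiJ i x : Phi (@dsum_inj R _ (fun i => E (j i)) i x) = phi (j i) x.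
  rewrite /Phi (bigD1 i)//= big1 => [|i' ii].
    by rewrite /dsum_inj dfwithin addr0.
  rewrite /dsum_inj dfwithout 1?eq_sym//; have [pl _ _ _] := phip (j i'); exact: linf0.
exists (fun i => E (j i)), Psi, Phi; split=> //.
- apply: cpcI.
  + move=> c x y; apply: functional_extensionality_dep => i.
    by have [pl _ _] := psip (j i); rewrite [LHS]pl.
  + move=> J a b; apply: dsum_Pcone => i.
    have [_ pp _] := psip (j i); have := pp J a (fun t => b t i); congr Pcone.
    by rewrite dsum_sumE; apply: eq_bigr => s _; rewrite dsum_sumE.
  + by apply: dsum_nrm_le => // i; have [] := psip (j i).
- apply/cpP; split=> [c x y|J a b].
    rewrite /Phi scaler_sumr -big_split; apply: eq_bigr => i _.
    by have [pl _ _ _] := phip (j i); exact: pl.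
  have -> : \sum_s \sum_t star (b s) * Phi (star (a s) * a t) * b t =
      \sum_i \sum_s \sum_t star (b s) * phi (j i) (star (a s i) * a t i) * b t.
    rewrite [RHS]exchange_big; apply: eq_bigr => s _.
    rewrite [RHS]exchange_big; apply: eq_bigr => t _.
    by rewrite /Phi mulr_sumr mulr_suml.
  by apply: Pcone_sum => i _; have [_ pp _ _] := phip (j i); exact: pp.
- have -> : eps = (complex.Re eps)%:C by case: eps eps_re {ap eps0 h} => x y /= ->.
  move=> b /h hb; rewrite nrmE ltcR; apply: le_lt_trans (_ : complex.Re eps / 2 < _); last by lra.
  by move: hb; rewrite (reindex j) //; exact: onW_bij.
- move=> i; have [pl pp po p1] := phip (j i).
  have -> : Phi \o @dsum_inj R _ (fun i => E (j i)) i = @phi (j i).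
    by apply/funext => x /=; exact: PhiJ.
  by split=> //; exact: cpcI.
Qed.

(** Four errors of [e / 4]: the slope of the weights, through [m]; the approximation of [A], through
    [e1]; the order zero correction, through [eta]; and the defect of the partition of unity,
    through [e']. *)
Lemma crossed_mono_approx (A : cstarType R) (alpha : A -> A) (B : cstarType R)
    (iota : A -> B) (u : B) (n d : nat) :
  star_automorphism alpha -> crossed_product alpha iota u ->
  nuclear_approx A n -> rokhlin_towers alpha d ->
  forall (T : seq ((nat * A) * nat)) (e : R), 0 < e ->
  approx_by ('I_d.+1 * 'I_3 * 'I_n.+1)%type [seq mono iota u t | t <- T] e.
Proof.
move=> aut cp nA rok T e e0; have [alphaH _] := aut; have cov := cp.1.
have [beta [Ex [betaH [ab ba] Exl [Exp Ex1] ExE]]] := crossed_expectation aut cp.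
pose M : R := 1 + \sum_(t <- T) nrm t.1.2.
have M1 : 1 <= M by rewrite lerDl sumr_ge0// => t _; exact: nrm_ge0.
have TM t : t \in T -> nrm t.1.2 <= M.
  move=> tT; rewrite /M (big_rem t tT) /= addrCA lerDl addr_ge0// sumr_ge0// => *; exact: nrm_ge0.
pose K := (\sum_(t <- T) (t.1.1 + t.2))%N.
have TK t : t \in T -> (t.1.1 + t.2 <= K)%N.
  by move=> tT; rewrite /K (big_rem t tT) /= leq_addr.
pose W : R := d.+1%:R * 3; have W1 : 3 <= W by rewrite ler_peMl// ler1n.
have W0 : 0 < W by lra.
have M0 : 0 < M by lra.
(* A monomial shifts levels by at most [K], over which a weight changes by at most [K / m]; [W] is
   the number of chains. *)
have [m m0 mP] : exists2 m : nat, (0 < m)%N & W * (3 * (K%:R / m%:R) * M) <= e / 4.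
  have q0 : 0 <= W * 3 * K%:R * M * 4 / e.
    by apply: divr_ge0; [rewrite !mulr_ge0// ltW|exact: ltW].
  have := archi_boundP q0; set m := Num.bound _ => hm; exists m.+1 => //.
  have mm : 0 < m.+1%:R :> R by [].
  have h1 : W * 3 * K%:R * M * 4 <= e * m.+1%:R.
    rewrite [leRHS]mulrC -ler_pdivrMr//; apply: le_trans (ltW hm) _.
    by rewrite ler_nat.
  have -> : W * (3 * (K%:R / m.+1%:R) * M) = (W * 3 * K%:R * M) / m.+1%:R.
    by move: (m.+1%:R^-1) => x; ring.
  by rewrite ler_pdivrMr//; lra.
pose H := (m + m).+1; pose HH : R := H%:R.
have HH1 : 1 <= HH by rewrite ler1n.
have hH c : (height m c <= H)%N by rewrite /height /H; case: ifP.
(* All the elements of [A] that occur, up to a scalar, as entries of compressed monomials. *)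
pose F1 : seq A := flatten [seq [seq iter (t.1.1 + p) beta t.1.2 | p <- seq.iota 0 H] | t <- T].
have itF t (c : 'I_3) (p : 'I_(height m c)) : t \in T -> iter (t.1.1 + p) beta t.1.2 \in F1.
  move=> tT; apply/flattenP; exists [seq iter (t.1.1 + p) beta t.1.2 | p <- seq.iota 0 H].
    by apply/mapP; exists t.
  by apply/mapP; exists (p : nat); rewrite // mem_iota /= add0n (leq_trans (ltn_ord p)).
have F1M x : x \in F1 -> nrm x <= M.
  move=> /flattenP[_ /mapP[t tT ->] /mapP[p _ ->]]; apply: le_trans (TM t tT).
  by apply: star_hom_nrm; exact: star_hom_iter.
pose e1 := e / (8 * W * (HH * HH)).
have e10 : 0 < e1 by rewrite divr_gt0// !mulr_gt0//; lra.
pose eta := e / (4 * W * n.+1%:R * M).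
have eta0 : 0 < eta by rewrite divr_gt0// !mulr_gt0.
have [E0 [psi [phi [Efd psiP phiP ap]]]] := nuclear_approx_by nA F1 e10.
have tw (x : 'I_3 * 'I_n.+1) : exists dF : R * seq A, 0 < dF.1 /\ forall s : A, Pcone s -> nrm s <= 1 ->
    nrm (\sum_(p < height m x.1) iter p alpha s) <= 1 ->
    (forall k, (0 < k < height m x.1)%N -> nrm (s * iter k alpha s) <= dF.1) ->
    (forall a, a \in dF.2 -> nrm (s * a - a * s) <= dF.1) ->
    exists Phi : bopc 'I_(height m x.1) (E0 x.2) -> B,
    [/\ linear Phi, cpf Phi, order_zero Phi, nrm (Phi 1) <= 1
      & forall Y, nrm (Phi Y - \sum_p \sum_p'
          u ^+ nat_of_ord p * iota (csqrt s * phi x.2 (ent Y p p') * csqrt s) * star (u ^+ nat_of_ord p'))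
        <= eta * nrm Y].
  have [h1 h2 h3 h4] := phiP x.2.
  have [dd [F [dd0 hF]]] := order_zero_tower alphaH cov (Efd x.2) h1 h2 h3 h4 (height m x.1) eta0.
  by exists (dd, F).
pose dF x := projT1 (cid (tw x)).
have dFP x := projT2 (cid (tw x)).
have [d0 d00 d0P] := @fin_min _ (fun x => (dF x).1) (fun x => (dFP x).1).
have [d1 d10 d1P] := csqrt_comm_unif e10 (ltW M0).
(* [d0] serves [order_zero_tower] for all chains and summands, [d1] the commutators of [csqrt s]
   with [F1], and the last term the partition of unity. *)
pose e' := Num.min d0 (Num.min d1 (e / (4 * M))).
have e'0 : 0 < e' by rewrite !lt_min d00 d10 divr_gt0// mulr_gt0.
pose F : seq A := F1 ++ flatten [seq (dF x).2 | x <- enum {: 'I_3 * 'I_n.+1}].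
have [s [sP sS sO sC sE]] := rokhlin_chains alphaH rok F m0 e'0.
have Phi_ex l (c : 'I_3) (i : 'I_n.+1) : exists Phi : bopc 'I_(height m c) (E0 i) -> B,
    [/\ linear Phi, cpf Phi, order_zero Phi, nrm (Phi 1) <= 1
      & forall Y, nrm (Phi Y - \sum_p \sum_p'
          u ^+ nat_of_ord p * iota (csqrt (s l c) * phi i (ent Y p p') * csqrt (s l c)) * star (u ^+ nat_of_ord p'))
        <= eta * nrm Y].
  have [_ h] := dFP (c, i); have [s0 s1] := sP l c; apply: (h _ s0 s1 (sS l c)).
    move=> k kh; apply: le_trans (sO l c k kh) _.
    by apply: le_trans (d0P (c, i)); rewrite ge_min lexx.
  move=> a aF; apply: le_trans (sC l c a _) _.
    rewrite mem_cat; apply/orP; right; apply/flattenP; exists (dF (c, i)).2 => //.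
    by apply: map_f; rewrite mem_enum.
  by apply: le_trans (d0P (c, i)); rewrite ge_min lexx.
pose Phi l c i := projT1 (cid (Phi_ex l c i)).
have PhiP l c i := projT2 (cid (Phi_ex l c i)).
pose tn (c q : nat) : R := tent R m (height m c) q.
pose Psi (c : 'I_3) i : B -> bopc 'I_(height m c) (E0 i) := compress (psi i \o Ex) (wt u (tn c) (h := height m c)).
have PsiP c i : [/\ linear (Psi c i), cpf (Psi c i) & nrm (Psi c i 1) <= 1].
  have [pl pp p1] := psiP i; have [cl cc] := cp_comp Exl Exp pl pp.
  split; [exact: compress_linear|exact: compress_cpf|].
  apply: (compress_nrm1 cc (c := fun p => tn c p *^ psi i 1)) => [p q|p]; last first.
    rewrite nrmZr ger0_norm ?tent_ge0// -[leRHS]mulr1.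
    by apply: ler_pM; rewrite ?tent_ge0 ?nrm_ge0 ?tent_le1.
  have [iH _ _ _] := cov; have [_ [i1 _] _] := iH.
  have -> : star (wt u (tn c) p) * wt u (tn c) q =
      star (wt u (tn c) p) * mono iota u ((0%N, 1), 0%N) * wt u (tn c) q.
    by rewrite /mono /= !expr0 star1 i1 !mulr1.
  rewrite /= (wt_mono Exl ExE) !add0n; case: (eqVneq p q) => [->|pq].
    rewrite eqxx (linfZ _ _ pl) -expr2 sqr_sqrtr ?tent_ge0//.
    by have [_ [-> _] _] := star_hom_iter q betaH.
  by rewrite val_eqE (negbTE pq) linf0.
exists (fun x : 'I_d.+1 * 'I_3 * 'I_n.+1 => bopc 'I_(height m x.1.2) (E0 x.2)), (fun x => Psi x.1.2 x.2), (fun x => Phi x.1.1 x.1.2 x.2).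
split=> //.
- by move=> x; exact: fd_mx.
- by move=> [[l c] i] /=; have [h1 h2 h3 h4 _] := PhiP l c i.
move=> _ /mapP[[[i0 a] j0] tT ->]; set b := mono iota u _.
have ijK := TK _ tT; have aM := TM _ tT; rewrite /= in ijK aM.
pose D : R := K%:R / m%:R; have D0 : 0 <= D by rewrite divr_ge0.
pose Z l (c : 'I_3) := \sum_(q < height m c) tn c q *^ iter q alpha (s l c).
have cell l c : nrm (\sum_i Phi l c i (Psi c i b) - b * iota (Z l c)) <=
    n.+1%:R * eta * M + HH * HH * (e1 + e1) + 3 * D * M.
  have [s0 s1] := sP l c.
  apply: le_trans (cell_estimate alphaH cp ba Exl ExE (E := E0) (psi := psi) (phi := phi)
    _ _ (t := tn c) (s := s l c) _ _ s0 s1 (sS l c) (Phi := Phi l c) (K := K) (D := D)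
    (eta := eta) (e1 := e1) (e2 := e1) ijK D0 (ltW eta0) (ltW e10) (ltW e10) _ _ _ _ _ _) _.
  - by move=> i; case: (psiP i).
  - by move=> i; case: (phiP i).
  - by move=> q; exact: tent_ge0.
  - by move=> q; exact: tent_le1.
  - by move=> p q; exact: tent_lip.
  - by move=> q; exact: tent_edge.
  - by move=> i Y; have [_ _ _ _] := PhiP l c i; apply.
  - by move=> i x; have [h1 h2 h3] := PsiP c i; exact: cp_contractive.
  - by move=> p; apply: ap; exact: (itF ((i0, a), j0)).
  - move=> p; have xF := itF ((i0, a), j0) c p tT; apply: d1P => //; first exact: F1M.
    apply: le_trans (sC l c _ _) _; first by rewrite mem_cat xF.
    by rewrite !ge_min lexx orbT.
  - rewrite card_ord; apply: lerD; first apply: lerD.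
    + by apply: ler_wpM2l => //; rewrite mulr_ge0// ltW.
    + apply: ler_wpM2r; first by rewrite addr_ge0// ltW.
      by apply: ler_pM => //; rewrite ler_nat.
    + by apply: ler_wpM2l => //; rewrite mulr_ge0.
have bM : nrm b <= M by apply: le_trans aM; exact: (mono_nrm cp).
have tot : nrm (b * iota (\sum_(l < d.+1) \sum_(c < 3) Z l c) - b) <= e / 4.
  have [iH _ _ _] := cov; have [_ [i1 _] _] := iH.
  rewrite -[X in _ - X]mulr1 -i1 -mulrBr -(linfB _ _ (iotal cov)).
  have -> : e / 4 = M * (e / (4 * M)) by field; rewrite gt_eqF.
  apply: nrmM_le => //; apply: le_trans (iota_nrm cov _) _; apply: le_trans sE _.
  by rewrite !ge_min lexx !orbT.
have E1 : \sum_(x : 'I_d.+1 * 'I_3 * 'I_n.+1) Phi x.1.1 x.1.2 x.2 (Psi x.1.2 x.2 b) =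
    \sum_(l < d.+1) \sum_(c < 3) \sum_i Phi l c i (Psi c i b).
  by rewrite [RHS]pair_bigA [RHS]pair_bigA.
rewrite E1; set S := \sum_(l < d.+1) _.
have h1 : nrm (S - b * iota (\sum_(l < d.+1) \sum_(c < 3) Z l c)) <=
    W * (n.+1%:R * eta * M + HH * HH * (e1 + e1) + 3 * D * M).
  rewrite (linf_sum _ _ _ (iotal cov)) mulr_sumr /S -sumrB.
  apply: le_trans (nrm_sum _ _ _) _.
  set G := _ + 3 * D * M.
  apply: (@le_trans _ _ (\sum_(l < d.+1) 3 * G)); last first.
    by rewrite sumr_const card_ord -[_ *+ _]mulr_natl mulrA.
  apply: ler_sum => l _; rewrite (linf_sum _ _ _ (iotal cov)) mulr_sumr -sumrB.
  apply: le_trans (nrm_sum _ _ _) _.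
  apply: (@le_trans _ _ (\sum_(c < 3) G)); last first.
    by rewrite sumr_const card_ord -[_ *+ _]mulr_natl.
  by apply: ler_sum => c _; exact: cell.
have h2 : W * (n.+1%:R * eta * M + HH * HH * (e1 + e1) + 3 * D * M) <= e / 4 + e / 4 + e / 4.
  rewrite (mulrDr W) (mulrDr W); apply: lerD; last exact: mP.
  have N0 : 0 < n.+1%:R :> R by [].
  rewrite /eta /e1; move: (n.+1%:R) N0 => N N0.
  apply: lerD; rewrite le_eqVlt; apply/orP; left; apply/eqP; field; rewrite !gt_eqF//; lra.
apply: le_trans (nrm_tri _ (b * iota (\sum_(l < d.+1) \sum_(c < 3) Z l c)) _) _.
have -> : e = e / 4 + e / 4 + e / 4 + e / 4 by field.
by apply: lerD => //; exact: le_trans h1 h2.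
Qed.

(** The total map has norm at most the number [N] of summands, whatever the approximation. So each
    [b] can first be replaced by a polynomial, and the accuracy on monomials chosen after its
    length. *)
Lemma crossed_approx (A : cstarType R) (alpha : A -> A) (B : cstarType R)
    (iota : A -> B) (u : B) (n d : nat) :
  star_automorphism alpha -> crossed_product alpha iota u ->
  nuclear_approx A n -> rokhlin_towers alpha d ->
  forall (F : seq B) (e : R), 0 < e -> approx_by ('I_d.+1 * 'I_3 * 'I_n.+1)%type F e.
Proof.
move=> aut cp nA rok F e e0.
pose I := ('I_d.+1 * 'I_3 * 'I_n.+1)%type; pose N : R := #|{: I}|%:R.
have N0 : 0 <= N by [].
have e40 : 0 < e / (2 * (N + 1)) by rewrite divr_gt0// mulr_gt0//; lra.
have pF b : exists T : seq ((nat * A) * nat), nrm (b - monosum iota u T) <= e / (2 * (N + 1)).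
  by have [_ [T ->] h] := crossed_dense cp b e40; exists T; exact: ltW.
pose T b := projT1 (cid (pF b)).
have TP b : nrm (b - monosum iota u (T b)) <= e / (2 * (N + 1)) by exact: projT2 (cid (pF b)).
pose L : R := 1 + (\sum_(b <- F) size (T b))%:R.
have L0 : 0 < L by rewrite ltr_pwDl.
have eL0 : 0 < e / (2 * L) by rewrite divr_gt0// mulr_gt0.
have [E [psi [phi [Efd psiP phiP ap]]]] :=
  crossed_mono_approx aut cp nA rok (flatten [seq T b | b <- F]) eL0.
exists E, psi, phi; split=> // b bF.
pose V x := \sum_i phi i (psi i x).
have Vl : linear V.
  move=> c x y; rewrite /V scaler_sumr -big_split; apply: eq_bigr => i _.
  by have [pl _ _] := psiP i; have [fl _ _ _] := phiP i; rewrite pl fl.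
have Vn x : nrm (V x) <= N * nrm x.
  apply: le_trans (nrm_sum _ _ _) _; apply: (@le_trans _ _ (\sum_(i : I) nrm x)); last first.
    by rewrite sumr_const -[_ *+ _]mulr_natl.
  apply: ler_sum => i _; have [pl pp p1] := psiP i; have [fl fp _ f1] := phiP i.
  by apply: le_trans (cp_contractive fl fp f1 _) _; exact: cp_contractive.
set p := monosum iota u (T b).
have h1 : nrm (V p - p) <= e / 2.
  rewrite /p /monosum (linf_sum _ _ _ Vl) -sumrB; apply: le_trans (nrm_sum _ _ _) _.
  apply: (@le_trans _ _ (\sum_(t <- T b) e / (2 * L))).
    rewrite big_seq [leRHS]big_seq; apply: ler_sum => t tT; apply: ap.
    by apply: map_f; apply/flattenP; exists (T b) => //; exact: map_f.
  rewrite big_const_seq count_predT iter_addr_0 -[_ *+ _]mulr_natl.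
  have : (size (T b))%:R <= L.
    apply: le_trans (_ : (\sum_(b <- F) size (T b))%:R <= _); last by rewrite /L lerDr.
    by rewrite ler_nat (big_rem b bF) /= leq_addr.
  move=> h; have -> : e / 2 = L * (e / (2 * L)) by field; rewrite gt_eqF.
  by apply: ler_wpM2r => //; exact: ltW.
have h2 : nrm (V (b - p)) <= N * (e / (2 * (N + 1))).
  by apply: le_trans (Vn _) _; apply: ler_wpM2l => //; exact: TP.
have h3 : N * (e / (2 * (N + 1))) + e / (2 * (N + 1)) = e / 2.
  by field; rewrite gt_eqF//; lra.
have -> : \sum_i phi i (psi i b) - b = V (b - p) + (V p - p) - (b - p).
  rewrite (linfB _ _ Vl) -/(V b); nc.
apply: le_trans (nrmB _ _) _; have := nrmD (V (b - p)) (V p - p); have := TP b; rewrite -/p; lra.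
Qed.

End Approximation.

Lemma least_spec (P : nat -> Prop) n : least P = Some n -> P n.
Proof.
by rewrite /least; case: pselect => // ex [<-]; case: ex_minnP => m /asboolP.
Qed.

Lemma least_le (P : nat -> Prop) n : P n -> exists2 m, least P = Some m & (m <= n)%N.
Proof.
move=> Pn; rewrite /least; case: pselect => [ex|[]]; last by exists n; apply/asboolP.
by case: ex_minnP => m _ h; exists m => //; apply: h; apply/asboolP.
Qed.

Theorem theorem5p1 (R : realType) (A : cstarType R) (alpha : A -> A)
    (B : cstarType R) (iota : A -> B) (u : B) (n d : nat) :
  separable_space A ->
  star_automorphism alpha ->
  crossed_product alpha iota u ->
  dim_nuc A = Some n ->
  dim_Rok alpha = Some d ->
  exists m : nat,
    dim_nuc B = Some m /\ (m <= 4 * (d + 1) * (n + 1) - 1)%N.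
Proof.
move=> _ aut cp /least_spec nA /least_spec rok.
(* [nuclear_approx] at [n] has [n + 1] summands, hence the predecessor. The dimension is at most
   [3 (d + 1) (n + 1) - 1], within the stated bound. *)
have cardI : #|{: 'I_d.+1 * 'I_3 * 'I_n.+1}| = (d.+1 * 3 * n.+1).-1.+1.
  by rewrite !card_prod !card_ord prednK.
have [m mB mle] := least_le (approx_by_nuclear cardI (crossed_approx aut cp nA rok)).
exists m; split=> //; apply: leq_trans mle _; nia.
Qed.
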